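(* Let $\Omega_2\subset\mathbb{C}^m$ be a bounded homogeneous domain with Bergman metric $g_{B_2}$. Then there is a constant $C>0$ depending only on $\Omega_2$ such that for every bounded domain $\Omega_1\subset\mathbb{C}^n$ with Bergman metric $g_{B_1}$ and every holomorphic map $f:\Omega_1\to\Omega_2$, $$f^*g_{B_2}\le C\,g_{B_1},$$ i.e. $g_{B_2}(df(X),df(X))\le C\,g_{B_1}(X,X)$ for all $z\in\Omega_1$ and $X\in T^{1,0}_z\Omega_1$.
   Context: A bounded domain is homogeneous if its group of biholomorphic self-maps acts transitively on it. For a bounded domain $\Omega\subset\mathbb{C}^n$, $A^2(\Omega)$ is the Hilbert space of holomorphic functions on $\Omega$ that are square integrable for Lebesgue measure. The Bergman kernel is $\mathcal{B}(z,\xi)=\sum_j\phi_j(z)\overline{\phi_j(\xi)}$ for any orthonormal basis $\{\phi_j\}$ of $A^2(\Omega)$, and $\mathcal{B}(z,z)>0$. The Bergman metric is $g_B(X,Y)=\sum_{j,k}\frac{\partial^2\log\mathcal{B}(z,z)}{\partial z_j\partial\bar z_k}X_j\overline{Y_k}$ for $X,Y\in T^{1,0}_z\Omega\cong\mathbb{C}^n$; it is positive definite. *)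

(* Defs.v *)
From HB Require Import structures.
From mathcomp Require Import all_boot all_order all_algebra.
From mathcomp Require Import complex.
From mathcomp Require Import all_classical all_reals all_analysis.

Set Implicit Arguments.
Unset Strict Implicit.
Unset Printing Implicit Defensive.

Import Order.TTheory GRing.Theory Num.Theory.
Import numFieldNormedType.Exports.

Local Open Scope classical_set_scope.
Local Open Scope ring_scope.
Local Open Scope complex_scope.

(* The instances of numFieldNormedType are keyed on abstract fields and are not
   found for R[i]. *)
HB.instance Definition _ (R : rcfType) := NormedModule.copy R[i] R[i]^o.

(* m1 \x m2 is canonically a measure, but type inference does not find a
   sigma-finite structure on it, which is needed to iterate the product. *)
Section sf_product.
Context d1 d2 (T1 : measurableType d1) (T2 : measurableType d2) (R : realType).
Variable m1 : {sigma_finite_measure set T1 -> \bar R}.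
Variable m2 : {sigma_finite_measure set T2 -> \bar R}.

Definition sf_product : set (T1 * T2) -> \bar R := (m1 \x m2)%E.

HB.instance Definition _ := Measure.on sf_product.

Lemma sf_product_sigma_finite : sigma_finite setT sf_product.
Proof.
have /sigma_finiteP[F [TF ndF Foo]] := sigma_finiteT m1.
have /sigma_finiteP[G [TG ndG Goo]] := sigma_finiteT m2.
exists (fun n => F n `*` G n).
  rewrite -setXTT TF TG predeqE => -[x y]; split.
    move=> [/= [n _ Fnx] [k _ Gky]]; exists (maxn n k) => //; split.
    - by move: x Fnx; exact/subsetPset/ndF/leq_maxl.
    - by move: y Gky; exact/subsetPset/ndG/leq_maxr.
  by move=> [n _ []/= ? ?]; split; exists n.
move=> k; have [? ?] := Foo k; have [? ?] := Goo k.
split; first exact: measurableX.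
by rewrite /sf_product product_measure1E// lte_mul_pinfty// ge0_fin_numE.
Qed.

HB.instance Definition _ := @Measure_isSigmaFinite.Build _ _ _
  sf_product sf_product_sigma_finite.

End sf_product.

Section product_power.
Context d (T : measurableType d) (R : realType).

Definition cons_pair k (p : T * k.-tuple T) : k.+1.-tuple T :=
  [tuple of p.1 :: p.2].

Definition uncons_pair k (t : k.+1.-tuple T) : T * k.-tuple T :=
  (thead t, [tuple of behead t]).

Lemma cons_pairK k : cancel (@cons_pair k) (@uncons_pair k).
Proof.
move=> [x t]; rewrite /uncons_pair theadE/=; congr pair.
exact/val_inj.
Qed.

Lemma uncons_pairK k : cancel (@uncons_pair k) (@cons_pair k).
Proof. by move=> t; rewrite [in RHS](tuple_eta t). Qed.

Lemma measurable_cons_pair k : measurable_fun setT (@cons_pair k).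
Proof. exact: measurable_cons. Qed.

Lemma measurable_uncons_pair k : measurable_fun setT (@uncons_pair k).
Proof.
apply: measurable_fun_pair; first exact: measurable_tnth.
exact: measurable_behead.
Qed.

Section cons_measure.
Variables (k : nat) (mu : {sigma_finite_measure set T -> \bar R}).
Variable (nu : {sigma_finite_measure set (k.-tuple T) -> \bar R}).

Definition cons_measure : set (k.+1.-tuple T) -> \bar R :=
  pushforward (sf_product mu nu) (@cons_pair k).

HB.instance Definition _ := Measure.copy cons_measure
  (measure_function_pushforward__canonical__measure_function_Measure
    (sf_product mu nu) (@measurable_cons_pair k)).

Lemma cons_measure_sigma_finite : sigma_finite setT cons_measure.
Proof.
have [F FT Foo] := @sigma_finiteT _ _ _ (sf_product mu nu).
exists (fun i => @uncons_pair k @^-1` F i) => [|i].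
  by rewrite -preimage_bigcup -FT preimage_setT.
have [mF mFoo] := Foo i; split.
  by rewrite -[X in measurable X]setTI; exact: measurable_uncons_pair.
rewrite /cons_measure /pushforward -comp_preimage.
by rewrite (_ : _ \o _ = id) ?preimage_id//; apply/funext => p /=;
  rewrite cons_pairK.
Qed.

HB.instance Definition _ := @Measure_isSigmaFinite.Build _ _ _
  cons_measure cons_measure_sigma_finite.

End cons_measure.

Fixpoint measure_power (mu : {sigma_finite_measure set T -> \bar R}) k :
    {sigma_finite_measure set (k.-tuple T) -> \bar R} :=
  if k is k'.+1 then cons_measure mu (measure_power mu k')
  else (\d_ [tuple of [::]] : set (0.-tuple T) -> \bar R).

End product_power.

Section bergman.
Variable R : realType.
Local Notation C := R[i].

Definition lebesgue_measure_C :=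
  sf_product (@lebesgue_measure R) (@lebesgue_measure R).

Definition lebesgue_measure_Cn n := measure_power lebesgue_measure_C n.

(* Integrals over subsets of C^n are taken over their preimages by this
   bijection from (R x R)^n. *)
Definition toCn n (x : n.-tuple (measurableTypeR R * measurableTypeR R)) :
    'rV[C]_n :=
  \row_(j < n) ((tnth x j).1 +i* (tnth x j).2).

Definition domain n (Omega : set 'rV[C]_n) :=
  [/\ Omega !=set0, open Omega & connected Omega].

Definition bounded_domain n (Omega : set 'rV[C]_n) :=
  domain Omega /\ bounded_set Omega.

Definition holomorphic_on n (V : normedModType C) (Omega : set 'rV[C]_n)
    (f : 'rV[C]_n -> V) :=
  forall z, Omega z -> differentiable f z.

Definition biholomorphic_self_map n (Omega : set 'rV[C]_n)
    (f : 'rV[C]_n -> 'rV[C]_n) :=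
  exists g : 'rV[C]_n -> 'rV[C]_n,
    [/\ holomorphic_on Omega f, holomorphic_on Omega g,
        (forall z, Omega z -> Omega (f z) /\ g (f z) = z) &
        (forall z, Omega z -> Omega (g z) /\ f (g z) = z)].

Definition homogeneous n (Omega : set 'rV[C]_n) :=
  forall p q, Omega p -> Omega q ->
    exists2 f, biholomorphic_self_map Omega f & f p = q.

Section A2.
Variables (n : nat) (Omega : set 'rV[C]_n).
Local Notation mu := (lebesgue_measure_Cn n).
Local Notation D := (@toCn n @^-1` Omega).

Definition L2_sqnorm (f : 'rV[C]_n -> C) : \bar R :=
  (\int[mu]_(x in D) (complex.Re (`|f (toCn x)| ^+ 2))%:E)%E.

Definition L2_dot (f g : 'rV[C]_n -> C) : C :=
  (\int[mu]_(x in D) complex.Re (f (toCn x) * (g (toCn x))^* )%C) +i*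
  (\int[mu]_(x in D) complex.Im (f (toCn x) * (g (toCn x))^* )%C).

Definition A2 (f : 'rV[C]_n -> C) :=
  holomorphic_on Omega f /\ (L2_sqnorm f < +oo)%E.

(* For n > 0 and Omega bounded, open and nonempty, A^2(Omega) contains the
   polynomials, so that its orthonormal bases are infinite sequences. *)
Definition orthonormal_basis (phi : nat -> 'rV[C]_n -> C) :=
  [/\ forall j, A2 (phi j),
      forall j k, L2_dot (phi j) (phi k) = (j == k)%:R &
      forall f, A2 f ->
        L2_sqnorm (fun z => f z - \sum_(j < N) L2_dot f (phi j) * phi j z)
          @[N --> \oo] --> 0%E].

(* The kernel does not depend on the basis; one is selected by choice. *)
Definition bergman_basis : nat -> 'rV[C]_n -> C :=
  xget (fun=> fun=> 0) [set phi | orthonormal_basis phi].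

Definition bergman_kernel (z xi : 'rV[C]_n) : C :=
  lim ((\sum_(j < N) bergman_basis j z * (bergman_basis j xi)^*%C)
    @[N --> \oo]).

End A2.

(* d/dt at t = 0, t real, of u (z + t v); taken on real and imaginary parts
   since C is only declared as a normed space over itself. *)
Definition real_derive n (v : 'rV[C]_n) (u : 'rV[C]_n -> C)
    (z : 'rV[C]_n) : C :=
  derive1 (fun t : R => complex.Re (u (z + t%:C *: v))) 0 +i*
  derive1 (fun t : R => complex.Im (u (z + t%:C *: v))) 0.

(* Wirtinger operators d/dz_j = (d/dx_j - i d/dy_j) / 2 and
   d/dzbar_j = (d/dx_j + i d/dy_j) / 2. *)
Definition wirtinger n (j : 'I_n) (u : 'rV[C]_n -> C) (z : 'rV[C]_n) : C :=
  (real_derive (delta_mx 0 j) u z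
   - 'i%C * real_derive ('i%C *: delta_mx 0 j) u z) / 2.

Definition wirtinger_bar n (j : 'I_n) (u : 'rV[C]_n -> C) (z : 'rV[C]_n) : C :=
  (real_derive (delta_mx 0 j) u z
   + 'i%C * real_derive ('i%C *: delta_mx 0 j) u z) / 2.

Definition bergman_metric n (Omega : set 'rV[C]_n) (z X Y : 'rV[C]_n) : C :=
  let log_kernel w := (ln (complex.Re (bergman_kernel Omega w w)))%:C in
  \sum_(j < n) \sum_(k < n)
    wirtinger j (wirtinger_bar k log_kernel) z * X 0 j * (Y 0 k)^*%C.

End bergman.

(* Main.v *)
(* Every f in A^2(Omega) has values and derivatives f(w), d_X f(w) bounded by its norm, so these
   functionals are represented by k_w, d_{w,X} in A^2(Omega). Then B(w,w) = |k_w|^2, and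
   differentiating the inner products <k_w, k_w> and <d_{w,X}, k_w> gives
     g_B(X,X) = |d_X|^2 / |k|^2 - |<d_X, k>|^2 / |k|^4 = |e|^2 / |k|^2,
   where e is the component of d_X orthogonal to k; <f, e> is d_X f(w) whenever f(w) = 0.

   Lower bound on Omega_1: if h maps Omega_1 to the unit disc and h(z) = 0, then
   f = h k_z has norm at most |k_z|, and Cauchy-Schwarz for <f, e> gives |d_X h|^2 <= g_{B_1}(X,X).

   Upper bound on Omega_2: let phi be an automorphism sending q to a fixed point p, and psi its
   inverse. The change of variables f |-> (f o psi) det psi' is bounded on A^2(Omega_2), with a norm
   depending only on the dimension. Applied to e, with the bound for derivatives at p, and to the
   constant 1, with the value at q, it gives g_{B_2}(Y,Y) <= C |phi'(q) Y|^2. A coordinate of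
   phi o f, rescaled, is an admissible h, which compares the two bounds.

   An orthonormal basis of A^2(Omega) is obtained from the subspaces H_k of functions vanishing at
   the first k points of a dense sequence: the element of least norm in H_k with value 1 at the
   next point is orthogonal to H_{k+1}. *)
From HB Require Import structures.
Require Import Defs.
From mathcomp Require Import all_boot all_order all_algebra.
From mathcomp Require Import perm complex.
From mathcomp Require Import all_classical all_reals all_analysis measurable_realfun.
From mathcomp Require Import ring lra.
Import Order.TTheory GRing.Theory Num.Theory.
Import numFieldNormedType.Exports.
Local Open Scope classical_set_scope.
Local Open Scope ring_scope.
Local Open Scope complex_scope.

Set Implicit Arguments.
Unset Strict Implicit.
Unset Printing Implicit Defensive.

(** * Closed forms on rectangles *)

(** Differentiability is assumed point by point, with no continuity of the derivative, so Cauchy's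
    theory starts from Goursat's bisection, applied to [f] composed with the exponential: a circle
    becomes a vertical side of a rectangle and the mean value property follows. It yields Cauchy's
    estimate, Taylor bounds with quadratic remainder and, by rotating polydiscs, the L2 bound for
    point values on which all bounded functionals rest.

    The change of variables is an inequality with factor 4 ^ (dimension). This suffices because the
    transport is used in both directions, along psi for e and along phi for the constant 1: the
    Jacobian determinants at p and at q are inverse to each other and cancel in the product of the
    two estimates, so the constant is independent of q.

    Representers are differentiated along real lines, with a remainder quadratic in norm; therefore
    second derivatives at a point must be bounded functionals too. *)

Section segment_integral.
Context {R : realType}.
Local Notation leb := (@lebesgue_measure R).

Definition integ (a b : R) (f : R -> R) : R := \int[leb]_(x in `[a, b]) f x.

Definition cts_on (a b : R) (f : R -> R) := {within `[a, b], continuous f}.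

Lemma cts_onP (a b : R) (f : R -> R) :
  (forall x, a <= x <= b -> forall e, 0 < e -> exists2 d, 0 < d &
    forall y, a <= y <= b -> `|y - x| < d -> `|f y - f x| <= e) ->
  cts_on a b f.
Proof.
move=> H; apply/subspace_continuousP => x; rewrite /= in_itv /= => xab.
apply/cvgrPdist_le => e e0; have [d d0 Hd] := H _ xab _ e0.
rewrite near_withinE; apply/nbhs_ballP; exists d => //= y /=.
rewrite /ball/= => xy; rewrite in_itv /= => yab.
by rewrite distrC; apply: Hd => //; rewrite distrC.
Qed.

Lemma cts_on_integrable a b f : cts_on a b f ->
  leb.-integrable `[a, b] (EFin \o f).
Proof. by move=> cf; apply: continuous_compact_integrable => //; exact: segment_compact. Qed.

Lemma cts_on_sub a b c d f : a <= c -> d <= b -> cts_on a b f -> cts_on c d f.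
Proof.
move=> ac db; apply: continuous_subspaceW => x /=; rewrite !in_itv /= => /andP[cx xd].
by rewrite (le_trans ac) //= (le_trans xd).
Qed.

Lemma cts_onB a b f g : cts_on a b f -> cts_on a b g -> cts_on a b (fun x => f x - g x).
Proof. by move=> cf cg x; apply: cvgB; [exact: cf|exact: cg]. Qed.

Lemma integB a b f g : cts_on a b f -> cts_on a b g ->
  integ a b (fun x => f x - g x) = integ a b f - integ a b g.
Proof. by move=> cf cg; apply: RintegralB => //; exact: cts_on_integrable. Qed.

Lemma integ_split a m b f : a <= m <= b -> cts_on a b f ->
  integ a b f = integ a m f + integ m b f.
Proof.
move=> /andP[am mb] cf; have fi := cts_on_integrable cf.
have fi2 : leb.-integrable `[m, b] (EFin \o f).
  exact/cts_on_integrable/(cts_on_sub am (lexx b)).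
apply/eqP; rewrite addrC -subr_eq; apply/eqP.
rewrite /integ (Rintegral_itvB fi) ?bnd_simp //.
rewrite Rintegral_itv_obnd_cbnd //.
apply: integrableS fi2 => //.
by move=> x /=; rewrite !in_itv /= => /andP[/ltW -> ->].
Qed.

Lemma integ_cst a b k : a <= b -> integ a b (fun=> k) = k * (b - a).
Proof.
move=> ab; rewrite /integ Rintegral_cst //; congr (_ * _).
rewrite [LHS](congr1 fine (lebesgue_measure_itv `[a, b])) /= lte_fin.
case: (ltrP a b) => // ba; apply/esym/eqP; rewrite subr_eq0.
by rewrite eq_le ab ba.
Qed.

Lemma integ_le a b f g : cts_on a b f -> cts_on a b g ->
  (forall x, a <= x <= b -> f x <= g x) -> integ a b f <= integ a b g.
Proof.
move=> cf cg fg; apply: le_Rintegral => //; try exact: cts_on_integrable.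
Qed.

Lemma integ_ext a b f g : (forall x, a <= x <= b -> f x = g x) -> integ a b f = integ a b g.
Proof. by move=> fg; apply: eq_Rintegral => x; rewrite inE /= in_itv /= => /fg. Qed.

Lemma cts_on_cst a b k : cts_on a b (fun=> k).
Proof. by move=> x; exact: cvg_cst. Qed.

(** Squeezes [f] between the constants k - e and k + e; serves small rectangles, cells of Riemann
    sums and small circles alike. *)
Lemma integ_near_cst a b f k e : a <= b -> cts_on a b f ->
  (forall x, a <= x <= b -> `|f x - k| <= e) ->
  `|integ a b f - k * (b - a)| <= e * (b - a).
Proof.
move=> ab cf fk.
have lo : integ a b (fun=> k - e) <= integ a b f.
  apply: integ_le => //; first exact: cts_on_cst.
  by move=> x /fk; rewrite ler_norml => /andP[? _]; lra.
have hi : integ a b f <= integ a b (fun=> k + e).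
  apply: integ_le => //; first exact: cts_on_cst.
  by move=> x /fk; rewrite ler_norml => /andP[_ ?]; lra.
rewrite !integ_cst // in lo hi.
rewrite ler_norml; apply/andP; split; lra.
Qed.

End segment_integral.

(** * Goursat's theorem for closed forms *)

Section goursat.
Context {R : realType}.
Variables (P Q : R -> R -> R).

(** Line integral of P dx + Q dy along the boundary, counterclockwise, with opposite sides
    paired. *)
Definition circulation (a b c d : R) : R :=
  integ a b (fun x => P x c - P x d) + integ c d (fun y => Q b y - Q a y).

(** Differentiability of [P] and [Q] at the point, with [p2] serving both as dP/dy and as dQ/dx:
    closedness without continuity of the derivatives. *)
Definition closed_form_at (x0 y0 : R) := exists p1 p2 q2 : R,
  forall e, 0 < e -> exists2 r, 0 < r & forall x y, `|x - x0| < r -> `|y - y0| < r ->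
    `|P x y - P x0 y0 - p1 * (x - x0) - p2 * (y - y0)| <= e * (`|x - x0| + `|y - y0|) /\
    `|Q x y - Q x0 y0 - p2 * (x - x0) - q2 * (y - y0)| <= e * (`|x - x0| + `|y - y0|).

Variables (A B C D : R).
Hypothesis AB : A <= B.
Hypothesis CD : C <= D.
Hypothesis closedPQ : forall x y, A <= x <= B -> C <= y <= D -> closed_form_at x y.

Lemma closed_form_cts_x y : C <= y <= D -> cts_on A B (fun x => P x y) /\ cts_on A B (fun x => Q x y).
Proof.
move=> yCD; split; apply: cts_onP => x xAB e e0;
  have [p1 [p2 [q2 H]]] := closedPQ xAB yCD;
  have [r r0 {}H] := H _ ltr01.
- pose K := `|p1| + 1; have K0 : 0 < K by rewrite ltr_wpDl.
  exists (Num.min r (e / K)); first by rewrite lt_min r0 divr_gt0.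
  move=> z zAB; rewrite lt_min => /andP[zr zK].
  have yy : `|y - y| < r by rewrite subrr normr0.
  have [+ _] := H z y zr yy; rewrite subrr normr0 mulr0 subr0 addr0 mul1r => H1.
  have -> : P z y - P x y = (P z y - P x y - p1 * (z - x)) + p1 * (z - x) by ring.
  rewrite (le_trans (ler_normD _ _)) // normrM.
  apply: (@le_trans _ _ (K * `|z - x|)).
    by rewrite /K mulrDl mul1r addrC lerD2l.
  by rewrite mulrC -ler_pdivlMr // ltW.
- pose K := `|p2| + 1; have K0 : 0 < K by rewrite ltr_wpDl.
  exists (Num.min r (e / K)); first by rewrite lt_min r0 divr_gt0.
  move=> z zAB; rewrite lt_min => /andP[zr zK].
  have yy : `|y - y| < r by rewrite subrr normr0.
  have [_] := H z y zr yy; rewrite subrr normr0 mulr0 subr0 addr0 mul1r => H1.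
  have -> : Q z y - Q x y = (Q z y - Q x y - p2 * (z - x)) + p2 * (z - x) by ring.
  rewrite (le_trans (ler_normD _ _)) // normrM.
  apply: (@le_trans _ _ (K * `|z - x|)).
    by rewrite /K mulrDl mul1r addrC lerD2l.
  by rewrite mulrC -ler_pdivlMr // ltW.
Qed.

Lemma closed_form_cts_y x : A <= x <= B -> cts_on C D (fun y => Q x y).
Proof.
move=> xAB; apply: cts_onP => y yCD e e0;
  have [p1 [p2 [q2 H]]] := closedPQ xAB yCD;
  have [r r0 {}H] := H _ ltr01.
pose K := `|q2| + 1; have K0 : 0 < K by rewrite ltr_wpDl.
exists (Num.min r (e / K)); first by rewrite lt_min r0 divr_gt0.
move=> z zAB; rewrite lt_min => /andP[zr zK].
have yy : `|x - x| < r by rewrite subrr normr0.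
have [_] := H x z yy zr; rewrite subrr normr0 mulr0 subr0 add0r mul1r => H1.
have -> : Q x z - Q x y = (Q x z - Q x y - q2 * (z - y)) + q2 * (z - y) by ring.
rewrite (le_trans (ler_normD _ _)) // normrM.
apply: (@le_trans _ _ (K * `|z - y|)).
  by rewrite /K mulrDl mul1r addrC lerD2l.
by rewrite mulrC -ler_pdivlMr // ltW.
Qed.

Definition subrect (a b c d : R) := [/\ A <= a, a <= b, b <= B & [/\ C <= c, c <= d & d <= D]].

(** The two boundaries run through the common side x = m in opposite directions. *)
Lemma circulation_split_x a m b c d : subrect a b c d -> a <= m <= b ->
  circulation a b c d = circulation a m c d + circulation m b c d.
Proof.
move=> [Aa ab bB [Cc cd dD]] /andP[am mb].
have c1 y : C <= y <= D -> cts_on a b (P^~ y).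
  by move=> /closed_form_cts_x[+ _]; exact: cts_on_sub.
have c2 x : A <= x <= B -> cts_on c d (Q x).
  by move=> /closed_form_cts_y; exact: cts_on_sub.
have Cc' : C <= c <= D by lra.
have Cd' : C <= d <= D by lra.
have Aa' : A <= a <= B by lra.
have Am' : A <= m <= B by lra.
have Ab' : A <= b <= B by lra.
rewrite /circulation (@integ_split _ a m b); [|lra|by apply: cts_onB; exact: c1].
rewrite !integB; try exact: c2; try (by apply: cts_on_sub (c1 _ _) => //; lra).
ring.
Qed.

Lemma circulation_split_y a b c m d : subrect a b c d -> c <= m <= d ->
  circulation a b c d = circulation a b c m + circulation a b m d.
Proof.
move=> [Aa ab bB [Cc cd dD]] /andP[am mb].
have c1 y : C <= y <= D -> cts_on a b (P^~ y).
  by move=> /closed_form_cts_x[+ _]; exact: cts_on_sub.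
have c2 x : A <= x <= B -> cts_on c d (Q x).
  by move=> /closed_form_cts_y; exact: cts_on_sub.
have Cc' : C <= c <= D by lra.
have Cd' : C <= d <= D by lra.
have Aa' : A <= a <= B by lra.
have Am' : C <= m <= D by lra.
have Ab' : A <= b <= B by lra.
rewrite /circulation (@integ_split _ c m d); [|lra|by apply: cts_onB; exact: c2].
rewrite !integB; try exact: c1; try (by apply: cts_on_sub (c2 _ _) => //; lra).
ring.
Qed.

(** The affine parts of [P] and [Q] contribute p2 (c - d) (b - a) and p2 (b - a) (d - c), which
    cancel; what remains is the error of the expansion times the side lengths. *)
Lemma circulation_small x0 y0 : A <= x0 <= B -> C <= y0 <= D -> forall e, 0 < e ->
  exists2 r, 0 < r & forall a b c d, subrect a b c d -> a <= x0 <= b -> c <= y0 <= d ->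
    b - a < r -> d - c < r -> `|circulation a b c d| <= e * (b - a + (d - c)) ^+ 2.
Proof.
move=> xAB yCD e e0; have [p1 [p2 [q2 H]]] := closedPQ xAB yCD.
(* Half of [e], because each integrand is a difference of two values. *)
have e20 : 0 < e / 2 by lra.
have [r r0 {}H] := H _ e20; exists r => // a b c d [Aa ab bB [Cc cd dD]] xab ycd bar dcr.
have c1 y : C <= y <= D -> cts_on a b (P^~ y).
  by move=> /closed_form_cts_x[+ _]; exact: cts_on_sub.
have c2 x : A <= x <= B -> cts_on c d (Q x).
  by move=> /closed_form_cts_y; exact: cts_on_sub.
set s := b - a + (d - c).
have Hx x : a <= x <= b -> `|x - x0| <= b - a.
  by move=> xx; rewrite ler_norml; apply/andP; split; lra.
have Hy y : c <= y <= d -> `|y - y0| <= d - c.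
  by move=> xx; rewrite ler_norml; apply/andP; split; lra.
have E x y : a <= x <= b -> c <= y <= d -> 
    `|P x y - P x0 y0 - p1 * (x - x0) - p2 * (y - y0)| <= e / 2 * s /\
    `|Q x y - Q x0 y0 - p2 * (x - x0) - q2 * (y - y0)| <= e / 2 * s.
  move=> /Hx hx /Hy hy.
  have [] := H x y (le_lt_trans hx bar) (le_lt_trans hy dcr) => h1 h2.
  by split; [apply: le_trans h1 _|apply: le_trans h2 _];
     rewrite ler_pM2l // lerD.
have cc : c <= c <= d by lra.
have dd : c <= d <= d by lra.
have aa : a <= a <= b by lra.
have bb : a <= b <= b by lra.
have T1 : `|integ a b (fun x => P x c - P x d) - p2 * (c - d) * (b - a)| <= e * s * (b - a).
  apply: integ_near_cst => //.
    by apply: cts_onB; apply: c1; lra.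
  move=> x xx; have [h1 _] := E _ _ xx cc; have [h2 _] := E _ _ xx dd.
  move: h1 h2; rewrite !ler_norml => /andP[? ?] /andP[? ?].
  by apply/andP; split; lra.
have T2 : `|integ c d (fun x => Q b x - Q a x) - p2 * (b - a) * (d - c)| <= e * s * (d - c).
  apply: integ_near_cst => //.
    by apply: cts_onB; apply: c2; lra.
  move=> x xx; have [_ h1] := E _ _ aa xx; have [_ h2] := E _ _ bb xx.
  move: h1 h2; rewrite !ler_norml => /andP[? ?] /andP[? ?].
  by apply/andP; split; lra.
rewrite /circulation.
set I1 := integ _ _ _ in T1 *; set I2 := integ _ _ _ in T2 *.
have -> : I1 + I2 = (I1 - p2 * (c - d) * (b - a)) + (I2 - p2 * (b - a) * (d - c)) by ring.
rewrite (le_trans (ler_normD _ _)) // (le_trans (lerD T1 T2)) //.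
by rewrite -mulrDr expr2 mulrA.
Qed.

Let rect := (R * R * (R * R))%type.
Let Rl (r : rect) := r.1.1.
Let Rr (r : rect) := r.1.2.
Let Rb (r : rect) := r.2.1.
Let Rt (r : rect) := r.2.2.
Let Rsub (r : rect) := subrect (Rl r) (Rr r) (Rb r) (Rt r).
Let Rc (r : rect) := circulation (Rl r) (Rr r) (Rb r) (Rt r).

(** Bisecting in both directions writes the circulation as a sum of four; the triangle inequality
    forbids all four to be below k / 4. *)
Let quarter (r : rect) (k : R) : Rsub r -> k <= `|Rc r| ->
  exists r' : rect, [/\ Rsub r', k / 4 <= `|Rc r'|, Rl r <= Rl r', Rr r' <= Rr r &
    [/\ Rb r <= Rb r', Rt r' <= Rt r, Rr r' - Rl r' = (Rr r - Rl r) / 2 &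
     Rt r' - Rb r' = (Rt r - Rb r) / 2]].
Proof.
case: r => [[a b] [c d]]; rewrite /Rsub /Rc /Rl /Rr /Rb /Rt /= => S H.
have [Aa ab bB [Cc cd dD]] := S.
pose m := (a + b) / 2; pose n := (c + d) / 2.
have am : a <= m <= b by rewrite /m; apply/andP; split; lra.
have cn : c <= n <= d by rewrite /n; apply/andP; split; lra.
have S1 : subrect a m c d by split; [lra|lra|lra|split; lra].
have S2 : subrect m b c d by split; [lra|lra|lra|split; lra].
move: H; rewrite (circulation_split_x S am) (circulation_split_y S1 cn) (circulation_split_y S2 cn) => H.
have : [\/ k / 4 <= `|circulation a m c n|, k / 4 <= `|circulation a m n d|,
  k / 4 <= `|circulation m b c n| | k / 4 <= `|circulation m b n d|].
  case: (lerP (k / 4) `|circulation a m c n|) => h1; first by constructor 1.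
  case: (lerP (k / 4) `|circulation a m n d|) => h2; first by constructor 2.
  case: (lerP (k / 4) `|circulation m b c n|) => h3; first by constructor 3.
  case: (lerP (k / 4) `|circulation m b n d|) => h4; first by constructor 4.
  exfalso; have := ler_normD (circulation a m c n + circulation a m n d) (circulation m b c n + circulation m b n d).
  have := ler_normD (circulation a m c n) (circulation a m n d).
  have := ler_normD (circulation m b c n) (circulation m b n d).
  lra.
case=> h; [exists (a, m, (c, n))|exists (a, m, (n, d))|exists (m, b, (c, n))|exists (m, b, (n, d))];
  split => //=; do ?[split] => //; rewrite /m /n; clear -ab cd Aa bB Cc dD am cn; rewrite /m /n in am cn; lra.
Qed.

(** If the circulation had modulus k > 0, repeated quartering would give nested rectangles of
    circulation at least k / 4 ^ n with sides divided by 2 ^ n. Near their common point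
    [circulation_small] makes it less than k / 4 ^ n. *)
Lemma goursat : circulation A B C D = 0.
Proof.
apply/eqP/negP => /negP E0.
pose k := `|circulation A B C D|; have k0 : 0 < k by rewrite normr_gt0.
(* The subset type carries the invariant, so that [choice] on a total relation followed by iteration
   gives the whole sequence. *)
pose T := {rk : rect * R | Rsub rk.1 /\ rk.2 <= `|Rc rk.1|}.
pose rel (t t' : T) := [/\ (sval t').2 = (sval t).2 / 4,
   Rl (sval t).1 <= Rl (sval t').1, Rr (sval t').1 <= Rr (sval t).1 &
   [/\ Rb (sval t).1 <= Rb (sval t').1, Rt (sval t').1 <= Rt (sval t).1,
   Rr (sval t').1 - Rl (sval t').1 = (Rr (sval t).1 - Rl (sval t).1) / 2 &
     Rt (sval t').1 - Rb (sval t').1 = (Rt (sval t).1 - Rb (sval t).1) / 2]].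
have relex (t : T) : exists t', rel t t'.
  case: t => -[r k'] /= [Sr kr]; have [r' [h1 h2 h3 h4 h5]] := quarter Sr kr.
  by exists (exist _ (r', k' / 4) (conj h1 h2)).
have S0 : Rsub (A, B, (C, D)) by rewrite /Rsub/subrect/Rl/Rr/Rb/Rt /=; do ?split.
pose t0 : T := exist _ ((A, B, (C, D)), k) (conj S0 (lexx k)).
have [f Hf] := choice relex.
pose u n := iter n f t0.
have uS n : rel (u n) (u n.+1) by rewrite /u iterS; exact: Hf.
pose a n := Rl (sval (u n)).1; pose b n := Rr (sval (u n)).1.
pose c n := Rb (sval (u n)).1; pose d n := Rt (sval (u n)).1.
have aS n : a n <= a n.+1 by have [] := uS n.
have bS n : b n.+1 <= b n by have [] := uS n.
have cS n : c n <= c n.+1 by have [_ _ _ []] := uS n.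
have dS n : d n.+1 <= d n by have [_ _ _ []] := uS n.
have ba n : b n - a n = (B - A) / 2 ^+ n.
  elim: n => [|n IH]; first by rewrite expr0 divr1.
  have [_ _ _ [_ _ h _]] := uS n; rewrite /b /a h -/(a n) -/(b n) IH exprS; field.
  by rewrite expf_neq0.
have dc n : d n - c n = (D - C) / 2 ^+ n.
  elim: n => [|n IH]; first by rewrite expr0 divr1.
  have [_ _ _ [_ _ _ h]] := uS n; rewrite /d /c h -/(c n) -/(d n) IH exprS; field.
  by rewrite expf_neq0.
have kn n : (sval (u n)).2 = k / 4 ^+ n.
  elim: n => [|n IH]; first by rewrite expr0 divr1.
  have [h _ _ _] := uS n; rewrite h IH exprS; field.
  by rewrite expf_neq0.
have an m n : (m <= n)%N -> a m <= a n by move=> mn; exact: (homo_leq (@lexx _ _) (@le_trans _ _)).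
have cn m n : (m <= n)%N -> c m <= c n by move=> mn; exact: (homo_leq (@lexx _ _) (@le_trans _ _)).
have bn m n : (m <= n)%N -> b n <= b m.
  by move=> mn; apply: (@homo_leq _ b (fun x y => y <= x)) => // [x y z h1 h2]; exact: le_trans h2 h1.
have dn m n : (m <= n)%N -> d n <= d m.
  by move=> mn; apply: (@homo_leq _ d (fun x y => y <= x)) => // [x y z h1 h2]; exact: le_trans h2 h1.
have abn n : a n <= b n by have [[]] := svalP (u n).
have cdn n : c n <= d n by have [[_ _ _ []]] := svalP (u n).
have abmn m n : a m <= b n.
  apply: (le_trans (an _ _ (leq_maxl m n))); apply: (le_trans (abn _)); exact/bn/leq_maxr.
have cdmn m n : c m <= d n.
  apply: (le_trans (cn _ _ (leq_maxl m n))); apply: (le_trans (cdn _)); exact/dn/leq_maxr.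
(* Every left end is below every right end, so the suprema lie in all the rectangles. *)
pose x0 := sup (range a); pose y0 := sup (range c).
have sa : has_sup (range a) by split; [exists (a 0%N); exists 0%N|exists (b 0%N) => _ [n _ <-]].
have sc : has_sup (range c) by split; [exists (c 0%N); exists 0%N|exists (d 0%N) => _ [n _ <-]].
have xn n : a n <= x0 <= b n.
  apply/andP; split; first by apply: ub_le_sup; [case: sa|exists n].
  by apply: ge_sup; [exists (a 0%N); exists 0%N|move=> _ [m _ <-]].
have yn n : c n <= y0 <= d n.
  apply/andP; split; first by apply: ub_le_sup; [case: sc|exists n].
  by apply: ge_sup; [exists (c 0%N); exists 0%N|move=> _ [m _ <-]].
(* The square of half the perimeter. With the tolerance k / 2 / (W + 1) its product with W stays
   below k, also when W = 0. *)
pose W := (B - A + (D - C)) ^+ 2.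
have W0 : 0 <= W by rewrite sqr_ge0.
have e0 : 0 < k / 2 / (W + 1) by apply: divr_gt0; lra.
have [r r0 Hr] := circulation_small (xn 0%N) (yn 0%N) e0.
pose M := B - A + (D - C) + 1.
have M0 : 0 < M by rewrite /M ltr_wpDl // addr_ge0 // subr_ge0.
have [n Hn] : exists n, M / 2 ^+ n < r.
  have [N HN] : exists N : nat, M / r < N%:R.
    by exists (Num.bound (M / r)); apply: archi_boundP; apply: divr_ge0; exact: ltW.
  exists N; rewrite ltr_pdivrMr ?exprn_gt0 // mulrC -ltr_pdivrMr //.
  by apply: (lt_trans HN); rewrite -natrX ltr_nat ltn_expl.
have p0 : 0 < 2 ^+ n :> R by rewrite exprn_gt0.
have sub_n : subrect (a n) (b n) (c n) (d n) by have [] := svalP (u n).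
have small (w : R) : w <= M -> w / 2 ^+ n < r.
  by move=> wM; apply: le_lt_trans Hn; rewrite ler_pM2r // invr_gt0.
have h1 : b n - a n < r 
  by rewrite ba; apply: small; rewrite /M -addrA lerDl addr_ge0 // subr_ge0.
have h2 : d n - c n < r 
  by rewrite dc; apply: small; rewrite /M addrAC lerDr addr_ge0 // subr_ge0.
have := Hr _ _ _ _ sub_n (xn n) (yn n) h1 h2.
have [_] := svalP (u n); rewrite kn => h3 h4; have := le_trans h3 h4.
rewrite ba dc -mulrDl expr_div_n -/W exprAC.
have -> : (2 ^+ 2 : R) = 4 by rewrite expr2; lra.
rewrite mulrA ler_pM2r ?invr_gt0 ?exprn_gt0 // => h.
have : k / 2 / (W + 1) * W < k.
  have kW : 0 <= k * W by rewrite mulr_ge0 // ltW.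
  rewrite mulrAC ltr_pdivrMr; last by lra.
  rewrite mulrDr mulr1 mulrAC; move: (k * W) kW => t kW; lra.
lra.
Qed.

End goursat.

(** * Holomorphic functions of one variable *)

Section modulus.
Context {R : realType}.
Local Notation C := R[i].

(** The norm on R[i] has values in R[i]; its real part allows estimates in the ordered field R. *)
Definition cabs (z : C) : R := complex.Re `|z|.

Lemma cabsE (z : C) : `|z| = (cabs z)%:C.
Proof. by rewrite /cabs normc_def. Qed.

Lemma cabs_ge0 (z : C) : 0 <= cabs z.
Proof. by rewrite -ler0c -cabsE. Qed.

Lemma cabsM (z w : C) : cabs (z * w) = cabs z * cabs w.
Proof. by apply: complexI; rewrite -cabsE normrM !cabsE rmorphM. Qed.

Lemma cabsN (z : C) : cabs (- z) = cabs z.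
Proof. by rewrite /cabs normrN. Qed.

Lemma cabsB (z w : C) : cabs (z - w) = cabs (w - z).
Proof. by rewrite /cabs distrC. Qed.

Lemma cabsD (z w : C) : cabs (z + w) <= cabs z + cabs w.
Proof. by rewrite -lecR rmorphD /= -!cabsE ler_normD. Qed.

Lemma cabs0 : cabs 0 = 0.
Proof. by rewrite /cabs normr0. Qed.

Lemma cabs1 : cabs 1 = 1.
Proof. by rewrite /cabs normr1. Qed.

Lemma cabsV (z : C) : cabs z^-1 = (cabs z)^-1.
Proof. by apply: complexI; rewrite -cabsE normfV cabsE fmorphV. Qed.

Lemma cabsX (z : C) n : cabs (z ^+ n) = cabs z ^+ n.
Proof. by elim: n => [|n IH]; rewrite ?expr0 ?cabs1 // !exprS cabsM IH. Qed.

Lemma cabs_eq0 (z : C) : (cabs z == 0) = (z == 0).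
Proof. by rewrite -[RHS]normr_eq0 cabsE (inj_eq (@complexI _) _ 0). Qed.

Lemma cabs_gt0 (z : C) : (0 < cabs z) = (z != 0).
Proof. by rewrite lt_neqAle cabs_ge0 andbT eq_sym cabs_eq0. Qed.

Lemma cabs_real (x : R) : cabs x%:C = `|x|.
Proof. by rewrite /cabs normc_def /= expr0n /= addr0 sqrtr_sqr. Qed.

Lemma sqr_cabs (z : C) : cabs z ^+ 2 = complex.Re z ^+ 2 + complex.Im z ^+ 2.
Proof. by rewrite /cabs normc_def /= sqr_sqrtr // addr_ge0 // sqr_ge0. Qed.

Lemma Re_le_cabs (z : C) : `|complex.Re z| <= cabs z.
Proof. by rewrite -lecR -cabsE normc_ge_Re. Qed.

Lemma Im_le_cabs (z : C) : `|complex.Im z| <= cabs z.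
Proof.
rewrite -[X in _ <= X]ger0_norm ?cabs_ge0 // -ler_sqr ?nnegrE ?normr_ge0 //.
by rewrite !real_normK ?num_real // sqr_cabs lerDr sqr_ge0.
Qed.

Lemma cabs_le (z : C) : cabs z <= `|complex.Re z| + `|complex.Im z|.
Proof.
rewrite -ler_sqr ?nnegrE ?cabs_ge0 ?addr_ge0 // sqr_cabs sqrrD !real_normK ?num_real //.
by rewrite addrAC lerDl mulrn_wge0 // mulr_ge0.
Qed.

Lemma cabsJ (z : C) : cabs (z^*) = cabs z.
Proof. by rewrite /cabs normcJ. Qed.

Lemma cabs_sum I (r : seq I) (P : pred I) (F : I -> C) :
  cabs (\sum_(i <- r | P i) F i) <= \sum_(i <- r | P i) cabs (F i).
Proof.
elim/big_rec2: _ => [|i x y _ h]; first by rewrite cabs0.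
by rewrite (le_trans (cabsD _ _)) // lerD2l.
Qed.

Lemma ReD (z w : C) : complex.Re (z + w) = complex.Re z + complex.Re w.
Proof. by case: z; case: w. Qed.
Lemma ImD (z w : C) : complex.Im (z + w) = complex.Im z + complex.Im w.
Proof. by case: z; case: w. Qed.
Lemma ReN (z : C) : complex.Re (- z) = - complex.Re z.
Proof. by case: z. Qed.
Lemma ImN (z : C) : complex.Im (- z) = - complex.Im z.
Proof. by case: z. Qed.
Lemma ReM (z w : C) :
  complex.Re (z * w) = complex.Re z * complex.Re w - complex.Im z * complex.Im w.
Proof. by case: z; case: w. Qed.
Lemma ImM (z w : C) :
  complex.Im (z * w) = complex.Re z * complex.Im w + complex.Im z * complex.Re w.
Proof. by case: z => a b; case: w => c d /=; rewrite addrC (mulrC b). Qed.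

Lemma complex_eq (z w : C) :
  complex.Re z = complex.Re w -> complex.Im z = complex.Im w -> z = w.
Proof. by case: z; case: w => a b c d /= -> ->. Qed.

(** Turns a bound for a modulus into a bound for the real part of [u * z], to which real analysis
    applies. *)
Lemma rotate_to_real (z : C) : exists2 u : C, cabs u = 1 & u * z = (cabs z)%:C.
Proof.
have [->|z0] := eqVneq z 0; first by exists 1; rewrite ?cabs1 // mulr0 cabs0.
have cz0 : (cabs z)%:C != 0 :> C by rewrite -cabsE normr_eq0.
exists ((cabs z)%:C / z); last by rewrite divfK.
by rewrite cabsM cabsV cabs_real ger0_norm ?cabs_ge0 // divff // cabs_eq0.
Qed.

End modulus.

Section derivatives.
Context {R : realType}.

Lemma is_derive_eps (f : R -> R) (x d : R) : is_derive x 1 f d ->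
  forall e, 0 < e -> exists2 r, 0 < r &
    forall y, `|y - x| < r -> `|f y - f x - d * (y - x)| <= e * `|y - x|.
Proof.
move=> [df <-] e e0; have /cvgrPdist_le/(_ e e0) := df.
rewrite near_withinE => /nbhs_ballP[r /= r0 H]; exists r => // y yx.
have [->|yx0] := eqVneq y x; first by rewrite !subrr mulr0 subr0 normr0 mulr0.
have h0 : y - x != 0 by rewrite subr_eq0.
have /= := H (y - x); rewrite /ball /= sub0r normrN => /(_ yx h0).
rewrite /GRing.scale /= mulr1 subrK /derive => h.
rewrite -ler_pdivrMr ?normr_gt0 // -normfV -normrM mulrBl.
by rewrite mulfK // distrC [_ * (y - x)^-1]mulrC.
Qed.

Lemma eps_is_derive (f : R -> R) (x d : R) :
  (forall e, 0 < e -> exists2 r, 0 < r &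
    forall y, `|y - x| < r -> `|f y - f x - d * (y - x)| <= e * `|y - x|) ->
  is_derive x 1 f d.
Proof.
move=> H.
have cv : h^-1 *: ((f \o shift x) (h *: (1 : R)) - f x) @[h --> (0 : R)^'] --> d.
  apply/cvgrPdist_le => e e0; have [r r0 {}H] := H e e0.
  rewrite near_withinE; apply/nbhs_ballP; exists r => //= h.
  rewrite /ball /= sub0r normrN => hr h0.
  have := H (h + x); rewrite addrK => /(_ hr).
  rewrite /GRing.scale /= mulr1 -ler_pdivrMr ?normr_gt0 // -normfV -normrM mulrBl.
  by rewrite mulfK // distrC [_ * h^-1]mulrC.
by split; [apply/cvg_ex; exists d|exact/cvg_lim].
Qed.

End derivatives.

(** * Complex differentiability and the exponential *)

Section mean_value.
Context {R : realType}.
Local Notation C := R[i].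

(** Complex differentiability with the derivative [d] as an argument, so that existence and value
    are handled together and nothing is said about neighbouring points. *)
Definition cdiff (f : C -> C) (a d : C) := forall e : R, 0 < e ->
  exists2 r : R, 0 < r & forall z, cabs (z - a) < r ->
    cabs (f z - f a - d * (z - a)) <= e * cabs (z - a).

Definition ccont (f : C -> C) (a : C) := forall e : R, 0 < e ->
  exists2 r : R, 0 < r & forall z, cabs (z - a) < r -> cabs (f z - f a) <= e.

Lemma cdiff_ccont f a d : cdiff f a d -> ccont f a.
Proof.
move=> H e e0; have [r r0 {}H] := H _ ltr01.
pose K := cabs d + 1; have K0 : 0 < K by rewrite ltr_wpDl ?cabs_ge0.
exists (Num.min r (e / K)); first by rewrite lt_min r0 divr_gt0.
move=> z; rewrite lt_min => /andP[/H zr zK].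
have -> : f z - f a = (f z - f a - d * (z - a)) + d * (z - a) by ring.
rewrite (le_trans (cabsD _ _)) //.
apply: (@le_trans _ _ (K * cabs (z - a))).
  by rewrite /K cabsM mulrDl addrC lerD2l.
by rewrite mulrC -ler_pdivlMr // ltW.
Qed.

Lemma cdiff_cst k a : cdiff (fun=> k) a 0.
Proof. by move=> e e0; exists 1 => // z _; rewrite mul0r subr0 subrr cabs0 mulr_ge0 ?cabs_ge0 // ltW. Qed.

Lemma cdiff_id a : cdiff id a 1.
Proof. by move=> e e0; exists 1 => // z _; rewrite mul1r subrr cabs0 mulr_ge0 ?cabs_ge0 // ltW. Qed.

Lemma cdiffD f g a d1 d2 : cdiff f a d1 -> cdiff g a d2 -> cdiff (fun z => f z + g z) a (d1 + d2).
Proof.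
move=> Hf Hg e e0; have e20 : 0 < e / 2 by rewrite divr_gt0.
have [r r0 {}Hf] := Hf _ e20; have [s s0 {}Hg] := Hg _ e20.
exists (Num.min r s); first by rewrite lt_min r0.
move=> z; rewrite lt_min => /andP[/Hf h1 /Hg h2].
have -> : f z + g z - (f a + g a) - (d1 + d2) * (z - a) =
   (f z - f a - d1 * (z - a)) + (g z - g a - d2 * (z - a)) by ring.
rewrite (le_trans (cabsD _ _)) // (le_trans (lerD h1 h2)) //.
by rewrite -mulrDl -splitr.
Qed.

Lemma cdiff_comp f g a d1 d2 : cdiff g a d1 -> cdiff f (g a) d2 -> cdiff (fun z => f (g z)) a (d2 * d1).
Proof.
move=> Hg Hf e e0.
have [r1 r10 H1] := Hg _ ltr01.
pose K := cabs d1 + 1; have K0 : 0 < K by rewrite ltr_wpDl ?cabs_ge0.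
pose L := cabs d2 + 1; have L0 : 0 < L by rewrite ltr_wpDl ?cabs_ge0.
have eK : 0 < e / 2 / K by rewrite !divr_gt0.
have eL : 0 < e / 2 / L by rewrite !divr_gt0.
have [r2 r20 H2] := Hf _ eK; have [r3 r30 H3] := Hg _ eL.
have [r4 r40 H4] := cdiff_ccont Hg (divr_gt0 r20 (ltr0n _ 2)).
exists (Num.min (Num.min r1 r3) r4); first by rewrite !lt_min r10 r30.
move=> z; rewrite !lt_min => /andP[/andP[/H1 h1 /H3 h3] /H4 h4].
have h2 : cabs (g z - g a) < r2 by apply: le_lt_trans h4 _; rewrite ltr_pdivrMr // ltr_pMr // ltr1n.
have {}h2 := H2 _ h2.
have -> : f (g z) - f (g a) - d2 * d1 * (z - a) =
  (f (g z) - f (g a) - d2 * (g z - g a)) + d2 * (g z - g a - d1 * (z - a)) by ring.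
rewrite (le_trans (cabsD _ _)) // [e]splitr mulrDl lerD //.
  apply: (le_trans h2); rewrite -mulrA ler_pM2l ?divr_gt0 // mulrC ler_pdivrMr // mulrC.
  have -> : g z - g a = (g z - g a - d1 * (z - a)) + d1 * (z - a) by ring.
  by rewrite (le_trans (cabsD _ _)) // /K cabsM mulrDl addrC lerD2l.
rewrite cabsM; apply: (@le_trans _ _ (L * (e / 2 / L * cabs (z - a)))).
  by apply: ler_pM; rewrite ?cabs_ge0 // /L lerDl.
by rewrite mulrA (mulrC L) divfK // gt_eqF.
Qed.

Lemma cdiffM f g a d1 d2 : cdiff f a d1 -> cdiff g a d2 ->
  cdiff (fun z => f z * g z) a (f a * d2 + d1 * g a).
Proof.
move=> Hf Hg e e0.
pose K := cabs (f a) + cabs (g a) + 1.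
have K0 : 0 < K by rewrite ltr_wpDl // addr_ge0 ?cabs_ge0.
pose L := cabs d1 + 1; have L0 : 0 < L by rewrite ltr_wpDl ?cabs_ge0.
have eK : 0 < e / 2 / K by rewrite !divr_gt0.
have eL : 0 < e / 2 / L by rewrite !divr_gt0.
have [r1 r10 H1] := Hf _ eK; have [r2 r20 H2] := Hg _ eK.
have [r3 r30 H3] := Hf _ ltr01; have [r4 r40 H4] := cdiff_ccont Hg eL.
exists (Num.min (Num.min r1 r2) (Num.min r3 r4)); first by rewrite !lt_min r10 r20 r30.
move=> z; rewrite !lt_min => /andP[/andP[/H1 h1 /H2 h2] /andP[/H3 h3 /H4 h4]].
have -> : f z * g z - f a * g a - (f a * d2 + d1 * g a) * (z - a) =
  ((f z - f a - d1 * (z - a)) * g a + f a * (g z - g a - d2 * (z - a))) + (f z - f a) * (g z - g a) by ring.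
apply: (le_trans (cabsD _ _)).
have -> : e * cabs (z - a) = e / 2 * cabs (z - a) + e / 2 * cabs (z - a).
  by rewrite -mulrDl -splitr.
apply: lerD.
  rewrite (le_trans (cabsD _ _)) // !cabsM.
  apply: (@le_trans _ _ (e / 2 / K * cabs (z - a) * cabs (g a) + cabs (f a) * (e / 2 / K * cabs (z - a)))).
    by apply: lerD; [apply: ler_wpM2r|apply: ler_wpM2l]; rewrite ?cabs_ge0.
  have -> : e / 2 / K * cabs (z - a) * cabs (g a) + cabs (f a) * (e / 2 / K * cabs (z - a)) =
    e / 2 * cabs (z - a) * ((cabs (f a) + cabs (g a)) / K) by ring.
  by rewrite ler_piMr ?mulr_ge0 ?cabs_ge0 ?divr_ge0 ?(ltW e0) // ler_pdivrMr // mul1r lerDl.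
have h5 : cabs (f z - f a) <= L * cabs (z - a).
  have -> : f z - f a = (f z - f a - d1 * (z - a)) + d1 * (z - a) by ring.
  by rewrite (le_trans (cabsD _ _)) // /L cabsM mulrDl addrC lerD2l.
rewrite cabsM; apply: (@le_trans _ _ (L * cabs (z - a) * (e / 2 / L))).
  by apply: ler_pM; rewrite ?cabs_ge0.
by rewrite mulrAC (mulrC L) divfK // gt_eqF.
Qed.

Lemma cdiff_inv a : a != 0 -> cdiff (fun z => z^-1) a (- (a ^- 2)).
Proof.
move=> a0 e e0; have ca : 0 < cabs a by rewrite cabs_gt0.
(* From |z| >= |a| / 2, the quotient |z - a| / (|z| |a|^2) is at most e as soon as |z - a| < K. *)
pose K := e * cabs a ^+ 3 / 2; have K0 : 0 < K by rewrite divr_gt0 // mulr_gt0 // exprn_gt0.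
exists (Num.min (cabs a / 2) K); first by rewrite lt_min K0 divr_gt0.
move=> z; rewrite lt_min => /andP[h1 h2].
have cz : cabs a / 2 <= cabs z.
  have : cabs a <= cabs z + cabs (z - a).
    by rewrite (cabsB z); have := cabsD z (a - z); rewrite addrC subrK.
  lra.
have z0 : z != 0 by rewrite -cabs_gt0 (lt_le_trans _ cz) // divr_gt0.
have -> : z^-1 - a^-1 - - a^-2 * (z - a) = (z - a) * ((z - a) / (z * a ^+ 2)).
  by field; rewrite z0 a0.
rewrite cabsM mulrC ler_wpM2r ?cabs_ge0 // cabsM cabsV cabsM cabsX.
rewrite ler_pdivrMr ?mulr_gt0 ?exprn_gt0 // ?cabs_gt0 //.
apply: (@le_trans _ _ K); first exact: ltW.
rewrite /K exprS mulrA -!mulrA ler_pM2l // [X in X <= _]mulrA [X in X <= _]mulrAC.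
have -> : cabs a * (cabs a / 2) * cabs a = cabs a / 2 * cabs a ^+ 2 by ring.
by rewrite ler_wpM2r // exprn_ge0 // ltW.
Qed.

(** The exponential of s + i t. *)
Definition epolar (s t : R) : C := (expR s * cos t) +i* (expR s * sin t).

Lemma cabs_epolar s t : cabs (epolar s t) = expR s.
Proof.
apply/eqP; rewrite -(eqrXn2 (n := 2)) ?cabs_ge0 ?expR_ge0 // sqr_cabs /= !exprMn -mulrDr.
by rewrite cos2Dsin2 mulr1.
Qed.

Lemma epolarD s t h k : epolar (s + h) (t + k) = epolar s t * epolar h k.
Proof.
rewrite /epolar expRD cosD sinD; apply: complex_eq; rewrite /=; ring.
Qed.

(** By the addition law the expansion at 0 suffices, where exp, cos and sin have known
    derivatives. *)
Lemma epolar_diff s t e : 0 < e -> exists2 r, 0 < r & forall x y, `|x - s| < r -> `|y - t| < r ->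
  cabs (epolar x y - epolar s t - epolar s t * ((x - s) +i* (y - t))) <= e * (`|x - s| + `|y - t|).
Proof.
move=> e0.
(* Collects the modulus exp s, the bound exp 1 for exp h when |h| < 1, and a factor 2 for the two
   coordinates. *)
pose K := 2 * expR s * (expR 1 + 1); have K0 : 0 < K by rewrite !mulr_gt0 ?expR_gt0 // addr_gt0 ?expR_gt0.
have eK : 0 < e / K by rewrite divr_gt0.
have [r1 r10 H1] := is_derive_eps (@is_derive_expR R 0) eK.
have [r2 r20 H2] := is_derive_eps (@is_derive_cos R 0) eK.
have [r3 r30 H3] := is_derive_eps (@is_derive_sin R 0) eK.
have [r4 r40 H4] := is_derive_eps (@is_derive_expR R 0) ltr01.
exists (Num.min (Num.min (Num.min r1 r2) (Num.min r3 r4)) (Num.min 1 (e / K / (expR 0 + 1)))).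
  by rewrite !lt_min r10 r20 r30 r40 ltr01 divr_gt0 // expR0.
move=> x y; set h := x - s; set k := y - t; rewrite !lt_min.
move=> /andP[/andP[/andP[a1 a2] /andP[a3 a4]] /andP[a5 a6]].
move=> /andP[/andP[/andP[b1 b2] /andP[b3 b4]] /andP[b5 b6]].
have {}H1 : `|expR h - 1 - h| <= e / K * `|h|.
  by have := H1 h; rewrite subr0 expR0 mul1r; exact.
have {}H2 : `|cos k - 1| <= e / K * `|k|.
  by have := H2 k; rewrite subr0 cos0 sin0 oppr0 mul0r subr0; exact.
have {}H3 : `|sin k - k| <= e / K * `|k|.
  by have := H3 k; rewrite subr0 cos0 sin0 mul1r subr0; exact.
have {}H4 : `|expR h - 1| <= e / K.
  have := H4 h; rewrite subr0 expR0 mul1r mul1r => /(_ a4) h4.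
  have -> : expR h - 1 = (expR h - 1 - h) + h by ring.
  apply: (le_trans (ler_normD _ _)); apply: (@le_trans _ _ (`|h| + `|h|)); first by rewrite lerD2r.
  by move: a6; rewrite expR0 ltr_pdivlMr //; lra.
have H5 : expR h <= expR 1.
  by rewrite ler_expR; apply: le_trans (ler_norm _) (ltW a5).
have -> : epolar x y = epolar s t * epolar h k by rewrite -epolarD /h /k ![_ + (_ - _)]addrC !subrK.
have -> : epolar s t * epolar h k - epolar s t - epolar s t * (h +i* k) =
  epolar s t * (epolar h k - 1 - (h +i* k)) by ring.
rewrite cabsM cabs_epolar.
have B1 : `|expR h * cos k - 1 - h| <= expR 1 * (e / K * `|k|) + e / K * `|h|.
  have -> : expR h * cos k - 1 - h = expR h * (cos k - 1) + (expR h - 1 - h) by ring.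
  rewrite (le_trans (ler_normD _ _)) // lerD // normrM (ger0_norm (expR_ge0 _)).
  by apply: ler_pM; rewrite ?expR_ge0.
have B2 : `|expR h * sin k - k| <= expR 1 * (e / K * `|k|) + e / K * `|k|.
  have -> : expR h * sin k - k = expR h * (sin k - k) + (expR h - 1) * k by ring.
  rewrite (le_trans (ler_normD _ _)) // lerD // normrM ?(ger0_norm (expR_ge0 _)).
    by apply: ler_pM; rewrite ?expR_ge0.
  by apply: ler_wpM2r.
apply: (@le_trans _ _ (expR s * (2 * (expR 1 + 1) * (e / K * (`|h| + `|k|))))).
  rewrite ler_wpM2l ?expR_ge0 // (le_trans (cabs_le _)) //= !subr0 -/h -/k.
  apply: (le_trans (lerD B1 B2)).
  have := expR_gt0 (1 : R); move: (expR 1) => E E0.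
  rewrite [e / K * (_ + _)]mulrDr; have : 0 <= e / K * `|h| by rewrite mulr_ge0 // ltW.
  have : 0 <= e / K * `|k| by rewrite mulr_ge0 // ltW.
  move: (e / K * `|h|) (e / K * `|k|) => U V V0 U0.
  have : 0 <= E * U by rewrite mulr_ge0 // ltW.
  have : 0 <= E * V by rewrite mulr_ge0 // ltW.
  lra.
have -> : expR s * (2 * (expR 1 + 1) * (e / K * (`|h| + `|k|))) = (K * (e / K)) * (`|h| + `|k|).
  by rewrite /K; ring.
by rewrite (mulrC K) divfK ?gt_eqF //.
Qed.

End mean_value.

(** * Mean value property and Cauchy estimates *)

Section cauchy.
Context {R : realType}.
Local Notation C := R[i].

Lemma cdiff_near_eq (f g : C -> C) a d r : 0 < r ->
  (forall z, cabs (z - a) < r -> f z = g z) -> cdiff f a d -> cdiff g a d.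
Proof.
move=> r0 fg H e e0; have [s s0 {}H] := H e e0.
exists (Num.min r s); first by rewrite lt_min r0.
move=> z; rewrite lt_min => /andP[zr /H]; rewrite !fg // subrr cabs0 //.
Qed.

Lemma cdiffB f g (a : C) d1 d2 : cdiff f a d1 -> cdiff g a d2 -> cdiff (fun z => f z - g z) a (d1 - d2).
Proof.
move=> Hf Hg; have H := cdiffM (cdiff_cst (-1) a) Hg.
move: (cdiffD Hf H); rewrite mul0r addr0 mulN1r.
by apply: (@cdiff_near_eq _ _ _ _ 1) => // z _; rewrite mulN1r.
Qed.

Lemma cdiffZ k f (a : C) d : cdiff f a d -> cdiff (fun z => k * f z) a (k * d).
Proof. by move=> Hf; have := cdiffM (cdiff_cst k a) Hf; rewrite mul0r addr0. Qed.

Lemma cdiff_affine (c v a : C) : cdiff (fun z => c + z * v) a v.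
Proof.
have := cdiffD (cdiff_cst c a) (cdiffM (cdiff_id a) (cdiff_cst v a)).
by rewrite mulr0 add0r mul1r add0r.
Qed.

(** Chain rule for [f] composed with the exponential, read as an expansion in two real variables;
    the differential is multiplication by the single complex number d * epolar s t. *)
Lemma cdiff_polar (f : C -> C) s t d : cdiff f (epolar s t) d ->
  forall e : R, 0 < e -> exists2 r : R, 0 < r & forall x y, `|x - s| < r -> `|y - t| < r ->
  cabs (f (epolar x y) - f (epolar s t) - d * epolar s t * ((x - s) +i* (y - t)))
    <= e * (`|x - s| + `|y - t|).
Proof.
move=> Hf e e0.
have [r1 r10 H1] := epolar_diff s t (ltr01 : 0 < 1 :> R).
pose K := expR s + 1; have K0 : 0 < K by rewrite ltr_wpDl ?expR_ge0.
pose L := cabs d + 1; have L0 : 0 < L by rewrite ltr_wpDl ?cabs_ge0.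
have eK : 0 < e / 2 / K by rewrite !divr_gt0.
have eL : 0 < e / 2 / L by rewrite !divr_gt0.
have [r2 r20 H2] := Hf _ eK; have [r3 r30 H3] := epolar_diff s t eL.
have r4 : 0 < r2 / K / 2 by rewrite !divr_gt0.
exists (Num.min (Num.min r1 r3) (r2 / K / 2)); first by rewrite !lt_min r10 r30.
move=> x y; rewrite !lt_min => /andP[/andP[a1 a3] a4] /andP[/andP[b1 b3] b4].
have {}H1 := H1 x y a1 b1; have {}H3 := H3 x y a3 b3.
set w := epolar x y in H1 H3 *; set w0 := epolar s t in H1 H2 H3 Hf *.
set h := (x - s) +i* (y - t) in H1 H3 *.
set n := `|x - s| + `|y - t| in H1 H3 *.
have n0 : 0 <= n by rewrite addr_ge0.
have hn : cabs h <= n by exact: cabs_le.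
have wn : cabs (w - w0) <= K * n.
  have -> : w - w0 = (w - w0 - w0 * h) + w0 * h by ring.
  rewrite (le_trans (cabsD _ _)) // cabsM cabs_epolar /K mulrDl addrC lerD //.
  by rewrite ler_wpM2l ?expR_ge0.
have {}H2 : cabs (f w - f w0 - d * (w - w0)) <= e / 2 / K * cabs (w - w0).
  apply: H2; apply: (le_lt_trans wn); rewrite mulrC -ltr_pdivlMr //.
  by rewrite [r2 / K]splitr ltrD.
have -> : f w - f w0 - d * w0 * h = (f w - f w0 - d * (w - w0)) + d * (w - w0 - w0 * h) by ring.
apply: (le_trans (cabsD _ _)).
have -> : e * n = e / 2 * n + e / 2 * n by rewrite -mulrDl -splitr.
apply: lerD.
  by apply: (le_trans H2); rewrite -mulrA ler_pM2l ?divr_gt0 // mulrC ler_pdivrMr // mulrC.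
rewrite cabsM; apply: (@le_trans _ _ (L * (e / 2 / L * n))).
  by apply: ler_pM; rewrite ?cabs_ge0 // /L lerDl.
by rewrite mulrA (mulrC L) divfK // gt_eqF.
Qed.

Section mean_value_property.
Variables (f : C -> C) (r : R).
Hypothesis r0 : 0 < r.
Hypothesis f0 : ccont f 0.
Hypothesis fdiff : forall z, 0 < cabs z -> cabs z <= r -> exists d, cdiff f z d.

Let F s t := complex.Re (f (epolar s t)).
Let G s t := complex.Im (f (epolar s t)).

(** [G] dx + [F] dy is the imaginary part of f (exp w) dw. With p the derivative of f (exp w), the
    Cauchy-Riemann equations give the coefficients Im p, Re p and - Im p. *)
Let closedFG s t : s <= ln r -> closed_form_at G F s t.
Proof.
move=> sr.
have [d Hd] : exists d, cdiff f (epolar s t) d.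
  apply: fdiff; rewrite cabs_epolar ?expR_gt0 //.
  by rewrite -[leRHS]lnK ?posrE // ler_expR.
pose p := d * epolar s t.
exists (complex.Im p), (complex.Re p), (- complex.Im p) => e e0.
have [q q0 H] := cdiff_polar Hd e0; exists q => // x y xs yt.
have := H x y xs yt; rewrite -/p => h; split.
- apply: le_trans h; apply: le_trans (Im_le_cabs _).
  rewrite !ImD !ImN (ImM p) /= le_eqVlt; apply/orP; left; apply/eqP; congr (`|_|).
  by rewrite /G; ring.
- apply: le_trans h; apply: le_trans (Re_le_cabs _).
  rewrite !ReD !ReN (ReM p) /= le_eqVlt; apply/orP; left; apply/eqP; congr (`|_|).
  by rewrite /F; ring.
Qed.

Lemma cts_circle : cts_on 0 (2 * pi) (fun t => complex.Re (f (epolar (ln r) t))).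
Proof.
have pi2 : 0 <= 2 * pi :> R by rewrite mulr_ge0 ?pi_ge0.
apply: (@closed_form_cts_y _ G F (ln r) (ln r) 0 (2 * pi)) => //; last by rewrite lexx.
by move=> x y /andP[_ xr] _; exact: closedFG.
Qed.

(* Goursat for [f \o exp] on the rectangle [s, ln r] x [0, 2 pi], then s -> -oo. *)
Lemma mean_value_Re :
  integ 0 (2 * pi) (fun t => complex.Re (f (epolar (ln r) t))) = 2 * pi * complex.Re (f 0).
Proof.
have pi2 : 0 < 2 * pi :> R by rewrite mulr_gt0 ?pi_gt0.
have key s : s <= ln r -> integ 0 (2 * pi) (F (ln r)) = integ 0 (2 * pi) (F s).
  move=> sr.
  have cl x y : s <= x <= ln r -> 0 <= y <= 2 * pi -> closed_form_at G F x y.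
    by move=> /andP[_ xr] _; exact: closedFG.
  have := goursat sr (ltW pi2) cl; rewrite /circulation.
  (* The horizontal sides cancel, the exponential having period 2 pi i. *)
  rewrite (@integ_ext _ s (ln r) _ (fun=> 0)); last first.
    move=> x _; rewrite /G /epolar cos0 sin0.
    by rewrite mulr_natl cos2pi sin2pi subrr.
  have c1 := closed_form_cts_y cl (_ : s <= ln r <= ln r).
  have c2 := closed_form_cts_y cl (_ : s <= s <= ln r).
  rewrite lexx andbT in c1; rewrite lexx in c2.
  rewrite (integ_cst 0 sr) mul0r add0r (integB (c1 sr) (c2 sr)).
  by move/eqP; rewrite subr_eq0 => /eqP.
apply/eqP; rewrite -subr_eq0 -normr_le0; apply/ler_addgt0Pl => e e0; rewrite addr0.
(* Continuity of [f] at 0 brings [F s] close to the real part of f 0 once exp s < q. *)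
have [q q0 H] := f0 (divr_gt0 e0 pi2).
pose s := ln (Num.min r (q / 2)).
have m0 : 0 < Num.min r (q / 2) by rewrite lt_min r0 divr_gt0.
have sr : s <= ln r by rewrite ler_ln ?posrE // ge_min lexx.
rewrite (key s sr).
suff : `|integ 0 (2 * pi) (F s) - complex.Re (f 0) * (2 * pi - 0)| <= e / (2 * pi) * (2 * pi - 0).
  by rewrite subr0 divfK ?gt_eqF // (mulrC (complex.Re _)).
apply: integ_near_cst; first exact: ltW.
- apply: (@closed_form_cts_y _ G F s (ln r) 0 (2 * pi)); last by rewrite lexx.
  by move=> x y /andP[_ xr] _; exact: closedFG.
- move=> x _; apply: le_trans (H (epolar s x) _).
    by rewrite -ReN -ReD; exact: Re_le_cabs.
  rewrite subr0 cabs_epolar lnK ?posrE // gt_min; apply/orP; right.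
  by rewrite ltr_pdivrMr // ltr_pMr // ltr1n.
Qed.

End mean_value_property.

Definition chol (f : C -> C) (a : C) (r : R) := forall z, cabs (z - a) <= r -> exists d, cdiff f z d.

Lemma cdiff_shift f (a z d : C) : cdiff f (a + z) d -> cdiff (fun x => f (a + x)) z d.
Proof.
move=> H e e0; have [q q0 {}H] := H e e0; exists q => // x xz.
by have -> : x - z = a + x - (a + z) by [ring]; apply: H; rewrite opprD addrACA subrr add0r.
Qed.

(** Mean value property for the difference quotient at [a], completed by the derivative and rotated
    so that its value at 0 is |d|. At 0 this quotient is known only to be continuous, which
    [mean_value_Re] allows. The factor 2 comes from |f z - f a| <= 2 M. *)
Lemma cauchy_estimate f a r M d : 0 < r -> chol f a r ->
  (forall z, cabs (z - a) <= r -> cabs (f z) <= M) -> cdiff f a d -> cabs d <= 2 * M / r.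
Proof.
move=> r0 fh fM fd.
have [u u1 ud] := rotate_to_real d.
pose g z := if z == 0 then u * d else u * ((f (a + z) - f a) / z).
have M0 : 0 <= M by apply: le_trans (fM a _); rewrite ?cabs_ge0 // subrr cabs0 ltW.
have g0 : ccont g 0.
  move=> e e0; have [q q0 H] := fd e e0; exists q => // z; rewrite subr0 => zq.
  rewrite /g eqxx; case: eqVneq => [_|z0]; first by rewrite subrr cabs0 ltW.
  rewrite -mulrBr cabsM u1 mul1r.
  have := H (a + z); rewrite addrAC subrr add0r => /(_ zq) h.
  have -> : (f (a + z) - f a) / z - d = (f (a + z) - f a - d * z) / z by field.
  by rewrite cabsM cabsV ler_pdivrMr // cabs_gt0.
have gd z : 0 < cabs z -> cabs z <= r -> exists d, cdiff g z d.
  move=> z0 zr; have zn : z != 0 by rewrite -cabs_gt0.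
  have [d1 h1] : exists d1, cdiff f (a + z) d1 by apply: fh; rewrite addrAC subrr add0r.
  have h2 := cdiffB (cdiff_shift h1) (cdiff_cst (f a) z).
  have h3 := cdiffZ u (cdiffM h2 (cdiff_inv zn)).
  (* The disc of radius |z| about z avoids 0, so [g] is given there by the quotient. *)
  eexists; apply: cdiff_near_eq z0 _ h3 => w wz; rewrite /g.
  by case: eqVneq => // w0; move: wz; rewrite w0 sub0r cabsN ltxx.
have pi2 : 0 < 2 * pi :> R by rewrite mulr_gt0 ?pi_gt0.
have := mean_value_Re r0 g0 gd; rewrite {2}/g eqxx ud /= => mv.
have : integ 0 (2 * pi) (fun t => complex.Re (g (epolar (ln r) t))) <=
  integ 0 (2 * pi) (fun=> 2 * M / r).
  apply: integ_le; [exact: cts_circle|exact: cts_on_cst|] => t _.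
  apply: le_trans (ler_norm _) _; apply: le_trans (Re_le_cabs _) _.
  have ce : cabs (epolar (ln r) t) = r by rewrite cabs_epolar lnK.
  have e0 : epolar (ln r) t != 0 by rewrite -cabs_gt0 ce.
  rewrite /g (negbTE e0) cabsM u1 mul1r cabsM cabsV ce ler_pM2r ?invr_gt0 //.
  apply: le_trans (cabsD _ _) _; rewrite cabsN mulrDl mul1r lerD // fM //.
    by rewrite addrAC subrr add0r ce.
  by rewrite subrr cabs0 ltW.
rewrite mv integ_cst; last exact: ltW.
by rewrite subr0 mulrC ler_pM2r.
Qed.

(** The rotation makes f b - f a real and nonnegative; then the real mean value theorem applies to
    the real part of [u * f] along the segment. *)
Lemma mean_value_ineq f (a b : C) (df : R -> C) M :
  (forall t, 0 <= t <= 1 -> cdiff f (a + t%:C * (b - a)) (df t)) ->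
  (forall t, 0 <= t <= 1 -> cabs (df t) <= M) -> cabs (f b - f a) <= M * cabs (b - a).
Proof.
move=> Hd HM.
have [u u1 ud] := rotate_to_real (f b - f a).
pose phi (t : R) := complex.Re (u * f (a + t%:C * (b - a))).
have dphi (t : R) : 0 <= t <= 1 -> is_derive t (1 : R) phi (complex.Re (u * (df t * (b - a)))).
  move=> t01; apply: eps_is_derive => e e0.
  have h := cdiffZ u (cdiff_comp (cdiff_affine a (b - a) t%:C) (Hd t t01)).
  have [q q0 H] := h e e0; exists q => // s st.
  have := H s%:C; rewrite -rmorphB /= cabs_real => /(_ st) => k.
  apply: le_trans k; apply: le_trans (Re_le_cabs _).
  rewrite !ReD !ReN /phi.
  have -> : complex.Re (u * (df t * (b - a)) * (s - t)%:C) = complex.Re (u * (df t * (b - a))) * (s - t).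
    by rewrite [in LHS]ReM /= mulr0 subr0.
  by [].
have cphi : {within `[0, 1], continuous phi}.
  apply: derivable_within_continuous => t; rewrite in_itv /= => t01.
  by have [] := dphi t t01.
have dphi' (t : R) : t \in `]0, 1[ -> is_derive t (1 : R) phi (complex.Re (u * (df t * (b - a)))).
  by rewrite in_itv /= => /andP[/ltW ? /ltW ?]; apply: dphi; apply/andP.
have [c cin] := MVT ltr01 dphi' cphi.
have e1 : a + (1 : R)%:C * (b - a) = b by rewrite rmorph1 mul1r addrC subrK.
have e0 : a + (0 : R)%:C * (b - a) = a by rewrite rmorph0 mul0r addr0.
rewrite /phi e0 e1 -ReN -ReD -mulrBr ud /= subr0 mulr1 => ->.
apply: le_trans (ler_norm _) _; apply: le_trans (Re_le_cabs _) _.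
rewrite !cabsM u1 mul1r ler_wpM2r ?cabs_ge0 // HM //.
by move: cin; rewrite in_itv /= => /andP[/ltW -> /ltW ->].
Qed.

Lemma chol_sub f (a b : C) r s : chol f a r -> cabs (b - a) + s <= r -> chol f b s.
Proof.
move=> H abr z zb; apply: H; apply: le_trans abr.
have -> : z - a = (b - a) + (z - b) by ring.
by apply: le_trans (cabsD _ _) _; rewrite lerD2l.
Qed.

Lemma segment_in_ball (a b c : C) r t : 0 <= t <= 1 -> cabs (a - c) <= r -> cabs (b - c) <= r ->
  cabs (a + t%:C * (b - a) - c) <= r.
Proof.
move=> /andP[t0 t1] ac bc.
have -> : a + t%:C * (b - a) - c = (1 - t)%:C * (a - c) + t%:C * (b - c).
  by rewrite rmorphB rmorph1; ring.
apply: le_trans (cabsD _ _) _; rewrite !cabsM !cabs_real !ger0_norm ?subr_ge0 //.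
have -> : r = (1 - t) * r + t * r by ring.
by rewrite lerD // ler_wpM2l // subr_ge0.
Qed.

Section taylor.
Variables (f : C -> C) (a : C) (r M : R).
Hypothesis r0 : 0 < r.
Hypothesis fh : chol f a r.
Hypothesis fM : forall z, cabs (z - a) <= r -> cabs (f z) <= M.

Lemma cauchy_estimate_near z d : cabs (z - a) <= r / 2 -> cdiff f z d -> cabs d <= 4 * M / r.
Proof.
move=> za zd; have r20 : 0 < r / 2 by rewrite divr_gt0.
have -> : 4 * M / r = 2 * M / (r / 2) by field; rewrite gt_eqF.
apply: cauchy_estimate zd => //; first by apply: chol_sub fh _; lra.
move=> w wz; apply: fM; have -> : w - a = (z - a) + (w - z) by ring.
by apply: le_trans (cabsD _ _) _; lra.
Qed.

Lemma cauchy_lipschitz z w : cabs (z - a) <= r / 2 -> cabs (w - a) <= r / 2 ->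
  cabs (f w - f z) <= 4 * M / r * cabs (w - z).
Proof.
move=> za wa.
have /choice[df Hdf] : forall t : R, exists d, 0 <= t <= 1 -> cdiff f (z + t%:C * (w - z)) d.
  move=> t; have [t01|] := boolP (0 <= t <= 1); last by exists 0.
  have [|d hd] := fh (z := z + t%:C * (w - z)); last by exists d.
  by have := segment_in_ball t01 za wa; have : 0 < r by []; lra.
apply: (mean_value_ineq Hdf) => t t01.
by apply: cauchy_estimate_near (Hdf t t01); exact: segment_in_ball.
Qed.

(** Cauchy's estimate on the disc of radius r / 4 for the translate difference f (h + x) - f x,
    which [cauchy_lipschitz] bounds by 4 M / r |h|: a Lipschitz bound for the derivative that avoids
    second derivatives. *)
Lemma cauchy_derive_lipschitz z d1 d2 : cabs (z - a) <= r / 4 -> cdiff f a d1 -> cdiff f z d2 ->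
  cabs (d2 - d1) <= 32 * M / r ^+ 2 * cabs (z - a).
Proof.
move=> za h1 h2; pose h := z - a.
have h3 : cdiff f (h + a) d2 by rewrite /h subrK.
have hd : cdiff (fun x => f (h + x) - f x) a (d2 - d1) by apply: cdiffB h1; exact: cdiff_shift.
have r40 : 0 < r / 4 by rewrite divr_gt0.
have -> : 32 * M / r ^+ 2 * cabs (z - a) = 2 * (4 * M / r * cabs h) / (r / 4).
  by rewrite -/h; field; rewrite gt_eqF.
apply: cauchy_estimate hd => //.
- move=> w wa.
  have [e1 E1] : exists d, cdiff f w d by apply: fh; lra.
  have [e2 E2] : exists d, cdiff f (h + w) d.
    apply: fh; rewrite -addrA; apply: le_trans (cabsD _ _) _; rewrite /h; lra.
  by exists (e2 - e1); apply: cdiffB E1; exact: cdiff_shift.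
- move=> w wa; have -> : h = h + w - w by rewrite addrK.
  rewrite [X in f X]addrNK; apply: cauchy_lipschitz; first by lra.
  rewrite -addrA; apply: le_trans (cabsD _ _) _; rewrite /h; lra.
Qed.

(** Mean value inequality for f w - d w, whose derivative is small by [cauchy_derive_lipschitz]. *)
Lemma taylor1 z d : cabs (z - a) <= r / 4 -> cdiff f a d ->
  cabs (f z - f a - d * (z - a)) <= 32 * M / r ^+ 2 * cabs (z - a) ^+ 2.
Proof.
move=> za hd.
have aa : cabs (a - a) <= r / 4 by rewrite subrr cabs0 ltW // divr_gt0.
have M0 : 0 <= M by apply: le_trans (fM (z := a) _); rewrite ?cabs_ge0 // subrr cabs0 ltW.
have /choice[df Hdf] : forall t : R, exists d, 0 <= t <= 1 -> cdiff f (a + t%:C * (z - a)) d.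
  move=> t; have [t01|] := boolP (0 <= t <= 1); last by exists 0.
  have [|d' hd'] := fh (z := a + t%:C * (z - a)); last by exists d'.
  by have := segment_in_ball t01 aa za; have : 0 < r by []; lra.
have Hg t : 0 <= t <= 1 -> cdiff (fun w => f w - d * w) (a + t%:C * (z - a)) (df t - d).
  move=> t01; apply: cdiffB; first exact: Hdf.
  by have := cdiffZ d (cdiff_id (a + t%:C * (z - a))); rewrite mulr1.
have -> : f z - f a - d * (z - a) = (f z - d * z) - (f a - d * a) by ring.
rewrite [cabs (z - a) ^+ 2]expr2 mulrA; apply: (mean_value_ineq Hg) => t t01.
have wa := segment_in_ball t01 aa za.
apply: le_trans (cauchy_derive_lipschitz wa hd (Hdf t t01)) _.
apply: ler_wpM2l; first by apply: divr_ge0; [apply: mulr_ge0; rewrite ?ler0n|exact: sqr_ge0].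
rewrite addrAC subrr add0r cabsM cabs_real.
have /andP[t0 t1] := t01; rewrite ger0_norm //.
by rewrite ler_piMl ?cabs_ge0.
Qed.

End taylor.

End cauchy.

(** * Holomorphic functions of several variables *)

Section root_average.
Context {R : realType}.
Local Notation C := R[i].

Lemma riemann_sum_le (phi : R -> R) (L h : R) m : 0 <= h -> cts_on 0 (m%:R * h) phi ->
  (forall s t, `|phi s - phi t| <= L * `|s - t|) ->
  `|integ 0 (m%:R * h) phi - \sum_(k < m) phi (k%:R * h) * h| <= m%:R * (L * h * h).
Proof.
move=> h0 + lip; elim: m => [|m IH] cphi.
  rewrite big_ord0 !mul0r subr0 (@integ_ext _ 0 0 phi (fun=> phi 0)).
    by rewrite integ_cst // subrr mulr0 normr0.
  by move=> x; rewrite -eq_le => /eqP <-.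
have mh : 0 <= m%:R * h <= m.+1%:R * h by rewrite mulr_ge0 // ler_wpM2r // ler_nat leqnSn.
have /andP[mh0 mhS] := mh.
rewrite big_ord_recr /= (integ_split mh cphi).
have {}IH := IH (cts_on_sub (lexx _) mhS cphi).
have c2 := cts_on_sub mh0 (lexx _) cphi.
have step : m.+1%:R * h - m%:R * h = h by rewrite -mulrBl -natrB // subSnn mul1r.
have : `|integ (m%:R * h) (m.+1%:R * h) phi - phi (m%:R * h) * (m.+1%:R * h - m%:R * h)|
    <= L * h * (m.+1%:R * h - m%:R * h).
  apply: integ_near_cst => // x /andP[x1 x2].
  have L0 : 0 <= L.
    by have := lip 1 0; rewrite subr0 normr1 mulr1; apply: le_trans.
  apply: le_trans (lip _ _) _; rewrite ler_wpM2l // ger0_norm ?subr_ge0 //.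
  by rewrite lerBlDl -[X in m%:R * h + X]step addrC subrK.
rewrite step => h2.
set I1 := integ _ _ _ in IH *; set I2 := integ _ _ _ in h2 *.
set S := \sum_(i < m) _ in IH *.
have -> : I1 + I2 - (S + phi (m%:R * h) * h) = (I1 - S) + (I2 - phi (m%:R * h) * h) by ring.
apply: (le_trans (ler_normD _ _)).
by rewrite -natr1 mulrDl mul1r lerD.
Qed.

Lemma lipschitz_of_derive (f df : R -> R) : (forall x, is_derive x (1 : R) f (df x)) ->
  (forall x, `|df x| <= 1) -> forall s t, `|f s - f t| <= `|s - t|.
Proof.
move=> fd df1.
have cf : continuous f by move=> x; apply/differentiable_continuous/derivable1_diffP; have [] := fd x.
have main s t : s < t -> `|f t - f s| <= `|t - s|.
  move=> st; have [c _ ->] := MVT st (fun x _ => fd x) (continuous_subspaceT cf).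
  by rewrite normrM ler_piMl.
move=> s t; case: (ltgtP s t) => [/main|/main //|->]; last by rewrite !subrr.
by rewrite distrC [leRHS]distrC.
Qed.

Definition circ (t : R) : C := epolar 0 t.

Lemma cabs_circ t : cabs (circ t) = 1.
Proof. by rewrite cabs_epolar expR0. Qed.

Lemma circ_lipschitz s t : cabs (circ s - circ t) <= 2 * `|s - t|.
Proof.
apply: le_trans (cabs_le _) _; rewrite /circ /epolar expR0 /= !mul1r.
have -> : 2 * `|s - t| = `|s - t| + `|s - t| by ring.
apply: lerD.
- apply: (@lipschitz_of_derive cos (fun x => - sin x)) => x.
  by rewrite normrN ler_norml; apply/andP; split; [exact: sin_geN1|exact: sin_le1].
- apply: (@lipschitz_of_derive sin cos) => x.
  by rewrite ler_norml; apply/andP; split; [exact: cos_geN1|exact: cos_le1].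
Qed.

(** A discrete mean value property: an average over roots of unity involves finitely many rotations,
    each of which preserves Lebesgue measure. The error is that of a Riemann sum: [f (circ t)] has
    Lipschitz constant 4 M, multiplied by the step 2 pi / N.+1. *)
Lemma root_average (f : C -> C) M N : chol f 0 2 -> (forall z, cabs (z - 0) <= 2 -> cabs (f z) <= M) ->
  cabs (N.+1%:R^-1 * \sum_(k < N.+1) f (circ (k%:R * (2 * pi / N.+1%:R))) - f 0)
    <= 8 * pi * M / N.+1%:R.
Proof.
move=> fh fM.
set S := \sum_(k < _) _.
have [u u1 ud] := rotate_to_real (N.+1%:R^-1 * S - f 0).
have N0 : 0 < N.+1%:R :> R by rewrite ltr0n.
have pi2 : 0 < 2 * pi :> R by rewrite mulr_gt0 ?pi_gt0.
pose h : R := 2 * pi / N.+1%:R; have h0 : 0 < h by rewrite divr_gt0.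
have Nh : N.+1%:R * h = 2 * pi by rewrite mulrC divfK // gt_eqF.
pose phi t := complex.Re (u * f (circ t)).
have lip s t : `|phi s - phi t| <= 4 * M * `|s - t|.
  rewrite -ReN -ReD -mulrBr; apply: le_trans (Re_le_cabs _) _; rewrite cabsM u1 mul1r.
  have c1 v : cabs (circ v - 0) <= 2 / 2 by rewrite subr0 cabs_circ divff.
  apply: le_trans (cauchy_lipschitz (ltr0n _ 2) fh fM (c1 t) (c1 s)) _.
  have M0 : 0 <= M by apply: le_trans (fM 0 _); rewrite ?cabs_ge0 // subrr cabs0.
  have -> : 4 * M * `|s - t| = 4 * M / 2 * (2 * `|s - t|) by field.
  by rewrite ler_wpM2l ?circ_lipschitz // divr_ge0 // mulr_ge0.
have uf1 : ccont (fun z => u * f z) 0.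
  have [d hd] : exists d, cdiff f 0 d by apply: fh; rewrite subrr cabs0.
  exact: cdiff_ccont (cdiffZ u hd).
have uf2 z : 0 < cabs z -> cabs z <= 1 -> exists d, cdiff (fun z => u * f z) z d.
  move=> _ z1; have [d hd] : exists d, cdiff f z d by apply: fh; rewrite subr0; lra.
  by exists (u * d); exact: cdiffZ.
have mv := mean_value_Re ltr01 uf1 uf2; rewrite ln1 in mv.
have cts := cts_circle ltr01 uf2; rewrite ln1 in cts.
have := @riemann_sum_le phi (4 * M) h N.+1 (ltW h0).
rewrite Nh => /(_ cts lip); rewrite [integ _ _ _]mv => H.
have -> : cabs (N.+1%:R^-1 * S - f 0) =
    - ((2 * pi * complex.Re (u * f 0) - \sum_(k < N.+1) phi (k%:R * h) * h) / (2 * pi)).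
  have -> : cabs (N.+1%:R^-1 * S - f 0) = complex.Re (u * (N.+1%:R^-1 * S - f 0)) by rewrite ud.
  rewrite mulrBr ReD ReN.
  rewrite -mulr_suml.
  have -> : complex.Re (u * (N.+1%:R^-1 * S)) = N.+1%:R^-1 * (\sum_(k < N.+1) phi (k%:R * h)).
    rewrite mulrCA.
    have -> : (N.+1%:R^-1 : C) = (N.+1%:R^-1 : R)%:C by rewrite fmorphV rmorph_nat.
    rewrite ReM /= mul0r subr0 /S mulr_sumr; congr (_ * _).
    by rewrite (@big_morph _ _ (@complex.Re R) 0 +%R) // => *; exact: ReD.
  have N0' : N.+1%:R != 0 :> R by rewrite gt_eqF.
  have pi0 : pi != 0 :> R by rewrite gt_eqF // pi_gt0.
  set T := \sum_(k < N.+1) _; set X := complex.Re _.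
  rewrite /h mulrBl [2 * pi * X]mulrC mulfK ?gt_eqF //.
  rewrite opprB; congr (_ - _); move: N0' pi0; move: (N.+1%:R : R) (pi : R) => a b a0 b0.
  by field; rewrite a0 b0.
apply: le_trans (ler_norm _) _.
rewrite normrN normrM [`|(2 * pi)^-1|]ger0_norm; last by rewrite invr_ge0 ltW.
rewrite ler_pdivrMr //.
apply: (le_trans H).
have -> : N.+1%:R * (4 * M * h * h) = (N.+1%:R * h) * (4 * M * h) by ring.
rewrite Nh /h.
rewrite le_eqVlt; apply/orP; left; apply/eqP.
have := gt_eqF N0; move: (N.+1%:R : R) (pi : R) => a b /negbT a0; by field.
Qed.

End root_average.

(** * The sup norm on C^n *)

Section rownorm.
Context {R : realType}.
Local Notation C := R[i].

(** The norm of a row vector is the maximum of the moduli of its coordinates, so balls are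
    polydiscs; the real part is taken as for [cabs]. *)
Definition rn n (v : 'rV[C]_n) : R := complex.Re `|v|.

Lemma rnE n (v : 'rV[C]_n) : `|v| = (rn v)%:C.
Proof. by rewrite /rn RRe_real // ger0_real. Qed.

Lemma rn_ge0 n (v : 'rV[C]_n) : 0 <= rn v.
Proof. by rewrite -ler0c -rnE. Qed.

Lemma rn0 n : rn (0 : 'rV[C]_n) = 0.
Proof. by rewrite /rn normr0. Qed.

Lemma rnN n (v : 'rV[C]_n) : rn (- v) = rn v.
Proof. by rewrite /rn normrN. Qed.

Lemma rnB n (v w : 'rV[C]_n) : rn (v - w) = rn (w - v).
Proof. by rewrite /rn distrC. Qed.

Lemma rnD n (v w : 'rV[C]_n) : rn (v + w) <= rn v + rn w.
Proof. by rewrite -lecR rmorphD /= -!rnE ler_normD. Qed.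

Lemma rnZ n k (v : 'rV[C]_n) : rn (k *: v) = cabs k * rn v.
Proof. by apply: complexI; rewrite -rnE normrZ cabsE rnE rmorphM. Qed.

Lemma rn_eq0 n (v : 'rV[C]_n) : (rn v == 0) = (v == 0).
Proof. by rewrite -[RHS]normr_eq0 rnE (inj_eq (@complexI _) _ 0). Qed.

Lemma rn_ltP n (v : 'rV[C]_n) (a : R) : 0 < a -> rn v < a <-> forall j, cabs (v 0 j) < a.
Proof.
move=> a0.
have -> : (rn v < a) = (`|0 - v| < a%:C) by rewrite sub0r normrN rnE ltcR.
have := congr1 (fun b => b 0 a%:C v) (mx_norm_ball C 1 n); rewrite /ball_ /= => <-.
split=> [+ j|H].
  by move=> [_ /(_ 0 j)]; rewrite /ball /= mxE sub0r normrN cabsE ltcR.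
split=> [|i j]; first by rewrite ltcR.
by rewrite /ball /= mxE sub0r normrN cabsE ltcR (ord1 i).
Qed.

Lemma cabs_le_rn n (v : 'rV[C]_n) j : cabs (v 0 j) <= rn v.
Proof.
apply/ler_addgt0Pl => e e0.
have a0 : 0 < e + rn v by rewrite ltr_pwDl // rn_ge0.
by apply: ltW; apply: (iffLR (rn_ltP v a0)); rewrite ltrDr.
Qed.

Lemma rn_le n (v : 'rV[C]_n) (a : R) : 0 <= a -> (forall j, cabs (v 0 j) <= a) -> rn v <= a.
Proof.
move=> a0 H; apply/ler_addgt0Pl => e e0.
apply/ltW/rn_ltP; first by rewrite ltr_pwDl.
by move=> j; apply: le_lt_trans (H j) _; rewrite ltrDr.
Qed.

Lemma rn_attained n (v : 'rV[C]_n) : (0 < n)%N -> exists j, rn v = cabs (v 0 j).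
Proof.
case: n v => // n v _.
have [j _ /= H] := @arg_maxP _ _ _ (ord0 : 'I_n.+1) predT (fun j => cabs (v 0 j)) isT.
exists j; apply/eqP; rewrite eq_le cabs_le_rn andbT.
by apply: rn_le => [|k]; [exact: cabs_ge0|exact: H].
Qed.

Lemma open_rn n (A : set 'rV[C]_n) (z : 'rV[C]_n) : open A -> A z ->
  exists2 r : R, 0 < r & forall w, rn (w - z) < r -> A w.
Proof.
move=> oA Az; have : nbhs z A by exact: open_nbhs_nbhs.
move=> /nbhs_ballP[e /= e0 H]; exists (complex.Re e).
  by move: e0; rewrite ltcE => /andP[].
move=> w wz; apply: H; rewrite mx_norm_ball /ball_ /= -opprB normrN rnE.
by rewrite -[e]RRe_real ?gtr0_real // ltcR.
Qed.

Lemma rn_open n (A : set 'rV[C]_n) :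
  (forall z, A z -> exists2 r : R, 0 < r & forall w, rn (w - z) < r -> A w) -> open A.
Proof.
move=> H; rewrite openE => z Az; have [r r0 Hr] := H z Az.
apply/nbhs_ballP; exists r%:C; first by rewrite /= ltcR.
move=> w; rewrite mx_norm_ball /ball_ /= -opprB normrN rnE ltcR.
exact: Hr.
Qed.

Lemma bounded_rn n (A : set 'rV[C]_n) : bounded_set A -> exists2 M : R, 0 < M & forall z, A z -> rn z <= M.
Proof.
move=> [M [Mr HM]].
exists (complex.Re `|M| + 1).
  by rewrite ltr_pwDr // -ler0c RRe_real // ger0_real.
have MK : M < `|M| + 1.
  by rewrite (le_lt_trans (real_ler_norm Mr)) // ltrDl.
move=> z Az; have /= := HM _ MK z Az; rewrite rnE cabsE => h.
by rewrite -lecR rmorphD rmorph1 /= -/(cabs M).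
Qed.

End rownorm.

(** * Differentials and estimates on balls *)

Section frechet.
Context {R : realType}.
Local Notation C := R[i].

Lemma differentiable_expansion n (W : normedModType C) (f : 'rV[C]_n -> W) z : differentiable f z ->
  forall e : R, 0 < e -> exists2 r : R, 0 < r & forall h, rn h < r ->
    `|f (z + h) - f z - 'd f z h| <= e%:C * (rn h)%:C.
Proof.
move=> df e e0; have e0' : 0 < e%:C :> C by rewrite ltcR.
have /eqaddoP/(_ _ e0') := diff_locally df.
move=> /nbhs_ballP[r /= r0 H]; exists (complex.Re r).
  by move: r0; rewrite ltcE => /andP[].
move=> h hr; have := H h; rewrite mx_norm_ball /ball_ /= sub0r normrN rnE.
rewrite -[r in _ < r]RRe_real ?gtr0_real // ltcR => /(_ hr).
by rewrite !fctE /= opprD addrA (addrC h).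
Qed.

Lemma expansion_differentiable n (W : normedModType C) (f : 'rV[C]_n -> W) z (L : {linear 'rV[C]_n -> W}) :
  (exists2 K : R, 0 <= K & forall h, `|L h| <= (K * rn h)%:C) ->
  (forall e : R, 0 < e -> exists2 r : R, 0 < r & forall h, rn h < r ->
    `|f (z + h) - f z - L h| <= (e * rn h)%:C) ->
  differentiable f z /\ 'd f z = L :> ('rV[C]_n -> W).
Proof.
move=> [K K0 HK] H.
have cL : continuous L.
  apply/linear_bounded_continuous.
  exists K%:C; split; first by rewrite complex_real.
  move=> X KX; apply/nbhs_ballP; exists 1; first by rewrite /= ltr01.
  move=> h; rewrite mx_norm_ball /ball_ /= sub0r normrN rnE -[1]/(1%:C) ltcR => h1.
  apply: le_trans (HK h) _; apply: le_trans (ltW KX).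
  by rewrite lecR ler_piMr // ltW.
have hE : (f \o shift z : 'rV[C]_n -> W) = (cst (f z) : 'rV[C]_n -> W) + (L : 'rV[C]_n -> W) +o_ (0 : 'rV[C]_n) id.
  apply/eqaddoP => e e0.
  have Re0 : 0 < complex.Re e by move: e0; rewrite ltcE => /andP[].
  have [r r0 Hr] := H _ Re0.
  apply/nbhs_ballP; exists r%:C; first by rewrite /= ltcR.
  move=> h; rewrite mx_norm_ball /ball_ /= sub0r normrN rnE ltcR => hr.
  rewrite !fctE /= opprD addrA (addrC h).
  apply: le_trans (Hr h hr) _.
  by rewrite rmorphM /= RRe_real ?gtr0_real // rnE.
have dL : 'd f z = L :> ('rV[C]_n -> W) by exact: diff_unique.
by split=> //; apply/diff_locallyP; rewrite dL.
Qed.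

(* Sealing the differential keeps conversion from unfolding its definition by choice. *)
Lemma dd_seal n : {D : ('rV[C]_n -> C) -> 'rV[C]_n -> 'rV[C]_n -> C | forall f z v, D f z v = 'd f z v}.
Proof. by exists (fun f z v => 'd f z v). Qed.

Definition dd n := sval (dd_seal n).

Lemma ddE n (f : 'rV[C]_n -> C) z v : dd f z v = 'd f z v.
Proof. exact: (svalP (dd_seal n)). Qed.

Lemma ddZ n (f : 'rV[C]_n -> C) z (c : C) v : dd f z (c *: v) = c * dd f z v.
Proof. by rewrite !ddE linearZ. Qed.

Lemma dd0 n (f : 'rV[C]_n -> C) z : dd f z 0 = 0.
Proof. by rewrite ddE linear0. Qed.

Lemma dd_sum n (f : 'rV[C]_n -> C) z I (s : seq I) (P : pred I) (F : I -> 'rV[C]_n) :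
  dd f z (\sum_(i <- s | P i) F i) = \sum_(i <- s | P i) dd f z (F i).
Proof. by rewrite ddE linear_sum; apply: eq_bigr => i _; rewrite ddE. Qed.

Lemma dd_expansion n (f : 'rV[C]_n -> C) z : differentiable f z ->
  forall e : R, 0 < e -> exists2 r : R, 0 < r & forall h, rn h < r ->
    cabs (f (z + h) - f z - dd f z h) <= e * rn h.
Proof.
move=> df e e0; have [r r0 H] := differentiable_expansion df e0; exists r => // h /H.
by rewrite -rmorphM /= [`|_|]cabsE lecR ddE.
Qed.

(** Estimates in one variable reach several variables by restriction to complex lines. *)
Lemma differentiable_line n (f : 'rV[C]_n -> C) z v a : differentiable f (z + a *: v) ->
  cdiff (fun t => f (z + t *: v)) a (dd f (z + a *: v) v).
Proof.
move=> df e e0.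
pose K := rn v + 1; have K0 : 0 < K by rewrite ltr_wpDl ?rn_ge0.
have [r r0 H] := dd_expansion df (divr_gt0 e0 K0).
exists (r / K); first by rewrite divr_gt0.
move=> t ta; pose h := (t - a) *: v.
have hK : rn h <= K * cabs (t - a).
  by rewrite /h rnZ mulrC ler_wpM2r ?cabs_ge0 // lerDl.
have := H h (le_lt_trans hK _); rewrite mulrC -ltr_pdivlMr // => /(_ ta).
have -> : z + a *: v + h = z + t *: v by rewrite -addrA -scalerDl (addrC a) subrK.
rewrite /h ddZ [(t - a) * _]mulrC.
move=> k; apply: le_trans k _; rewrite -/h.
by rewrite -mulrA ler_pM2l // mulrC ler_pdivrMr // mulrC.
Qed.

Lemma rn_scale_eq n (h : 'rV[C]_n) : h != 0 -> rn ((rn h)^-1%:C *: h) = 1.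
Proof.
move=> h0; have rh : 0 < rn h by rewrite lt_neqAle rn_ge0 eq_sym rn_eq0 h0.
by rewrite rnZ cabs_real ger0_norm ?invr_ge0 ?rn_ge0 // mulVf // gt_eqF.
Qed.

Section holomorphic_ball.
Variables (n : nat) (f : 'rV[C]_n -> C) (z : 'rV[C]_n) (r M : R).
Hypothesis r0 : 0 < r.
Hypothesis fh : forall w, rn (w - z) <= r -> differentiable f w.
Hypothesis fM : forall w, rn (w - z) <= r -> cabs (f w) <= M.

Let lineP (v : 'rV[C]_n) (t : C) : rn v <= 1 -> cabs (t - 0) <= r -> rn (z + t *: v - z) <= r.
Proof.
move=> v1; rewrite subr0 => tr; rewrite addrAC subrr add0r rnZ.
by rewrite -[r]mulr1; apply: ler_pM; rewrite ?cabs_ge0 ?rn_ge0.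
Qed.

Lemma hol_bound_ge0 : 0 <= M.
Proof. by apply: le_trans (fM (w := z) _); rewrite ?cabs_ge0 // subrr rn0 ltW. Qed.

Lemma hol_chol v : rn v <= 1 -> chol (fun t => f (z + t *: v)) 0 r.
Proof.
move=> v1 t tr; exists (dd f (z + t *: v) v); apply: differentiable_line.
by apply: fh; exact: lineP.
Qed.

(** Cauchy's estimate on the complex line in the direction v / |v|, then homogeneity. *)
Lemma hol_diff_bound v : cabs (dd f z v) <= 2 * M / r * rn v.
Proof.
have [->|v0] := eqVneq v 0; first by rewrite dd0 cabs0 rn0 mulr0.
have rv : 0 < rn v by rewrite lt_neqAle rn_ge0 eq_sym rn_eq0 v0.
pose u := (rn v)^-1%:C *: v; have u1 : rn u = 1 := rn_scale_eq v0.
have hl := @differentiable_line n f z u 0.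
rewrite scale0r addr0 in hl.
have hz : differentiable f z by apply: fh; rewrite subrr rn0 ltW.
have u1' : rn u <= 1 by rewrite u1.
have := @cauchy_estimate _ (fun t => f (z + t *: u)) 0 r M _ r0 (hol_chol u1')
  (fun t tr => fM (lineP u1' tr)) (hl hz).
rewrite /u ddZ cabsM cabs_real ger0_norm ?invr_ge0 ?rn_ge0 //.
by rewrite mulrC ler_pdivrMr.
Qed.

Lemma hol_taylor h : rn h <= r / 4 ->
  cabs (f (z + h) - f z - dd f z h) <= 32 * M / r ^+ 2 * rn h ^+ 2.
Proof.
move=> hr.
have [->|v0] := eqVneq h 0.
  by rewrite dd0 addr0 subrr subr0 cabs0 rn0 expr0n mulr0.
have rv : 0 < rn h by rewrite lt_neqAle rn_ge0 eq_sym rn_eq0 v0.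
pose u := (rn h)^-1%:C *: h; have u1 : rn u = 1 := rn_scale_eq v0.
have uh : (rn h)%:C *: u = h.
  by rewrite /u scalerA -rmorphM divff ?gt_eqF // rmorph1 scale1r.
have hl := @differentiable_line n f z u 0.
rewrite scale0r addr0 in hl.
have hz : differentiable f z by apply: fh; rewrite subrr rn0 ltW.
have u1' : rn u <= 1 by rewrite u1.
have hb : cabs ((rn h)%:C - 0) <= r / 4 by rewrite subr0 cabs_real ger0_norm ?rn_ge0.
have := @taylor1 _ (fun t => f (z + t *: u)) 0 r M r0 (hol_chol u1')
  (fun t tr => fM (lineP u1' tr)) _ _ hb (hl hz).
rewrite scale0r addr0 uh subr0 cabs_real ger0_norm ?rn_ge0 //.
by have -> : dd f z u * (rn h)%:C = dd f z h by rewrite mulrC -ddZ uh.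
Qed.

End holomorphic_ball.

End frechet.

(** * Limits and derivatives of holomorphic functions *)

Section weierstrass.
Context {R : realType}.
Local Notation C := R[i].

Lemma complex_complete (u : nat -> C) :
  (forall e : R, 0 < e -> exists K, forall k l, (K <= k)%N -> (K <= l)%N -> cabs (u k - u l) <= e) ->
  exists a, forall e : R, 0 < e -> exists K, forall k, (K <= k)%N -> cabs (u k - a) <= e.
Proof.
move=> H.
have real_complete (x : nat -> R) :
    (forall e : R, 0 < e -> exists K, forall k l, (K <= k)%N -> (K <= l)%N -> `|x k - x l| <= e) ->
    exists a, forall e : R, 0 < e -> exists K, forall k, (K <= k)%N -> `|x k - a| <= e.
  move=> Hx; have : cvgn x.
    apply/cauchy_cvgP/cauchy_ballP => e e0.
    have [K HK] := Hx (e / 2) (divr_gt0 e0 (ltr0n _ 2)).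
    exists ([set x k | k in [set k | (K <= k)%N]], [set x k | k in [set k | (K <= k)%N]]) => /=.
      by split; exists K => // k /= Kk; exists k.
    move=> [_ _] [[k Kk <-] [l Kl <-]] /=.
    by rewrite /ball /=; apply: le_lt_trans (HK k l Kk Kl) _; rewrite ltr_pdivrMr // ltr_pMr // ltr1n.
  move=> /cvg_ex [a xa]; exists a => e e0.
  have /cvgrPdist_le/(_ e e0)[K _ HK] := xa.
  by exists K => k Kk; rewrite distrC; exact: HK.
have [a Ha] : exists a, forall e : R, 0 < e -> exists K, forall k, (K <= k)%N -> `|complex.Re (u k) - a| <= e.
  apply: real_complete => e e0; have [K HK] := H e e0; exists K => k l Kk Kl.
  by rewrite -ReN -ReD; apply: le_trans (Re_le_cabs _) _; exact: HK.
have [b Hb] : exists a, forall e : R, 0 < e -> exists K, forall k, (K <= k)%N -> `|complex.Im (u k) - a| <= e.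
  apply: real_complete => e e0; have [K HK] := H e e0; exists K => k l Kk Kl.
  by rewrite -ImN -ImD; apply: le_trans (Im_le_cabs _) _; exact: HK.
exists (a +i* b) => e e0; have e20 : 0 < e / 2 by rewrite divr_gt0.
have [K1 HK1] := Ha _ e20; have [K2 HK2] := Hb _ e20.
exists (maxn K1 K2) => k; rewrite geq_max => /andP[/HK1 h1 /HK2 h2].
apply: le_trans (cabs_le _) _; rewrite [e]splitr !ReD !ImD !ReN !ImN /=.
exact: lerD.
Qed.

Lemma holB n (f g : 'rV[C]_n -> C) z : differentiable f z -> differentiable g z ->
  differentiable (fun w => f w - g w) z /\
  forall v, dd (fun w => f w - g w) z v = dd f z v - dd g z v.
Proof.
move=> df dg; split; first by apply: differentiableB.
by move=> v; rewrite !ddE; have E := diffB df dg; exact: (congr1 (fun h => h v) E).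
Qed.

Lemma holD n (f g : 'rV[C]_n -> C) z : differentiable f z -> differentiable g z ->
  differentiable (fun w => f w + g w) z /\
  forall v, dd (fun w => f w + g w) z v = dd f z v + dd g z v.
Proof.
move=> df dg; split; first by apply: differentiableD.
by move=> v; rewrite !ddE; have E := diffD df dg; exact: (congr1 (fun h => h v) E).
Qed.

Lemma hol_cst n (c : C) (z : 'rV[C]_n) :
  differentiable (fun _ : 'rV[C]_n => c) z /\ forall v, dd (fun _ : 'rV[C]_n => c) z v = 0.
Proof.
split; first exact: differentiable_cst.
by move=> v; rewrite ddE; have E := @diff_cst _ _ _ c z; exact: (congr1 (fun h => h v) E).
Qed.

Lemma holM n (f g : 'rV[C]_n -> C) z : differentiable f z -> differentiable g z ->
  differentiable (fun w => f w * g w) z /\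
  forall v, dd (fun w => f w * g w) z v = f z * dd g z v + g z * dd f z v.
Proof.
move=> df dg; split; first by apply: differentiableM.
by move=> v; rewrite !ddE; have E := diffM df dg; exact: (congr1 (fun h => h v) E).
Qed.

(** Linear forms given by coefficients: the coefficients bound the form, which provides the
    continuity required of a differential. *)
Definition lin_comb n (a : 'I_n -> C) (h : 'rV[C]_n) : C := \sum_j h 0 j * a j.

Lemma lin_comb_is_linear n (a : 'I_n -> C) : linear (@lin_comb n a).
Proof.
move=> k u v; rewrite /lin_comb scaler_sumr -big_split; apply: eq_bigr => j _.
by rewrite !mxE mulrDl -mulrA.
Qed.

HB.instance Definition _ n (a : 'I_n -> C) :=
  GRing.isLinear.Build C 'rV[C]_n C _ (@lin_comb n a) (@lin_comb_is_linear n a).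

Lemma dd_lin_comb n (f : 'rV[C]_n -> C) z h :
  dd f z h = lin_comb (fun j => dd f z (delta_mx 0 j)) h.
Proof.
rewrite [h in LHS]matrix_sum_delta big_ord1 dd_sum; apply: eq_bigr => j _.
by rewrite ddZ.
Qed.

Lemma lin_comb_bound n (a : 'I_n -> C) h : cabs (lin_comb a h) <= (\sum_j cabs (a j)) * rn h.
Proof.
apply: le_trans (cabs_sum _ _ _) _; rewrite mulr_suml; apply: ler_sum => j _.
by rewrite cabsM mulrC ler_wpM2l ?cabs_ge0 // cabs_le_rn.
Qed.

Lemma expansion_hol n (f : 'rV[C]_n -> C) z (a : 'I_n -> C) :
  (forall e : R, 0 < e -> exists2 r : R, 0 < r & forall h, rn h < r ->
    cabs (f (z + h) - f z - lin_comb a h) <= e * rn h) ->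
  differentiable f z /\ forall h, dd f z h = lin_comb a h.
Proof.
move=> H.
have [] := @expansion_differentiable R n C f z (lin_comb a : {linear 'rV[C]_n -> C}).
- exists (\sum_j cabs (a j)); first by apply: sumr_ge0 => j _; exact: cabs_ge0.
  by move=> h; rewrite [`|_|]cabsE lecR lin_comb_bound.
- by move=> e /H[r r0 Hr]; exists r => // h /Hr; rewrite [`|_|]cabsE lecR.
by move=> df Hd; split=> [|h]; [exact: df|rewrite ddE Hd].
Qed.

Lemma hol_near_eq n (f g : 'rV[C]_n -> C) z (r : R) : 0 < r ->
  (forall w, rn (w - z) < r -> f w = g w) -> differentiable f z ->
  differentiable g z /\ forall v, dd g z v = dd f z v.
Proof.
move=> r0 fg df.
have [|d1 d2] := @expansion_hol n g z (fun j => dd f z (delta_mx 0 j)).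
  move=> e e0; have [s s0 H] := dd_expansion df e0.
  exists (Num.min r s); first by rewrite lt_min r0.
  move=> h; rewrite lt_min => /andP[hr /H].
  rewrite -dd_lin_comb fg; last by rewrite addrAC subrr add0r.
  by rewrite fg // subrr rn0.
split; first exact: d1.
by move=> v; rewrite d2 -dd_lin_comb.
Qed.

Lemma hol_shift n (f : 'rV[C]_n -> C) z a : differentiable f (z + a) ->
  differentiable (fun w => f (w + a)) z /\ forall v, dd (fun w => f (w + a)) z v = dd f (z + a) v.
Proof.
move=> df.
have [|d1 d2] := @expansion_hol n (fun w => f (w + a)) z (fun j => dd f (z + a) (delta_mx 0 j)).
  move=> e e0; have [s s0 H] := dd_expansion df e0.
  by exists s => // h /H; rewrite -dd_lin_comb (addrAC z a h).
split; first exact: d1.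
by move=> v; rewrite d2 -dd_lin_comb.
Qed.

Lemma coef_ge0 k (x r : R) : 0 <= x -> 0 <= k%:R * x / r ^+ 2.
Proof. by move=> x0; rewrite divr_ge0 ?sqr_ge0 ?mulr_ge0 ?ler0n. Qed.

(** By Cauchy's estimate for F k - F l the derivatives at [z] form Cauchy sequences. The quadratic
    Taylor bound is uniform in k and passes to the limit, so the limit [L] of the derivatives is the
    differential of [f]. *)
Lemma weierstrass n (F : nat -> 'rV[C]_n -> C) (f : 'rV[C]_n -> C) z (r M : R) : 0 < r ->
  (forall k w, rn (w - z) <= r -> differentiable (F k) w) ->
  (forall k w, rn (w - z) <= r -> cabs (F k w) <= M) ->
  (forall e : R, 0 < e -> exists K, forall k w, (K <= k)%N -> rn (w - z) <= r -> cabs (F k w - f w) <= e) ->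
  differentiable f z /\ forall v (e : R), 0 < e -> exists K, forall k, (K <= k)%N ->
    cabs (dd (F k) z v - dd f z v) <= e.
Proof.
move=> r0 Fh FM Ff.
have zz : rn (z - z) <= r by rewrite subrr rn0 ltW.
have Fz k : differentiable (F k) z by exact: Fh.
have cau v : exists a, forall e : R, 0 < e -> exists K, forall k, (K <= k)%N -> cabs (dd (F k) z v - a) <= e.
  apply: complex_complete => e e0.
  pose c := 2 / r * (rn v + 1).
  have c0 : 0 < c by rewrite mulr_gt0 ?divr_gt0 // ltr_wpDl ?rn_ge0.
  have [K HK] := Ff (e / c / 2) (divr_gt0 (divr_gt0 e0 c0) (ltr0n _ 2)).
  exists K => k l Kk Kl.
  have dB w : rn (w - z) <= r -> differentiable (fun w => F k w - F l w) w.
    by move=> wz; have [] := holB (Fh k _ wz) (Fh l _ wz).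
  have [_ <-] := holB (Fz k) (Fz l).
  have bB w : rn (w - z) <= r -> cabs (F k w - F l w) <= e / c.
    move=> wz.
    have -> : F k w - F l w = (F k w - f w) - (F l w - f w) by ring.
    by apply: le_trans (cabsD _ _) _; rewrite cabsN [e / c]splitr lerD // HK.
  apply: le_trans (hol_diff_bound r0 dB bB v) _.
  have -> : 2 * (e / c) / r * rn v = e * ((2 / r * rn v) / c) by ring.
  rewrite ler_piMr //; first exact: ltW.
  rewrite ler_pdivrMr // mul1r /c ler_wpM2l ?lerDl //.
  by rewrite divr_ge0 // ltW.
have /choice[L HL] := cau.
have M0 : 0 <= M := hol_bound_ge0 r0 (FM 0%N).
have key h : rn h <= r / 4 -> cabs (f (z + h) - f z - L h) <= 32 * M / r ^+ 2 * rn h ^+ 2.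
  move=> hr; apply/ler_addgt0Pl => e e0; have e30 : 0 < e / 3 by rewrite divr_gt0.
  have [K1 H1] := HL h _ e30; have [K2 H2] := Ff _ e30.
  pose k := maxn K1 K2.
  have {}H1 := H1 k (leq_maxl _ _).
  have {}H2 w := H2 k w (leq_maxr _ _).
  have hz : rn (z + h - z) <= r.
    by rewrite addrAC subrr add0r; have : 0 < r by []; lra.
  have h1 := H2 _ hz; have h2 := H2 _ zz.
  have := hol_taylor r0 (Fh k) (FM k) hr.
  set T := F k (z + h) - _ - _ => hT.
  have -> : f (z + h) - f z - L h =
    T - (F k (z + h) - f (z + h)) + (F k z - f z) + (dd (F k) z h - L h).
    by rewrite /T; ring.
  apply: le_trans (cabsD _ _) _; apply: le_trans (lerD (cabsD _ _) (lexx _)) _.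
  apply: le_trans (lerD (lerD (cabsD _ _) (lexx _)) (lexx _)) _; rewrite cabsN.
  have -> : e = e / 3 + e / 3 + e / 3 by field.
  lra.
(* [L] was chosen separately for each vector; its linearity is inherited from the differentials of
   [F k] through the finitely many basis vectors. *)
have Llin h : L h = lin_comb (fun j => L (delta_mx 0 j)) h.
  apply/eqP; rewrite -subr_eq0 -cabs_eq0 eq_le cabs_ge0 andbT.
  apply/ler_addgt0Pl => e e0; rewrite addr0.
  pose c := \sum_j (cabs (h 0 j)) + 1.
  have c0 : 0 < c by rewrite ltr_wpDl // sumr_ge0 // => j _; exact: cabs_ge0.
  have ec0 : 0 < e / c by rewrite divr_gt0.
  have [K1 H1] := HL h _ ec0.
  have /choice[K2 H2] : forall j, exists K, forall k, (K <= k)%N ->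
    cabs (dd (F k) z (delta_mx 0 j) - L (delta_mx 0 j)) <= e / c by move=> j; exact: HL.
  pose k := maxn K1 (\max_j K2 j).
  have {}H1 := H1 k (leq_maxl _ _).
  have {}H2 j : cabs (dd (F k) z (delta_mx 0 j) - L (delta_mx 0 j)) <= e / c.
    by apply: H2; apply: leq_trans (leq_maxr _ _); exact: leq_bigmax.
  have -> : L h - lin_comb (fun j => L (delta_mx 0 j)) h =
    (\sum_j h 0 j * (dd (F k) z (delta_mx 0 j) - L (delta_mx 0 j))) - (dd (F k) z h - L h).
    rewrite [dd (F k) z h]dd_lin_comb /lin_comb.
    have -> : \sum_j h 0 j * (dd (F k) z (delta_mx 0 j) - L (delta_mx 0 j)) =
      \sum_j h 0 j * dd (F k) z (delta_mx 0 j) - \sum_j h 0 j * L (delta_mx 0 j).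
      by rewrite -sumrB; apply: eq_bigr => j _; rewrite mulrBr.
    by ring.
  apply: le_trans (cabsD _ _) _; rewrite cabsN.
  have -> : e = (\sum_j cabs (h 0 j)) * (e / c) + e / c.
    have -> : (\sum_j cabs (h 0 j)) * (e / c) + e / c = c * (e / c) by rewrite /c; ring.
    by rewrite mulrC divfK // gt_eqF.
  apply: lerD => //; apply: le_trans (cabs_sum _ _ _) _; rewrite mulr_suml.
  by apply: ler_sum => j _; rewrite cabsM ler_wpM2l ?cabs_ge0.
have [|df dE] := @expansion_hol n f z (fun j => L (delta_mx 0 j)).
  move=> e e0; pose c := 32 * M / r ^+ 2 + 1.
  have c0 : 0 < c by rewrite ltr_wpDl // coef_ge0.
  exists (Num.min (r / 4) (e / c)); first by rewrite lt_min !divr_gt0.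
  move=> h; rewrite lt_min => /andP[/ltW h1 h2]; rewrite -Llin.
  apply: le_trans (key h h1) _; rewrite [rn h ^+ 2]expr2 mulrA ler_wpM2r ?rn_ge0 //.
  apply: (@le_trans _ _ (c * rn h)); first by rewrite ler_wpM2r ?rn_ge0 // lerDl.
  by rewrite mulrC -ler_pdivlMr // ltW.
split; first exact: df.
by move=> v e e0; have [K HK] := HL v e e0; exists K => k Kk; rewrite dE -Llin; exact: HK.
Qed.

Lemma hol_scale n k (f : 'rV[C]_n -> C) z : differentiable f z ->
  differentiable (fun w => k * f w) z /\ forall v, dd (fun w => k * f w) z v = k * dd f z v.
Proof.
move=> df; have [dk ek] := hol_cst k z; have [d e] := holM dk df.
split; first exact: d.
by move=> v; rewrite (e v) (ek v) mulr0 addr0.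
Qed.

Lemma hol_sum n I (s : seq I) (P : pred I) (F : I -> 'rV[C]_n -> C) z : (forall i, P i -> differentiable (F i) z) ->
  differentiable (fun w => \sum_(i <- s | P i) F i w) z /\
  forall v, dd (fun w => \sum_(i <- s | P i) F i w) z v = \sum_(i <- s | P i) dd (F i) z v.
Proof.
move=> dF; elim: s => [|i s [IH1 IH2]].
  have -> : (fun w => \sum_(i <- [::] | P i) F i w) = fun=> 0.
    by apply/funext => w; rewrite big_nil.
  have [d e] := hol_cst 0 z; split; first exact: d.
  by move=> v; rewrite (e v) big_nil.
have [Pi|nPi] := boolP (P i).
  have -> : (fun w => \sum_(i <- i :: s | P i) F i w) = fun w => F i w + \sum_(i <- s | P i) F i w.
    by apply/funext => w; rewrite big_cons Pi.
  have [d e] := holD (dF i Pi) IH1; split; first exact: d.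
  by move=> v; rewrite (e v) (IH2 v) big_cons Pi.
have -> : (fun w => \sum_(i <- i :: s | P i) F i w) = fun w => \sum_(i <- s | P i) F i w.
  by apply/funext => w; rewrite big_cons (negbTE nPi).
split; first exact: IH1.
by move=> v; rewrite (IH2 v) big_cons (negbTE nPi).
Qed.

Lemma hol_prod n I (s : seq I) (F : I -> 'rV[C]_n -> C) z : (forall i, differentiable (F i) z) ->
  differentiable (fun w => \prod_(i <- s) F i w) z.
Proof.
move=> dF; elim: s => [|i s IH].
  have -> : (fun w => \prod_(i <- [::]) F i w) = fun=> 1.
    by apply/funext => w; rewrite big_nil.
  by have [d _] := hol_cst 1 z; exact: d.
have -> : (fun w => \prod_(i <- i :: s) F i w) = fun w => F i w * \prod_(i <- s) F i w.
  by apply/funext => w; rewrite big_cons.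
by have [d _] := holM (dF i) IH; exact: d.
Qed.

Lemma hol_coord n m (f : 'rV[C]_n -> 'rV[C]_m) z j : differentiable f z ->
  differentiable (fun w => f w 0 j) z /\ forall v, dd (fun w => f w 0 j) z v = 'd f z v 0 j.
Proof.
move=> df; have E v : 'd f z v 0 j = lin_comb (fun i => 'd f z (delta_mx 0 i) 0 j) v.
  rewrite [v in LHS]matrix_sum_delta big_ord1 linear_sum summxE; apply: eq_bigr => i _.
  by rewrite linearZ mxE.
have [|d1 d2] := @expansion_hol n (fun w => f w 0 j) z (fun i => 'd f z (delta_mx 0 i) 0 j).
  move=> e e0; have [r r0 H] := differentiable_expansion df e0; exists r => // h /H.
  rewrite -E -rmorphM /= rnE lecR => k; apply: le_trans k; apply: le_trans (cabs_le_rn _ j).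
  by rewrite !mxE.
split; first exact: d1.
by move=> v; rewrite (d2 v) E.
Qed.

Lemma hol_continuous n (f : 'rV[C]_n -> C) z : differentiable f z ->
  forall e : R, 0 < e -> exists2 r : R, 0 < r & forall w, rn (w - z) <= r -> cabs (f w - f z) <= e.
Proof.
move=> df e e0; have [r r0 H] := dd_expansion df ltr01.
pose K := \sum_j cabs (dd f z (delta_mx 0 j)) + 1.
have K0 : 0 < K by rewrite ltr_wpDl // sumr_ge0 // => j _; exact: cabs_ge0.
exists (Num.min (r / 2) (e / (K + 1))).
  by rewrite lt_min !divr_gt0 // addr_gt0.
move=> w; rewrite le_min => /andP[w1 w2].
have hr : rn (w - z) < r by apply: le_lt_trans w1 _; rewrite ltr_pdivrMr // ltr_pMr // ltr1n.
have := H _ hr; rewrite (addrC z) subrK mul1r => h1.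
have h2 := lin_comb_bound (fun j => dd f z (delta_mx 0 j)) (w - z).
rewrite -dd_lin_comb in h2.
have -> : f w - f z = (f w - f z - dd f z (w - z)) + dd f z (w - z) by ring.
apply: le_trans (cabsD _ _) _; apply: le_trans (lerD h1 h2) _.
have h3 : (K + 1) * rn (w - z) <= e by rewrite mulrC -ler_pdivlMr // addr_gt0.
apply: le_trans h3; rewrite -[X in X + _]mul1r -mulrDl ler_wpM2r ?rn_ge0 // /K.
by rewrite addrC -addrA lerD2l lerDl.
Qed.

Lemma hol_local n (Om : set 'rV[C]_n) (f : 'rV[C]_n -> C) z : open Om -> holomorphic_on Om f -> Om z ->
  exists r M : R, [/\ 0 < r, forall w, rn (w - z) <= r -> Om w & forall w, rn (w - z) <= r -> cabs (f w) <= M].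
Proof.
move=> oO fh Oz; have [r r0 Hr] := open_rn oO Oz.
have [s s0 Hs] := hol_continuous (fh z Oz) ltr01.
exists (Num.min (r / 2) s), (cabs (f z) + 1); split.
- by rewrite lt_min s0 divr_gt0.
- move=> w; rewrite le_min => /andP[w1 _]; apply: Hr; apply: le_lt_trans w1 _.
  by rewrite ltr_pdivrMr // ltr_pMr // ltr1n.
- move=> w; rewrite le_min => /andP[_ /Hs h].
  have -> : f w = f z + (f w - f z) by ring.
  by apply: le_trans (cabsD _ _) _; rewrite lerD2l.
Qed.

Lemma ball_sub n (z w x : 'rV[C]_n) (s t r : R) : s + t <= r -> rn (w - z) <= s -> rn (x - w) <= t -> rn (x - z) <= r.
Proof.
move=> str wz xw; have -> : x - z = (w - z) + (x - w) by rewrite [RHS]addrC addrA subrK.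
by apply: le_trans (rnD _ _) _; apply: le_trans (lerD wz xw) _.
Qed.

Section derivative_function.
Variables (n : nat) (f : 'rV[C]_n -> C) (z : 'rV[C]_n) (r M : R).
Hypothesis r0 : 0 < r.
Hypothesis fh : forall w, rn (w - z) <= r -> differentiable f w.
Hypothesis fM : forall w, rn (w - z) <= r -> cabs (f w) <= M.

Lemma hol_derive_bound v w : rn (w - z) <= r / 2 -> cabs (dd f w v) <= 4 * M / r * rn v.
Proof.
move=> wz; have r20 : 0 < r / 2 by rewrite divr_gt0.
have sub x : rn (x - w) <= r / 2 -> rn (x - z) <= r by apply: ball_sub wz; rewrite -splitr.
have := hol_diff_bound r20 (fun x h => fh (sub x h)) (fun x h => fM (sub x h)) v.
by have -> : 4 * M / r = 2 * M / (r / 2) by field; rewrite gt_eqF.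
Qed.

Lemma hol_derive_taylor w h : rn (w - z) <= r / 2 -> rn h <= r / 8 ->
  cabs (f (w + h) - f w - dd f w h) <= 128 * M / r ^+ 2 * rn h ^+ 2.
Proof.
move=> wz hr; have r20 : 0 < r / 2 by rewrite divr_gt0.
have sub x : rn (x - w) <= r / 2 -> rn (x - z) <= r by apply: ball_sub wz; rewrite -splitr.
have hr' : rn h <= r / 2 / 4 by apply: le_trans hr _; lra.
have := hol_taylor r20 (fun x h => fh (sub x h)) (fun x h => fM (sub x h)) hr'.
by have -> : 128 * M / r ^+ 2 = 32 * M / (r / 2) ^+ 2 by field; rewrite gt_eqF.
Qed.

(** The difference quotients [F k] with steps [t k] converge to the derivative uniformly near [z],
    by the Taylor bound, so [weierstrass] applies to them. *)
Lemma hol_derive v : differentiable (fun w => dd f w v) z.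
Proof.
have M0 : 0 <= M := hol_bound_ge0 r0 fM.
pose V := rn v + 1; have V0 : 0 < V by rewrite ltr_wpDl ?rn_ge0.
(* With V = |v| + 1 the increment t k v has norm at most r / 8 / k.+1, within the range of
   [hol_derive_taylor], also for v = 0. *)
pose t k : R := r / 8 / V / k.+1%:R.
have t0 k : 0 < t k by rewrite !divr_gt0.
have tV k : t k * rn v <= r / 8 / k.+1%:R.
  rewrite /t -[X in _ <= X]mulr1 -!mulrA ler_pM2l // ler_pM2l ?invr_gt0 //.
  by rewrite mulr1 mulrCA ler_piMr ?invr_ge0 // mulrC ler_pdivrMr // mul1r lerDl.
have tV8 k : t k * rn v <= r / 8.
  apply: le_trans (tV k) _; rewrite ler_pdivrMr // ler_peMr ?divr_ge0 ?(ltW r0) //.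
  by rewrite ler1n.
pose F k (w : 'rV[C]_n) := (t k)^-1%:C * (f (w + (t k)%:C *: v) - f w).
have r40 : 0 < r / 4 by rewrite divr_gt0.
pose c := 128 * M / r ^+ 2 * (r / 8) * V.
have c0 : 0 <= c by rewrite mulr_ge0 ?(ltW V0) // mulr_ge0 ?coef_ge0 // divr_ge0 ?(ltW r0).
have half w : rn (w - z) <= r / 4 -> rn (w - z) <= r / 2.
  by move=> h; apply: le_trans h _; have : 0 < r by []; lra.
have rtv k : rn ((t k)%:C *: v) = t k * rn v.
  by rewrite rnZ cabs_real ger0_norm // ltW.
have FE k w : rn (w - z) <= r / 4 -> cabs (F k w - dd f w v) <= c / k.+1%:R.
  move=> wz; have hv : rn ((t k)%:C *: v) <= r / 8 by rewrite rtv.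
  have := hol_derive_taylor (half _ wz) hv.
  rewrite ddZ rtv => H.
  have tn0 : (t k)%:C != 0 :> C by rewrite -cabs_gt0 cabs_real normr_gt0 gt_eqF.
  have -> : F k w - dd f w v = (t k)^-1%:C * (f (w + (t k)%:C *: v) - f w - (t k)%:C * dd f w v).
    by rewrite /F fmorphV; field.
  rewrite cabsM cabs_real ger0_norm ?invr_ge0 ?(ltW (t0 _)) // mulrC ler_pdivrMr //.
  apply: le_trans H _; rewrite [(_ * _) ^+ 2]expr2 mulrA.
  have -> : c / k.+1%:R * t k = 128 * M / r ^+ 2 * (r / 8 / k.+1%:R) * (t k * V) by rewrite /c; ring.
  apply: ler_pM.
  - by rewrite mulr_ge0 ?coef_ge0 // mulr_ge0 ?rn_ge0 ?(ltW (t0 _)).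
  - by rewrite mulr_ge0 ?rn_ge0 ?(ltW (t0 _)).
  - by rewrite ler_wpM2l // coef_ge0.
  - by rewrite ler_pM2l // lerDl.
apply: (proj1 (@weierstrass n F (fun w => dd f w v) z (r / 4) (4 * M / r * rn v + c) r40 _ _ _)).
- move=> k w wz.
  have sh : differentiable (fun w => f (w + (t k)%:C *: v)) w.
    apply: (proj1 (hol_shift _)); apply: fh.
    have -> : w + (t k)%:C *: v - z = (w - z) + (t k)%:C *: v by rewrite addrAC.
    apply: le_trans (rnD _ _) _; rewrite rtv.
    by have := tV8 k; have : 0 < r by []; lra.
  have fw : differentiable f w by apply: fh; have : 0 < r by []; lra.
  have [d _] := holB sh fw.
  by have [] := hol_scale (t k)^-1%:C d.
- move=> k w wz.
  have -> : F k w = dd f w v + (F k w - dd f w v) by ring.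
  apply: le_trans (cabsD _ _) _; apply: lerD; first exact: hol_derive_bound (half _ wz).
  apply: le_trans (FE k w wz) _; rewrite ler_pdivrMr // ler_peMr // ler1n.
  done.
- move=> e e0; exists (Num.bound (c / e)) => k w Kk wz.
  apply: le_trans (FE k w wz) _; rewrite ler_pdivrMr // mulrC -ler_pdivrMr //.
  apply/ltW; apply: lt_le_trans (archi_boundP _) _; first by rewrite divr_ge0 // ltW.
  by rewrite ler_nat; apply: leq_trans Kk _.
Qed.

End derivative_function.

Lemma hol_derive_on n (Om : set 'rV[C]_n) (f : 'rV[C]_n -> C) v : open Om -> holomorphic_on Om f ->
  holomorphic_on Om (fun w => dd f w v).
Proof.
move=> oO fh z Oz; have [r [M [r0 Hr HM]]] := hol_local oO fh Oz.
exact: (hol_derive r0 (fun w h => fh w (Hr w h)) HM).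
Qed.

(** The transpose of the usual Jacobian matrix, since vectors are rows and matrices act on the
    right; the chain rule then reads in the order of application. *)
Definition Jmx n m (f : 'rV[C]_n -> 'rV[C]_m) z : 'M[C]_(n, m) :=
  \matrix_(i, j) 'd f z (delta_mx 0 i) 0 j.

Lemma diff_Jmx n m (f : 'rV[C]_n -> 'rV[C]_m) z v : 'd f z v = v *m Jmx f z.
Proof.
rewrite [v in LHS]matrix_sum_delta big_ord1 linear_sum; apply/rowP => j.
by rewrite summxE mxE; apply: eq_bigr => i _; rewrite linearZ !mxE.
Qed.

Lemma Jmx_comp n m p (f : 'rV[C]_n -> 'rV[C]_m) (g : 'rV[C]_m -> 'rV[C]_p) z :
  differentiable f z -> differentiable g (f z) -> Jmx (g \o f) z = Jmx f z *m Jmx g (f z).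
Proof.
move=> df dg; apply/row_matrixP => i.
rewrite !rowE -diff_Jmx mulmxA -!diff_Jmx.
exact: (congr1 (fun h => h (delta_mx 0 i)) (diff_comp df dg)).
Qed.

(** The entries are derivatives of coordinate functions, holomorphic by [hol_derive_on], and the
    determinant is a polynomial in them. *)
Lemma hol_Jdet n (Om : set 'rV[C]_n) (f : 'rV[C]_n -> 'rV[C]_n) : open Om -> holomorphic_on Om f ->
  holomorphic_on Om (fun w => \det (Jmx f w)).
Proof.
move=> oO fh z Oz; rewrite /determinant.
have fj j : holomorphic_on Om (fun w => f w 0 j) by move=> w Ow; exact: (proj1 (hol_coord j (fh w Ow))).
have [r r0 Hr] := open_rn oO Oz.
apply: (proj1 (@hol_sum n _ (index_enum _) predT
  (fun (s : {perm 'I_n}) w => (-1) ^+ s * \prod_i Jmx f w i (s i)) z _)) => s _.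
apply: (proj1 (@hol_scale n ((-1) ^+ s) (fun w => \prod_i Jmx f w i (s i)) z _)).
apply: (@hol_prod n _ (index_enum _) (fun i w => Jmx f w i (s i))) => i.
apply: (proj1 (hol_near_eq r0 _ (hol_derive_on (delta_mx 0 i) oO (fj (s i)) Oz))).
move=> w /Hr Ow; rewrite mxE.
exact: (proj2 (hol_coord (s i) (fh w Ow))).
Qed.

End weierstrass.

(** * Invariance of the Lebesgue measure *)

Section coordinates.
Context {R : realType}.
Local Notation C := R[i].
Local Notation RR := (measurableTypeR R * measurableTypeR R)%type.
Local Notation TT n := (n.-tuple RR).

Definition ofCn n (z : 'rV[C]_n) : TT n := [tuple (complex.Re (z 0 j), complex.Im (z 0 j)) | j < n].

Lemma toCnE n (x : TT n) j : toCn x 0 j = (tnth x j).1 +i* (tnth x j).2.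
Proof. by rewrite mxE. Qed.

Lemma ofCnK n (z : 'rV[C]_n) : toCn (ofCn z) = z.
Proof. by apply/rowP => j; rewrite toCnE tnth_mktuple /=; case: (z 0 j). Qed.

Lemma toCnK n (x : TT n) : ofCn (toCn x) = x.
Proof. by apply/eq_from_tnth => j; rewrite tnth_mktuple toCnE; case: (tnth x j). Qed.

(** Measurability of a map into C^n, expressed through real coordinates; the source is arbitrary, so
    that pairs of points are covered as well. *)
Definition mcoord d (T : measurableType d) n (e : T -> 'rV[C]_n) :=
  forall j, measurable_fun setT (fun x => complex.Re (e x 0 j)) /\
            measurable_fun setT (fun x => complex.Im (e x 0 j)).

Lemma mcoord_toCn n : mcoord (@toCn R n).
Proof.
move=> j; split.
- have -> : (fun x : TT n => complex.Re (toCn x 0 j)) = fst \o (fun x : TT n => tnth x j).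
    by apply/funext => x; rewrite toCnE.
  by apply: measurableT_comp => //; exact: measurable_tnth.
- have -> : (fun x : TT n => complex.Im (toCn x 0 j)) = snd \o (fun x : TT n => tnth x j).
    by apply/funext => x; rewrite toCnE.
  by apply: measurableT_comp => //; exact: measurable_tnth.
Qed.

Lemma measurable_fun_ofCn d (T : measurableType d) n (e : T -> 'rV[C]_n) :
  mcoord e -> measurable_fun setT (fun x => ofCn (e x)).
Proof.
move=> me; apply/measurable_fun_tnthP => j.
have -> : (fun t : TT n => tnth t j) \o (fun x => ofCn (e x)) = (fun x => (complex.Re (e x 0 j), complex.Im (e x 0 j))).
  by apply/funext => x; rewrite /= tnth_mktuple.
by have [m1 m2] := me j; apply: measurable_fun_pair.
Qed.

(** An open set is the countable union of the rational boxes that it contains. *)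
Lemma measurable_pre_open d (T : measurableType d) n (e : T -> 'rV[C]_n) (U : set 'rV[C]_n) :
  mcoord e -> open U -> measurable (e @^-1` U).
Proof.
move=> me oU.
pose B (i : {ffun 'I_n -> rat * rat} * nat) : set 'rV[C]_n := [set w | forall j,
  `|complex.Re (w 0 j) - ratr (i.1 j).1| < i.2.+1%:R^-1 /\
  `|complex.Im (w 0 j) - ratr (i.1 j).2| < i.2.+1%:R^-1].
have mB i : measurable (e @^-1` B i).
  have -> : e @^-1` B i = \bigcap_(j in [set: 'I_n])
      ((fun x => complex.Re (e x 0 j)) @^-1` (ball (ratr (i.1 j).1 : R) (i.2.+1%:R^-1 : R)) `&`
       (fun x => complex.Im (e x 0 j)) @^-1` (ball (ratr (i.1 j).2 : R) (i.2.+1%:R^-1 : R))).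
    rewrite /ball /=; apply/seteqP; split=> x /= H j.
      by move=> _; have [h1 h2] := H j; split; rewrite /= distrC.
    by have [/= h1 h2] := H j Logic.I; rewrite distrC h1 distrC h2.
  apply: fin_bigcap_measurable => // j _; have [m1 m2] := me j.
  apply: measurableI; rewrite -[X in measurable X]setTI.
    by apply: m1 => //; exact: measurable_ball.
  by apply: m2 => //; exact: measurable_ball.
have -> : e @^-1` U = \bigcup_i (e @^-1` (if `[< B i `<=` U >] then B i else set0)).
  apply/seteqP; split=> [x /= Ux|x [i _] /=]; last first.
    by case: asboolP => // h; exact: h.
  have [r r0 Hr] := open_rn oU Ux.
  (* Two points of a box of half-width 1 / N.+1 differ by less than 2 / N.+1 in each real
     coordinate, hence by less than 4 / N.+1 in modulus. *)
  pose N := Num.bound (4 / r).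
  have N0 : (4 / r) < N.+1%:R.
    apply: lt_trans (archi_boundP _) _; first by rewrite divr_ge0 // ltW.
    by rewrite ltr_nat.
  have Nr : 4 * N.+1%:R^-1 < r.
    by rewrite ltr_pdivrMr // mulrC -ltr_pdivrMr.
  have Np : 0 < N.+1%:R^-1 :> R by rewrite invr_gt0.
  have rat_near (a : R) : exists q : rat, `|a - ratr q| < N.+1%:R^-1.
    move: (N.+1%:R^-1 : R) Np => c Np.
    have /rat_in_itvoo[q] : a - c < a + c by lra.
    rewrite in_itv /= => /andP[q1 q2]; exists q.
    by rewrite ltr_norml; apply/andP; split; lra.
  have /choice[q1 Hq1] : forall j, exists q : rat, `|complex.Re (e x 0 j) - ratr q| < N.+1%:R^-1.
    by move=> j; exact: rat_near.
  have /choice[q2 Hq2] : forall j, exists q : rat, `|complex.Im (e x 0 j) - ratr q| < N.+1%:R^-1.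
    by move=> j; exact: rat_near.
  pose c := [ffun j => (q1 j, q2 j)]; exists (c, N) => //=.
  have xB : B (c, N) (e x) by move=> j /=; rewrite ffunE.
  case: asboolP => // nB; exfalso; apply: nB => w wB; apply: Hr.
  apply/rn_ltP => // j; rewrite !mxE.
  apply: le_lt_trans (cabs_le _) _; rewrite !ReD !ImD !ReN !ImN.
  have /= [h1 h2] := wB j; have /= [h3 h4] := xB j.
  apply: lt_trans Nr; move: h1 h2 h3 h4; move: (N.+1%:R^-1 : R) Np => c' Np; rewrite !ltr_norml => /andP[? ?] /andP[? ?] /andP[? ?] /andP[? ?].
  have : `|complex.Re (w 0 j) - complex.Re (e x 0 j)| < 2 * c'.
    by rewrite ltr_norml; apply/andP; split; lra.
  have : `|complex.Im (w 0 j) - complex.Im (e x 0 j)| < 2 * c'.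
    by rewrite ltr_norml; apply/andP; split; lra.
  by lra.
apply: countable_bigcupT_measurable; first exact: countableP.
by move=> i; case: ifP => // _; rewrite preimage_set0.
Qed.

Definition rcont_on n (U : set 'rV[C]_n) (u : 'rV[C]_n -> R) := forall z, U z ->
  forall e : R, 0 < e -> exists2 r : R, 0 < r & forall w, U w -> rn (w - z) < r -> `|u w - u z| <= e.

Lemma measurable_fun_rcont n (U : set 'rV[C]_n) (u : 'rV[C]_n -> R) : open U -> rcont_on U u ->
  measurable_fun (@toCn R n @^-1` U) (u \o @toCn R n).
Proof.
move=> oU cu mD; apply: (measurability _ (RGenOInfty.measurableE R)) => //.
move=> /= _ [_ [a ->] <-].
have -> : @toCn R n @^-1` U `&` (u \o @toCn R n) @^-1` `]a, +oo[%classic =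
    @toCn R n @^-1` (U `&` [set z | a < u z]).
  by apply/seteqP; split=> x /=; rewrite in_itv /= andbT.
apply: measurable_pre_open; first exact: mcoord_toCn.
apply: rn_open => z [Uz /= az].
have [r1 r10 H1] := open_rn oU Uz.
have [|r2 r20 H2] := cu z Uz ((u z - a) / 2); first by rewrite divr_gt0 // subr_gt0.
exists (Num.min r1 r2); first by rewrite lt_min r10.
move=> w; rewrite lt_min => /andP[/H1 Uw /(H2 w Uw)]; rewrite ler_norml => /andP[h _].
by split=> //=; lra.
Qed.

End coordinates.

Section pushforward_measure.
Context d1 d2 (X : measurableType d1) (Y : measurableType d2) (R : realType).

Definition pushm (mu : {measure set X -> \bar R}) (f : X -> Y) (mf : measurable_fun setT f) :
  {measure set Y -> \bar R} := measure_function_pushforward__canonical__measure_function_Measure mu mf.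

End pushforward_measure.

Section translation.
Context {R : realType}.
Local Notation C := R[i].
Local Notation mR := (measurableTypeR R).
Local Notation RR := (mR * mR)%type.
Local Notation TT n := (n.-tuple RR).
Local Notation leb := (@lebesgue_measure R).

Lemma lebesgue_oc (x y : R) : leb `]x, y]%classic = if x < y then (y - x)%:E else 0%E.
Proof. by have := lebesgue_measure_itv `]x, y]; rewrite /= lte_fin -EFinD. Qed.

(** The pushforward has the right value on half-open intervals, and these determine Lebesgue
    measure. *)
Lemma lebesgue_translation (a : R) (A : set mR) : measurable A ->
  leb ((fun x : mR => x + a : mR) @^-1` A) = leb A.
Proof.
move=> mA.
have mf : measurable_fun setT (fun x : mR => x + a : mR) by apply: measurable_funD.
have U := @lebesgue_stieltjes_measure_unique R idfun (pushm leb mf).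
apply/esym; apply: U mA => X [[x y] _ <-] /=.
transitivity (leb ((fun x : mR => x + a : mR) @^-1` `]x, y]%classic)); last by [].
have -> : (fun x0 : mR => x0 + a : mR) @^-1` `]x, y]%classic = `]x - a, y - a]%classic.
  by apply/seteqP; split=> t /=; rewrite !in_itv /= ltrBlDr lerBrDr.
rewrite [RHS]lebesgue_oc [LHS]lebesgue_oc ltrD2r.
by case: ifP => // _; congr EFin; ring.
Qed.

Lemma lebesgue_scaling (a : R) (A : set mR) : 0 < a -> measurable A ->
  (a%:E * leb ((fun x : mR => (a * x)%R : mR) @^-1` A))%E = leb A.
Proof.
move=> a0 mA.
have mf : measurable_fun setT (fun x : mR => a * x : mR) by apply: measurable_funM.
pose a' := NngNum (ltW a0).
have U := @lebesgue_stieltjes_measure_unique R idfun (mscale a' (pushm leb mf)).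
apply/esym; apply: U mA => X [[x y] _ <-] /=.
transitivity (a%:E * leb ((fun x : mR => (a * x)%R : mR) @^-1` `]x, y]%classic))%E; last by [].
have -> : (fun x0 : mR => a * x0 : mR) @^-1` `]x, y]%classic = `]x / a, y / a]%classic.
  by apply/seteqP; split=> t /=; rewrite !in_itv /= ltr_pdivrMr // ler_pdivlMr // mulrC.
rewrite [LHS]lebesgue_oc lebesgue_oc ltr_pM2r ?invr_gt0 //.
case: ifP => // _; last by rewrite mule0.
by rewrite -EFinM /=; congr EFin; field; rewrite gt_eqF.
Qed.

Section product.
Context d1 d2 (T1 : measurableType d1) (T2 : measurableType d2).
Variable m1 : {sigma_finite_measure set T1 -> \bar R}.
Variable m2 : {sigma_finite_measure set T2 -> \bar R}.

Lemma sf_productX (A : set T1) (B : set T2) : measurable A -> measurable B ->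
  sf_product m1 m2 (A `*` B) = (m1 A * m2 B)%E.
Proof. by move=> mA mB; rewrite /sf_product product_measure1E. Qed.

Lemma sf_product_unique (m : {measure set (T1 * T2) -> \bar R}) :
  (forall A B, measurable A -> measurable B -> m (A `*` B) = (m1 A * m2 B)%E) ->
  forall W, measurable W -> sf_product m1 m2 W = m W.
Proof. by move=> H W mW; apply: product_measure_unique. Qed.

(** Uniqueness of the product measure from its values on rectangles. The factors a and b treat
    translations, where they are 1, and scalings together. *)
Lemma sf_product_map (f1 : T1 -> T1) (f2 : T2 -> T2) (a b : R) :
  measurable_fun setT f1 -> measurable_fun setT f2 -> 0 <= a -> 0 <= b ->
  (forall A, measurable A -> (a%:E * m1 (f1 @^-1` A))%E = m1 A) ->
  (forall A, measurable A -> (b%:E * m2 (f2 @^-1` A))%E = m2 A) ->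
  forall W, measurable W ->
  ((a * b)%:E * sf_product m1 m2 ((fun p => (f1 p.1, f2 p.2)) @^-1` W))%E = sf_product m1 m2 W.
Proof.
move=> mf1 mf2 a0 b0 H1 H2 W mW.
have mf : measurable_fun setT (fun p : T1 * T2 => (f1 p.1, f2 p.2)).
  by apply: measurable_fun_pair; [apply: measurableT_comp mf1 _|apply: measurableT_comp mf2 _].
have ab0 : 0 <= a * b by rewrite mulr_ge0.
apply/esym.
apply: (@sf_product_unique (mscale (NngNum ab0) (pushm (sf_product m1 m2) mf))) => // A B mA mB.
transitivity ((a * b)%:E * sf_product m1 m2 ((f1 @^-1` A) `*` (f2 @^-1` B)))%E; first by [].
have mA' : measurable (f1 @^-1` A) by rewrite -[X in measurable X]setTI; exact: mf1.
have mB' : measurable (f2 @^-1` B) by rewrite -[X in measurable X]setTI; exact: mf2.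
rewrite [X in (_ * X)%E]sf_productX // -(H1 A) // -(H2 B) // EFinM.
by rewrite muleACA.
Qed.

End product.

Definition tadd n (v x : TT n) : TT n :=
  [tuple ((tnth x j).1 + (tnth v j).1, (tnth x j).2 + (tnth v j).2) | j < n].

Lemma toCn_tadd n (v x : TT n) : toCn (tadd v x) = toCn x + toCn v.
Proof. by apply/rowP => j; rewrite !mxE tnth_mktuple. Qed.

Lemma mC_translation (v : RR) (A : set RR) : measurable A ->
  @lebesgue_measure_C R ((fun p : RR => (p.1 + v.1, p.2 + v.2) : RR) @^-1` A) = @lebesgue_measure_C R A.
Proof.
move=> mA; have madd (a : R) : measurable_fun setT (fun x : mR => x + a : mR) by apply: measurable_funD.
have := @sf_product_map _ _ _ _ leb leb _ _ 1 1 (madd v.1) (madd v.2) ler01 ler01 _ _ _ mA.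
rewrite mulr1 mul1e; apply=> B mB; rewrite mul1e; exact: lebesgue_translation.
Qed.

Lemma mC_scaling (r : R) (A : set RR) : 0 < r -> measurable A ->
  ((r ^+ 2)%:E * @lebesgue_measure_C R ((fun p : RR => ((r * p.1)%R, (r * p.2)%R) : RR) @^-1` A))%E = @lebesgue_measure_C R A.
Proof.
move=> r0 mA; have mmul : measurable_fun setT (fun x : mR => r * x : mR) by apply: measurable_funM.
by have := @sf_product_map _ _ _ _ leb leb _ _ r r mmul mmul (ltW r0) (ltW r0)
  (fun B mB => lebesgue_scaling r0 mB) (fun B mB => lebesgue_scaling r0 mB) _ mA.
Qed.

Local Notation mu n := (lebesgue_measure_Cn R n).

Lemma mu_cons n (A : set (TT n.+1)) :
  mu n.+1 A = sf_product (@lebesgue_measure_C R) (mu n) (@cons_pair _ RR n @^-1` A).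
Proof. by []. Qed.

Lemma measurable_preT d1 d2 (X : measurableType d1) (Y : measurableType d2) (f : X -> Y) A :
  measurable_fun setT f -> measurable A -> measurable (f @^-1` A).
Proof. by move=> mf mA; rewrite -[X in measurable X]setTI; exact: mf. Qed.

Lemma measurable_tadd n (v : TT n) : measurable_fun setT (tadd v).
Proof.
apply/measurable_fun_tnthP => j.
have -> : (fun t : TT n => tnth t j) \o tadd v =
   (fun p : RR => (p.1 + (tnth v j).1, p.2 + (tnth v j).2) : RR) \o (fun t : TT n => tnth t j).
  by apply/funext => x; rewrite /= tnth_mktuple.
apply: measurableT_comp; last exact: measurable_tnth.
apply: measurable_fun_pair.
  by apply: measurable_funD => //; exact: measurable_fst.
by apply: measurable_funD => //; exact: measurable_snd.
Qed.

Lemma mu_translation n (v : TT n) (A : set (TT n)) : measurable A -> mu n (tadd v @^-1` A) = mu n A.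
Proof.
elim: n v A => [|n IH] v A mA.
  have e x : tadd v x = x by apply: eq_from_tnth => -[].
  by have -> : tadd v @^-1` A = A by apply/seteqP; split=> x; rewrite /preimage /= e.
rewrite !mu_cons.
pose f1 := fun p : RR => (p.1 + (thead v).1, p.2 + (thead v).2) : RR.
pose f2 := @tadd n [tuple of behead v].
have -> : @cons_pair _ RR n @^-1` (tadd v @^-1` A) =
   (fun p : RR * TT n => (f1 p.1, f2 p.2)) @^-1` (@cons_pair _ RR n @^-1` A).
  have tb k : tnth v (lift ord0 k) = tnth [tuple of behead v] k by rewrite [in LHS](tuple_eta v) tnthS.
  have E (p : RR) (t : TT n) : tadd v (cons_pair (p, t)) = cons_pair (f1 p, f2 t).
    apply/eq_from_tnth => j; rewrite tnth_mktuple.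
    case: (unliftP ord0 j) => [k ->|->]; first by rewrite !tnthS tnth_mktuple tb.
    by rewrite !tnth0.
  by apply/seteqP; split=> -[p t]; rewrite /preimage /= E.
have m1 : measurable_fun setT f1.
  apply: measurable_fun_pair.
    by apply: measurable_funD => //; exact: measurable_fst.
  by apply: measurable_funD => //; exact: measurable_snd.
have := @sf_product_map _ _ _ _ (@lebesgue_measure_C R) (mu n) f1 f2 1 1 m1 (@measurable_tadd n _) ler01 ler01 _ _
  _ (measurable_preT (@measurable_cons_pair _ _ _) mA).
rewrite mulr1 mul1e; apply=> B mB; rewrite mul1e; [exact: mC_translation|exact: IH].
Qed.

Lemma mu_box n (B : 'I_n -> set RR) : (forall j, measurable (B j)) ->
  mu n [set x | forall j, B j (tnth x j)] = (\prod_j @lebesgue_measure_C R (B j))%E.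
Proof.
elim: n B => [|n IH] B mB.
  rewrite big_ord0 /= diracE mem_set //.
  by move=> [].
rewrite mu_cons big_ord_recl -IH //.
have -> : @cons_pair _ RR n @^-1` [set x | forall j, B j (tnth x j)] =
   B ord0 `*` [set x | forall j, B (lift ord0 j) (tnth x j)].
  apply/seteqP; split=> -[p t] /= H.
    split; first by have := H ord0; rewrite tnth0.
    by move=> j; have := H (lift ord0 j); rewrite tnthS.
  move=> j; case: (unliftP ord0 j) => [k ->|->]; first by rewrite tnthS; apply: H.2.
  by rewrite tnth0; exact: H.1.
rewrite sf_productX //.
have -> : [set x : TT n | forall j, B (lift ord0 j) (tnth x j)] =
  \bigcap_(j in [set: 'I_n]) ((fun x : TT n => tnth x j) @^-1` (B (lift ord0 j))).
  by apply/seteqP; split=> x /= H j => [_|]; apply: H.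
apply: fin_bigcap_measurable => // j _.
by apply: measurable_preT => //; exact: measurable_tnth.
Qed.

End translation.

(** * Uniqueness of translation invariant measures *)

Section haar.
Context {R : realType}.
Local Notation C := R[i].
Local Notation mR := (measurableTypeR R).
Local Notation RR := (mR * mR)%type.
Local Notation TT n := (n.-tuple RR).
Local Notation mu n := (lebesgue_measure_Cn R n).

Section tonelli.
Context d1 d2 (T1 : measurableType d1) (T2 : measurableType d2).
Variable m1 : {sigma_finite_measure set T1 -> \bar R}.
Variable m2 : {sigma_finite_measure set T2 -> \bar R}.

Lemma tonelli_sets (W : set (T1 * T2)) : measurable W ->
  (\int[m1]_x m2 [set y | W (x, y)] = \int[m2]_y m1 [set x | W (x, y)])%E.
Proof.
move=> mW; have mf : measurable_fun setT (EFin \o (\1_W : T1 * T2 -> R)).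
  by apply/measurable_EFinP; exact: measurable_indic.
have := @fubini_tonelli _ _ _ _ _ m1 m2 _ mf (fun x => _).
have <- : (fun x => \int[m2]_y (\1_W (x, y))%:E)%E = (fun x => m2 [set y | W (x, y)]).
  apply/funext => x; rewrite (_ : (fun y => _) = EFin \o \1_[set y | W (x, y)]).
    rewrite integral_indic ?setIT //.
    have -> : [set y | W (x, y)] = xsection W x.
      by apply/seteqP; split=> y /=; rewrite /xsection /= inE.
    exact: measurable_xsection.
  by apply/funext => y; rewrite /= !indicE; congr (_%:R%:E); apply/idP/idP; rewrite !in_setE.
have <- : (fun y => \int[m1]_x (\1_W (x, y))%:E)%E = (fun y => m1 [set x | W (x, y)]).
  apply/funext => y; rewrite (_ : (fun x => _) = EFin \o \1_[set x | W (x, y)]).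
    rewrite integral_indic ?setIT //.
    have -> : [set x | W (x, y)] = ysection W y.
      by apply/seteqP; split=> x /=; rewrite /ysection /= inE.
    exact: measurable_ysection.
  by apply/funext => x; rewrite /= !indicE; congr (_%:R%:E); apply/idP/idP; rewrite !in_setE.
by apply=> x; rewrite /= lee_fin indicE.
Qed.

Lemma integral_section_cst (A : set T1) (Q : T1 -> set T2) c : measurable A ->
  (forall x, m2 (Q x) = c) -> (0 <= c)%E ->
  (\int[m1]_x m2 [set y | A x /\ Q x y] = c * m1 A)%E.
Proof.
move=> mA Qc c0.
transitivity (\int[m1]_x (c * (\1_A x)%:E))%E.
  apply: eq_integral => x _; rewrite indicE.
  have [xA|xA] := boolP (x \in A).
    rewrite mule1 -(Qc x); congr (m2 _); apply/seteqP; split=> y /=; first by case.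
    by split=> //; exact: set_mem.
  rewrite mule0 (_ : [set y | _] = set0) ?measure0 //.
  by apply/seteqP; split=> y //= [Ax _]; move: xA; rewrite notin_setE.
rewrite ge0_integralZl //.
- by rewrite integral_indic // setIT.
- by apply/measurable_EFinP; exact: measurable_indic.
Qed.

End tonelli.

Definition tneg n (x : TT n) : TT n := [tuple (- (tnth x j).1, - (tnth x j).2) | j < n].

Lemma toCn_inj n : injective (@toCn R n).
Proof. by move=> x y /(congr1 (@ofCn R n)); rewrite !toCnK. Qed.

Lemma toCn_tneg n (x : TT n) : toCn (tneg x) = - toCn x.
Proof. by apply/rowP => j; rewrite !mxE tnth_mktuple. Qed.

Lemma measurable_tneg n : measurable_fun setT (@tneg n).
Proof.
apply/measurable_fun_tnthP => j.
have -> : (fun t : TT n => tnth t j) \o @tneg n =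
   (fun p : RR => (- p.1, - p.2) : RR) \o (fun t : TT n => tnth t j).
  by apply/funext => x; rewrite /= tnth_mktuple.
apply: measurableT_comp; last exact: measurable_tnth.
by apply: measurable_fun_pair; apply: measurableT_comp => //.
Qed.

Lemma measurable_tadd2 n : measurable_fun setT (fun p : TT n * TT n => tadd p.2 p.1).
Proof.
apply/measurable_fun_tnthP => j.
have -> : (fun t : TT n => tnth t j) \o (fun p : TT n * TT n => tadd p.2 p.1) =
   (fun p : TT n * TT n => ((tnth p.1 j).1 + (tnth p.2 j).1, (tnth p.1 j).2 + (tnth p.2 j).2) : RR).
  by apply/funext => x; rewrite /= tnth_mktuple.
have mt1 : measurable_fun setT (fun p : TT n * TT n => tnth p.1 j).
  by apply: (measurableT_comp (@measurable_tnth _ _ _ j)).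
have mt2 : measurable_fun setT (fun p : TT n * TT n => tnth p.2 j).
  by apply: (measurableT_comp (@measurable_tnth _ _ _ j)).
apply: measurable_fun_pair.
  by apply: measurable_funD; [exact: (measurableT_comp measurable_fst mt1)|exact: (measurableT_comp measurable_fst mt2)].
by apply: measurable_funD; [exact: (measurableT_comp measurable_snd mt1)|exact: (measurableT_comp measurable_snd mt2)].
Qed.

(* Tonelli on the pairs with [x] in [A] and [x + y] in [B]: the measures invariant under
   translations are proportional to [mu]. *)
Lemma haar_exchange n (nu : {sigma_finite_measure set (TT n) -> \bar R}) (A B : set (TT n)) :
  (forall v D, measurable D -> nu (tadd v @^-1` D) = nu D) -> measurable A -> measurable B ->
  (mu n B * nu A = mu n (@tneg n @^-1` A) * nu B)%E.
Proof.
move=> inv mA mB.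
have mtn : measurable (@tneg n @^-1` A) := measurable_preT (@measurable_tneg n) mA.
rewrite -(@integral_section_cst _ _ _ _ nu (mu n) A (fun x => tadd x @^-1` B)) //; last first.
  by move=> x; exact: mu_translation.
rewrite -(@integral_section_cst _ _ _ _ nu (mu n) B (fun x => [set y | A (tadd (tneg y) x)])) //; last first.
  move=> x; rewrite -(@mu_translation R n (tneg x) _ mtn); congr (mu n _).
  apply/seteqP; split=> y; rewrite /preimage /=;
  suff -> : tadd (tneg y) x = tneg (tadd (tneg x) y) by [];
  by apply: toCn_inj; rewrite !(toCn_tadd, toCn_tneg) opprD opprK addrC.
have c2 : measurable ([set p : TT n * TT n | A p.1 /\ (tadd p.1 @^-1` B) p.2]).
  apply: measurableI; first exact: (measurable_preT measurable_fst).
  have := measurable_preT (@measurable_tadd2 n) mB; congr measurable.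
  apply/seteqP; split=> p; rewrite /preimage /=;
  suff -> : tadd p.1 p.2 = tadd p.2 p.1 by [];
  by apply: toCn_inj; rewrite !toCn_tadd addrC.
have c3 : measurable ([set p : TT n * TT n | B p.1 /\ A (tadd (tneg p.2) p.1)]).
  apply: measurableI; first exact: (measurable_preT measurable_fst).
  have mm : measurable_fun setT (fun p : TT n * TT n => tadd (tneg p.2) p.1).
    have := measurableT_comp (@measurable_tadd2 n) (measurable_fun_pair measurable_fst
      (measurableT_comp (@measurable_tneg n) measurable_snd)).
    by [].
  exact: measurable_preT mm mA.
rewrite (tonelli_sets nu (mu n) c2) (tonelli_sets nu (mu n) c3).
apply: eq_integral => y _.
have mD : measurable [set x | A x /\ (tadd x @^-1` B) y].
  have := measurable_ysection y c2; congr measurable.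
  by apply/seteqP; split=> x /=; rewrite /ysection /= inE.
(* The substitution of x - y for x, permitted by the invariance of [nu], turns the conditions x in
   A, x + y in B into x - y in A, x in B. *)
rewrite -(inv (tneg y) _ mD); congr (nu _).
apply/seteqP; split=> x; rewrite /preimage /=;
  suff -> : tadd (tadd (tneg y) x) y = x by [move=> []];
  by apply: toCn_inj; rewrite !(toCn_tadd, toCn_tneg) addrC subrK.
Qed.

Definition disc (r : R) : set RR := [set p | cabs (p.1 +i* p.2) < r].

Lemma measurable_disc r : measurable (disc r).
Proof.
have [r0|r0] := lerP r 0.
  rewrite (_ : disc r = set0) //; apply/seteqP; split=> p //= h.
  by have := lt_le_trans h r0; rewrite ltNge cabs_ge0.
have mf : measurable_fun setT (fun p : RR => p.1 ^+ 2 + p.2 ^+ 2 : mR).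
  by apply: measurable_funD; apply: measurable_funX.
have -> : disc r = (fun p : RR => p.1 ^+ 2 + p.2 ^+ 2 : mR) @^-1` `]-oo, (r ^+ 2)[%classic.
  apply/seteqP; split=> p; rewrite /preimage /disc /= in_itv /=;
  by rewrite -[_ + _](sqr_cabs (p.1 +i* p.2)) ltr_sqr ?nnegrE ?cabs_ge0 // ltW.
by apply: measurable_preT mf _.
Qed.

Lemma mC_X (A B : set mR) : measurable A -> measurable B ->
  @lebesgue_measure_C R (A `*` B) = (lebesgue_measure A * lebesgue_measure B)%E.
Proof. exact: sf_productX. Qed.

Lemma mC_disc_fin : (@lebesgue_measure_C R (disc 1) < +oo)%E.
Proof.
have mI (a b : R) : measurable (`]a, b]%classic : set mR) by [].
apply: (@le_lt_trans _ _ (@lebesgue_measure_C R (`]-2, 2]%classic `*` `]-2, 2]%classic))).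
  apply: le_measure; rewrite ?inE //; first exact: measurable_disc.
    exact: measurableX.
  move=> p /= h; have := Re_le_cabs (p.1 +i* p.2); have := Im_le_cabs (p.1 +i* p.2) => /= h1 h2.
  have {}h1 := le_lt_trans h1 h; have {}h2 := le_lt_trans h2 h.
  by move: h1 h2; rewrite !ltr_norml !in_itv /= => /andP[? ?] /andP[? ?]; split; apply/andP; split; lra.
rewrite mC_X // !lebesgue_oc; case: ifP => _; last by rewrite mul0e ltry.
by rewrite -EFinM ltry.
Qed.

Lemma mC_disc_pos : (0 < @lebesgue_measure_C R (disc 1))%E.
Proof.
have mI (a b : R) : measurable (`]a, b]%classic : set mR) by [].
have h0 : 0 < 4^-1 :> R by rewrite invr_gt0.
apply: (@lt_le_trans _ _ (@lebesgue_measure_C R (`]0, 4^-1]%classic `*` `]0, 4^-1]%classic))).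
  by rewrite mC_X // !lebesgue_oc h0 -EFinM lte_fin subr0 mulr_gt0.
apply: le_measure; rewrite ?inE //; [exact: measurableX|exact: measurable_disc|].
move=> p /=; rewrite !in_itv /= => -[/andP[a1 a2] /andP[b1 b2]].
apply: le_lt_trans (cabs_le _) _; rewrite /= !gtr0_norm //.
lra.
Qed.

(** The area of the unit disc, kept as a positive symbol. *)
Definition kappa : R := fine (@lebesgue_measure_C R (disc 1)).

Lemma mC_disc1 : @lebesgue_measure_C R (disc 1) = kappa%:E.
Proof. by rewrite fineK // ge0_fin_numE // mC_disc_fin. Qed.

Lemma kappa_gt0 : 0 < kappa.
Proof. by rewrite -lte_fin -mC_disc1 mC_disc_pos. Qed.

Lemma mC_disc r : 0 < r -> @lebesgue_measure_C R (disc r) = (r ^+ 2 * kappa)%:E.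
Proof.
move=> r0; rewrite -(mC_scaling r0 (measurable_disc r)) [RHS]EFinM -mC_disc1; congr (_ * _)%E.
congr (_ _); apply/seteqP; split=> p; rewrite /preimage /disc /=;
have -> : (r * p.1) +i* (r * p.2) = r%:C * (p.1 +i* p.2) by rewrite /= ; apply: complex_eq; rewrite /=; ring.
  by rewrite cabsM cabs_real gtr0_norm // gtr_pMr.
by rewrite cabsM cabs_real gtr0_norm // gtr_pMr.
Qed.

Definition pdisc n (r : 'I_n -> R) : set (TT n) := [set x | forall j, cabs (toCn x 0 j) < r j].

Lemma measurable_pdisc n (r : 'I_n -> R) : measurable (pdisc r).
Proof.
have -> : pdisc r = \bigcap_(j in [set: 'I_n]) ((fun x : TT n => tnth x j) @^-1` disc (r j)).
  by apply/seteqP; split=> x /= H j => [_|]; have := H j; rewrite /disc /preimage /= toCnE //; apply.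
apply: fin_bigcap_measurable => // j _.
by apply: measurable_preT; [exact: measurable_tnth|exact: measurable_disc].
Qed.

Lemma mu_pdisc n (r : 'I_n -> R) : (forall j, 0 < r j) ->
  mu n (pdisc r) = ((\prod_j r j) ^+ 2 * kappa ^+ n)%:E.
Proof.
move=> r0.
have -> : pdisc r = [set x | forall j, disc (r j) (tnth x j)].
  by apply/seteqP; split=> x /= H j; have := H j; rewrite /disc /= toCnE.
rewrite (@mu_box R n (fun j => disc (r j))); last by move=> j; exact: measurable_disc.
rewrite (eq_bigr (fun j => ((r j) ^+ 2 * kappa)%:E)); last by move=> j _; exact: mC_disc.
by rewrite prodEFin big_split /= prodrXl prodr_const card_ord.
Qed.

End haar.

(** * Linear changes of variables *)

Section linear_maps.
Context {R : realType}.
Local Notation C := R[i].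
Local Notation mR := (measurableTypeR R).
Local Notation RR := (mR * mR)%type.
Local Notation TT n := (n.-tuple RR).
Local Notation mu n := (lebesgue_measure_Cn R n).

Definition tlin n (L : 'M[C]_n) (x : TT n) : TT n := ofCn (toCn x *m L).

Lemma toCn_tlin n (L : 'M[C]_n) x : toCn (tlin L x) = toCn x *m L.
Proof. by rewrite ofCnK. Qed.

Lemma measurable_tlin n (L : 'M[C]_n) : measurable_fun setT (tlin L).
Proof.
apply: measurable_fun_ofCn => j; split.
- have -> : (fun x : TT n => complex.Re ((toCn x *m L) 0 j)) =
    (fun x => \sum_k ((tnth x k).1 * complex.Re (L k j) - (tnth x k).2 * complex.Im (L k j))).
    apply/funext => x; rewrite !mxE (big_morph _ (@ReD R) (erefl : complex.Re (0 : C) = 0)).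
    by apply: eq_bigr => k _; rewrite toCnE ReM.
  apply: measurable_sum => k; apply: measurable_funB; apply: measurable_funM => //.
    by apply: (measurableT_comp measurable_fst); exact: measurable_tnth.
  by apply: (measurableT_comp measurable_snd); exact: measurable_tnth.
- have -> : (fun x : TT n => complex.Im ((toCn x *m L) 0 j)) =
    (fun x => \sum_k ((tnth x k).1 * complex.Im (L k j) + (tnth x k).2 * complex.Re (L k j))).
    apply/funext => x; rewrite !mxE (big_morph _ (@ImD R) (erefl : complex.Im (0 : C) = 0)).
    by apply: eq_bigr => k _; rewrite toCnE ImM.
  apply: measurable_sum => k; apply: measurable_funD; apply: measurable_funM => //.
    by apply: (measurableT_comp measurable_fst); exact: measurable_tnth.
  by apply: (measurableT_comp measurable_snd); exact: measurable_tnth.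
Qed.

Lemma tlinM n (L M : 'M[C]_n) x : tlin M (tlin L x) = tlin (L *m M) x.
Proof. by apply: toCn_inj; rewrite !toCn_tlin mulmxA. Qed.

Lemma tlin1 n (x : TT n) : tlin 1%:M x = x.
Proof. by apply: toCn_inj; rewrite toCn_tlin mulmx1. Qed.

Lemma measurable_tlin_pre n (L : 'M[C]_n) (A : set (TT n)) : measurable A -> measurable (tlin L @^-1` A).
Proof. exact: measurable_preT (@measurable_tlin n L). Qed.

Section pushforward_linear.
Variables (n : nat) (L : 'M[C]_n).

(** Invertibility is an argument so that the sigma-finite structure, built from the inverse matrix,
    can be attached to the term. *)
Definition nuL (uL : L \in unitmx) : set (TT n) -> \bar R := pushforward (mu n) (tlin L).

HB.instance Definition _ (uL : L \in unitmx) := Measure.copy (nuL uL) (pushm (mu n) (@measurable_tlin n L)).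

Lemma nuL_sigma_finite (uL : L \in unitmx) : sigma_finite setT (nuL uL).
Proof.
have [F FT Foo] := @sigma_finiteT _ _ _ (mu n).
exists (fun i => tlin (invmx L) @^-1` F i) => [|i].
  by rewrite -preimage_bigcup -FT preimage_setT.
have [mF mFoo] := Foo i; split; first exact: measurable_tlin_pre.
rewrite /nuL /pushforward -comp_preimage.
by rewrite (_ : _ \o _ = id) ?preimage_id //; apply/funext => p /=; rewrite tlinM mulmxV // tlin1.
Qed.

HB.instance Definition _ (uL : L \in unitmx) := @Measure_isSigmaFinite.Build _ _ _
  (nuL uL) (nuL_sigma_finite uL).

Lemma nuL_invariant (uL : L \in unitmx) v (D : set (TT n)) : measurable D ->
  nuL uL (tadd v @^-1` D) = nuL uL D.
Proof.
move=> mD; rewrite /nuL /pushforward.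
have mD' : measurable (tlin L @^-1` D) by exact: measurable_tlin_pre.
rewrite -[RHS](mu_translation (tlin (invmx L) v) mD'); congr (mu n _).
apply/seteqP; split=> x; rewrite /preimage /=;
  suff -> : tadd v (tlin L x) = tlin L (tadd (tlin (invmx L) v) x) by [];
  by apply: toCn_inj; rewrite !(toCn_tadd, toCn_tlin) mulmxDl -mulmxA mulVmx // mulmx1.
Qed.

End pushforward_linear.

Definition pdball n (r : R) : set (TT n) := [set x | rn (toCn x) < r].
Local Notation pball n r := (@pdball n r).

Lemma pballE n (r : R) : 0 < r -> pball n r = pdisc (fun=> r).
Proof. by move=> r0; apply/seteqP; split=> x /= /(rn_ltP _ r0). Qed.

Lemma measurable_pball n r : measurable (pball n r).
Proof.
have [r0|r0] := lerP r 0; last by rewrite pballE //; exact: measurable_pdisc.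
rewrite (_ : pball n r = set0) //; apply/seteqP; split=> p //= h.
by have := lt_le_trans h r0; rewrite ltNge rn_ge0.
Qed.

Definition vball n (r : R) : R := ((r ^+ n) ^+ 2 * kappa ^+ n).

Lemma mu_pball n r : 0 < r -> mu n (pball n r) = (vball n r)%:E.
Proof. by move=> r0; rewrite pballE // mu_pdisc // prodr_const card_ord. Qed.

Lemma vball_gt0 n r : 0 < r -> 0 < vball n r.
Proof. by move=> r0; rewrite mulr_gt0 ?exprn_gt0 ?kappa_gt0. Qed.

(** [haar_exchange] for [mu] itself, tested on the unit polydisc, whose measure is finite and
    positive. *)
Lemma mu_tneg n (A : set (TT n)) : measurable A -> mu n (@tneg R n @^-1` A) = mu n A.
Proof.
move=> mA.
have := @haar_exchange R n (mu n) A (pball n 1) (@mu_translation R n) mA (@measurable_pball n 1).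
rewrite mu_pball // [RHS]muleC => H.
have v0 := vball_gt0 n ltr01.
have vn : ((vball n 1)^-1%:E * (vball n 1)%:E = 1)%E.
  by rewrite -EFinM mulVf // gt_eqF.
by rewrite -[LHS]mul1e -[RHS]mul1e -vn -!muleA H.
Qed.

(** The constant by which [tlin L] multiplies the measure of preimages, read off on the unit
    polydisc; classically |det L|^-2 for invertible L. *)
Definition modulus n (L : 'M[C]_n) : R := fine (mu n (tlin L @^-1` pball n 1)) / vball n 1.

Lemma rn_mulmx n m (M : 'M[C]_(n, m)) (v : 'rV[C]_n) :
  rn (v *m M) <= (\sum_i \sum_j cabs (M i j)) * rn v.
Proof.
apply: rn_le => [|j].
  by rewrite mulr_ge0 ?rn_ge0 //; do 2!(apply: sumr_ge0 => ? _); exact: cabs_ge0.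
rewrite mxE; apply: le_trans (cabs_sum _ _ _) _; rewrite mulr_suml; apply: ler_sum => i _.
rewrite cabsM mulrC; apply: ler_pM; rewrite ?cabs_ge0 ?cabs_le_rn //.
rewrite (bigD1 j) //= lerDl; apply: sumr_ge0 => k _; exact: cabs_ge0.
Qed.

Lemma nuL_pball_fin n (L : 'M[C]_n) : L \in unitmx -> mu n (tlin L @^-1` pball n 1) \is a fin_num.
Proof.
move=> uL; pose K := \sum_i \sum_j cabs (invmx L i j) + 1.
have K0 : 0 < K by rewrite ltr_wpDl //; do 2!(apply: sumr_ge0 => ? _); exact: cabs_ge0.
rewrite ge0_fin_numE //; apply: (@le_lt_trans _ _ (mu n (pball n K))); last first.
  by rewrite mu_pball // ltry.
apply: le_measure; rewrite ?inE; [apply: measurable_tlin_pre; exact: measurable_pball|exact: measurable_pball|].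
move=> x; rewrite /preimage /pdball /= toCn_tlin => h.
have -> : toCn x = (toCn x *m L) *m invmx L by rewrite -mulmxA mulmxV // mulmx1.
apply: le_lt_trans (rn_mulmx _ _) _.
apply: (@le_lt_trans _ _ ((\sum_i \sum_j cabs (invmx L i j)) * 1)).
  rewrite ler_wpM2l ?(ltW h) //; do 2!(apply: sumr_ge0 => ? _); exact: cabs_ge0.
by rewrite mulr1 ltrDl.
Qed.

(** The pushforward [nuL] is translation invariant, hence proportional to [mu] by [haar_exchange];
    the unit polydisc gives the constant. *)
Lemma mu_tlin n (L : 'M[C]_n) (A : set (TT n)) : L \in unitmx -> measurable A ->
  mu n (tlin L @^-1` A) = ((modulus L)%:E * mu n A)%E.
Proof.
move=> uL mA.
have := @haar_exchange R n (nuL uL) A (pball n 1) (nuL_invariant uL) mA (@measurable_pball n 1).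
rewrite mu_tneg // mu_pball // => H.
have v0 := vball_gt0 n ltr01.
have vn : ((vball n 1)^-1%:E * (vball n 1)%:E = 1)%E.
  by rewrite -EFinM mulVf // gt_eqF.
rewrite -[LHS]mul1e -vn -muleA [X in (_ * X)%E]H /modulus EFinM fineK; last exact: nuL_pball_fin.
by rewrite [in RHS](muleC (mu n (_ @^-1` _))) -muleA; congr (_ * _)%E; exact: muleC.
Qed.

Lemma modulusM n (L M : 'M[C]_n) : L \in unitmx -> M \in unitmx ->
  modulus (L *m M) = modulus L * modulus M.
Proof.
move=> uL uM; have uLM : L *m M \in unitmx by rewrite unitmx_mul uL.
have v0 := vball_gt0 n ltr01.
have mB := @measurable_pball n 1; have mT := measurable_tlin_pre M mB.
have E : tlin (L *m M) @^-1` pball n 1 = tlin L @^-1` (tlin M @^-1` pball n 1).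
  by apply/seteqP; split=> x; rewrite /preimage /= tlinM.
have h := etrans (esym (mu_tlin uLM mB)) (etrans (congr1 (mu n) E)
  (etrans (mu_tlin uL mT) (congr1 (fun x => (modulus L)%:E * x)%E (mu_tlin uM mB)))).
move: h; rewrite (mu_pball n ltr01) -!EFinM => -[H].
by apply: (mulIf (lt0r_neq0 v0)); rewrite H mulrA.
Qed.

Lemma modulus_pball_eq n (L : 'M[C]_n) : L \in unitmx ->
  (forall v : 'rV[C]_n, rn (v *m L) = rn v) -> modulus L = 1.
Proof.
move=> uL H; rewrite /modulus.
have -> : tlin L @^-1` pball n 1 = pball n 1.
  by apply/seteqP; split=> x; rewrite /preimage /pdball /= toCn_tlin H.
by rewrite mu_pball //= divff // gt_eqF // vball_gt0.
Qed.

(** The condition decouples into the coordinates: the set is the polydisc with radii e / |d_j|. *)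
Lemma mu_tlin_diag n (d : 'rV[C]_n) (e : R) : 0 < e -> (forall j, d 0 j != 0) ->
  mu n [set x | rn (toCn x *m diag_mx d) < e] = (((\prod_j cabs (d 0 j))^-1) ^+ 2 * vball n e)%:E.
Proof.
move=> e0 d0.
have cd j : 0 < cabs (d 0 j) by rewrite cabs_gt0.
have -> : [set x : TT n | rn (toCn x *m diag_mx d) < e] = pdisc (fun j => e / cabs (d 0 j)).
  have E (x : TT n) j : (toCn x *m diag_mx d) 0 j = toCn x 0 j * d 0 j by rewrite mul_mx_diag mxE.
  apply/seteqP; split=> x /=.
    by move=> /(rn_ltP _ e0) H j; have := H j; rewrite E cabsM ltr_pdivlMr.
  by move=> H; apply/rn_ltP => // j; have := H j; rewrite E cabsM ltr_pdivlMr.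
rewrite mu_pdisc; last by move=> j; rewrite divr_gt0.
congr EFin; rewrite /vball big_split /= prodr_const card_ord prodfV exprMn.
by rewrite -mulrA mulrCA.
Qed.

(* Conjugating by diag(t^(k i)) shrinks the off-diagonal part of T without changing the modulus. *)
Lemma modulus_triangular n (T : 'M[C]_n) (k : 'I_n -> nat) :
  (forall i j, i != j -> T i j != 0 -> (k i < k j)%N) -> (forall i, T i i != 0) -> T \in unitmx ->
  (\prod_i cabs (T i i))^-1 ^+ 2 <= modulus T.
Proof.
move=> Tk Td uT.
have v0 := vball_gt0 n ltr01.
pose d : 'rV[C]_n := \row_i T i i.
have d0 j : d 0 j != 0 by rewrite mxE.
pose D := \sum_i \sum_j cabs (invmx (diag_mx d) i j).
have D0 : 0 <= D by do 2!(apply: sumr_ge0 => ? _); exact: cabs_ge0.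
have uD : diag_mx d \in unitmx.
  by rewrite unitmxE det_diag unitfE; apply/prodf_neq0 => i _; rewrite mxE.
pose S := \sum_i \sum_j cabs (T i j).
have S0 : 0 <= S by do 2!(apply: sumr_ge0 => ? _); exact: cabs_ge0.
(* The off-diagonal entries cost [e] in the radius: after conjugation, the preimage of the polydisc
   of radius 1 - e under the diagonal part lies in the preimage of the unit polydisc under [T']. *)
have key (e : R) : 0 < e < 1 -> (\prod_i cabs (T i i))^-1 ^+ 2 * vball n (1 - e) <= modulus T * vball n 1.
  move=> /andP[e0 e1]; have e1' : 0 < 1 - e by rewrite subr_gt0.
  (* Points of the smaller preimage have norm at most D, and the off-diagonal part moves them by at
     most t S D <= e. That t <= 1 is used for the powers t ^ (k j - k i). *)
  pose t : R := e / (S * D + 1).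
  have SD : 0 < S * D + 1 by rewrite ltr_wpDl // mulr_ge0.
  have t0 : 0 < t by rewrite divr_gt0.
  have t1 : t <= 1 by rewrite ler_pdivrMr // mul1r; apply: le_trans (ltW e1) _; rewrite lerDr mulr_ge0.
  have tC : t%:C != 0 :> C by rewrite -cabs_gt0 cabs_real normr_gt0 gt_eqF.
  pose s : 'rV[C]_n := \row_i (t%:C ^+ k i)^-1; pose s' : 'rV[C]_n := \row_i (t%:C ^+ k i).
  have ss : diag_mx s *m diag_mx s' = 1%:M.
    apply/matrixP => i j; rewrite mul_diag_mx !mxE.
    case: eqVneq => [->|_]; rewrite ?mulr1n ?mulVf ?expf_neq0 //.
    by rewrite mulr0n mulr0.
  have us : diag_mx s \in unitmx by have [] := mulmx1_unit ss.
  have us' : diag_mx s' \in unitmx by have [] := mulmx1_unit ss.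
  pose T' := diag_mx s *m T *m diag_mx s'.
  have usT : diag_mx s *m T \in unitmx by rewrite unitmx_mul us.
  have uT' : T' \in unitmx by rewrite unitmx_mul usT.
  have -> : modulus T = modulus T'.
    have h1 := modulusM usT us'; have h2 := modulusM us uT; have h3 := modulusM us us'.
    have m1 : modulus (1%:M : 'M[C]_n) = 1.
      by apply: modulus_pball_eq => [|v]; [exact: unitmx1|rewrite mulmx1].
    rewrite ss m1 in h3; apply: etrans (esym h1); rewrite h2 mulrAC -h3.
    by rewrite mul1r.
  pose N := T' - diag_mx d.
  have Nij i j : cabs (N i j) <= t * cabs (T i j).
    rewrite /N /T' mul_mx_diag mul_diag_mx !mxE.
    have [<-|ij] := eqVneq i j.
      by rewrite mulr1n mulrAC mulVf ?expf_neq0 // mul1r subrr cabs0 mulr_ge0 ?cabs_ge0 // ltW.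
    rewrite mulr0n subr0; have [->|Tij] := eqVneq (T i j) 0.
      by rewrite mulr0 mul0r cabs0 mulr0.
    have kij := Tk i j ij Tij.
    rewrite mulrAC cabsM ler_wpM2r ?cabs_ge0 //.
    rewrite -(subnK (ltnW kij)) exprD mulrCA mulVf ?expf_neq0 // mulr1 cabsX cabs_real gtr0_norm //.
    by rewrite -(subnK (_ : (1 <= k j - k i)%N)) ?subn_gt0 // addn1 exprS ler_piMr ?(ltW t0) // exprn_ile1 // ltW.
  have NS (v : 'rV[C]_n) : rn (v *m N) <= t * S * rn v.
    apply: le_trans (rn_mulmx _ _) _; rewrite ler_wpM2r ?rn_ge0 //.
    by rewrite /S mulr_sumr; apply: ler_sum => i _; rewrite mulr_sumr; apply: ler_sum => j _.
  rewrite -lee_fin.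
  have -> : (modulus T' * vball n 1)%:E = mu n (tlin T' @^-1` pball n 1).
    by rewrite mu_tlin // ?mu_pball //; exact: measurable_pball.
  rewrite (eq_bigr (fun j => cabs (d 0 j))); last by move=> j _; rewrite mxE.
  rewrite -mu_tlin_diag //.
  have -> : [set x : TT n | rn (toCn x *m diag_mx d) < 1 - e] = tlin (diag_mx d) @^-1` pball n (1 - e).
    by apply/seteqP; split=> x; rewrite /preimage /pdball /= toCn_tlin.
  apply: le_measure; rewrite ?inE; try (by apply: measurable_tlin_pre; exact: measurable_pball).
  move=> x; rewrite /preimage /pdball /= !toCn_tlin => h.
  have -> : toCn x *m T' = toCn x *m diag_mx d + toCn x *m N.
    by rewrite -mulmxDr /N addrC subrK.
  apply: le_lt_trans (rnD _ _) _.
  have xD : rn (toCn x) <= D.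
    have := rn_mulmx (invmx (diag_mx d)) (toCn x *m diag_mx d); rewrite (mulmxK uD) => hx.
    apply: le_trans hx _; rewrite ler_piMr //.
    by apply: le_trans (ltW h) _; rewrite lerBlDr lerDl ltW.
  rewrite -[ltRHS](subrK e); apply: ltr_leD h _.
  apply: le_trans (NS _) _; apply: (@le_trans _ _ (t * S * D)).
    by rewrite ler_wpM2l // mulr_ge0 // ltW.
  by rewrite /t -!mulrA ler_piMr ?(ltW e0) // mulrC ler_pdivrMr // mul1r lerDl.
(* Bernoulli's inequality for (1 - e) ^ (2 n), the ratio of the two polydisc volumes, lets e tend to
   0. *)
have bern (m : nat) (e : R) : 0 <= e <= 1 -> 1 - m%:R * e <= (1 - e) ^+ m.
  move=> /andP[e0 e1]; elim: m => [|m IH]; first by rewrite mul0r subr0 expr0.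
  rewrite exprS; apply: (@le_trans _ _ ((1 - e) * (1 - m%:R * e))); last by rewrite ler_wpM2l // subr_ge0.
  rewrite -natr1; have : 0 <= m%:R * e * e by rewrite !mulr_ge0.
  by rewrite mulrDl mul1r; move: (m%:R * e) => X; nra.
rewrite -(ler_pM2r v0); apply/ler_addgt0Pl => e e0.
set P := (\prod_i _)^-1 ^+ 2 in key *.
have P0 : 0 <= P by rewrite sqr_ge0.
pose c := P * vball n 1 * (n * 2)%:R.
have c0 : 0 <= c by rewrite mulr_ge0 // mulr_ge0 // ltW.
pose e' := Num.min 2^-1 (e / (c + 1)).
have e'0 : 0 < e' by rewrite lt_min invr_gt0 ltr0n divr_gt0 // ltr_wpDl.
have e'1 : e' < 1 by rewrite gt_min invf_lt1 // ltr1n.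
have := key e'; rewrite e'0 e'1 => /(_ isT) h.
have e'01 : 0 <= e' <= 1 by rewrite !ltW.
have vE : vball n (1 - e') = (1 - e') ^+ (n * 2) * vball n 1.
  by rewrite /vball !expr1n mul1r exprM.
rewrite -lerBlDr; apply: (@le_trans _ _ (P * vball n 1 - P * vball n (1 - e'))).
  by rewrite lerD2l lerN2.
rewrite vE; apply: (@le_trans _ _ (c * e')).
  have := bern (n * 2)%N e' e'01; rewrite /c; move: ((1 - e') ^+ _) => X hX.
  have -> : P * vball n 1 - P * (X * vball n 1) = P * vball n 1 * (1 - X) by ring.
  rewrite -[leRHS]mulrA; apply: ler_wpM2l; first by rewrite mulr_ge0 // ltW.
  by rewrite lerBlDr addrC -lerBlDr.
apply: (@le_trans _ _ ((c + 1) * (e / (c + 1)))); last by rewrite mulrC divfK // gt_eqF // ltr_wpDl.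
by apply: ler_pM => //; rewrite ?(ltW e'0) ?lerDl // ge_min lexx orbT.
Qed.

Lemma rn_perm n (s : {perm 'I_n}) (v : 'rV[C]_n) : rn (v *m perm_mx s) = rn v.
Proof.
have main (t : {perm 'I_n}) (w : 'rV[C]_n) : rn (w *m perm_mx t) <= rn w.
  apply: rn_le => [|j]; first exact: rn_ge0.
  have := col_permE t^-1%g w; rewrite invgK => <-; rewrite mxE; exact: cabs_le_rn.
apply/eqP; rewrite eq_le main /=.
apply: le_trans (main s^-1%g (v *m perm_mx s)).
by rewrite -mulmxA -perm_mxM mulgV perm_mx1 mulmx1.
Qed.

(** LUP decomposition. A permutation preserves polydiscs and has modulus 1; the triangular factors
    fall under [modulus_triangular], with weights n - i for the lower factor, whose diagonal is 1,
    and i for the upper one. *)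
Lemma modulus_ge n (A : 'M[C]_n.+1) : A \in unitmx -> (cabs (\det A))^-1 ^+ 2 <= modulus A.
Proof.
move=> uA.
have := cormen_lup_correct A; have := cormen_lup_perm A.
have := @cormen_lup_lower _ _ A; have := @cormen_lup_upper _ _ A.
case: (cormen_lup A) => -[P L] U /= HU HL /is_perm_mxP[s ->] E.
have {}E : perm_mx s *m A = L *m U by [].
have tL : is_trig_mx L.
  by apply/is_trig_mxP => i j ij; rewrite (HL i j (ltnW ij)) -val_eqE /= ltn_eqF.
have LE i : L i i = 1 by rewrite (HL i i (leqnn i)) eqxx.
have dL : \det L = 1 by rewrite (det_trig tL) big1.
have tU : is_trig_mx U^T by apply/is_trig_mxP => i j ij; rewrite mxE (HU j i ij).
have dU : \det U = \prod_i U i i.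
  by rewrite -det_tr (det_trig tU); apply: eq_bigr => i _; rewrite mxE.
have uL : L \in unitmx by rewrite unitmxE dL unitr1.
have uP : (perm_mx s : 'M[C]_n.+1) \in unitmx by rewrite unitmxE det_perm unitrX // unitrN1.
have uU : U \in unitmx.
  by have : L *m U \in unitmx; [rewrite -E unitmx_mul uP|rewrite unitmx_mul => /andP[]].
have Un0 i : U i i != 0.
  by move: uU; rewrite unitmxE dU unitfE => /prodf_neq0; apply.
have dA : cabs (\det A) = \prod_i cabs (U i i).
  have := congr1 (fun M => cabs (\det M)) E; rewrite !det_mulmx dL mul1r dU cabsM det_perm.
  rewrite cabsX cabsN cabs1 expr1n mul1r => ->.
  by rewrite (big_morph _ (@cabsM R) (@cabs1 R)).
have mA : modulus A = modulus L * modulus U.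
  have h1 := modulusM uL uU; have h2 := modulusM uP uA.
  have h3 := modulus_pball_eq uP (rn_perm s).
  transitivity (modulus (perm_mx s : 'M[C]_n.+1) * modulus A); first by rewrite h3 mul1r.
  apply: etrans (esym h2) _.
  apply: etrans _ h1.
  exact: congr1 E.
rewrite mA dA -[leLHS]mul1r; apply: ler_pM => //; first exact: sqr_ge0.
  have := @modulus_triangular n.+1 L (fun i => n - i)%N.
  rewrite big1; last by move=> i _; rewrite LE cabs1.
  rewrite invr1 expr1n; apply=> [i j ij|i|]; [|by rewrite LE oner_eq0|exact: uL].
  case: (leqP i j) => ij2; last by move=> _; rewrite ltn_sub2l // (leq_trans ij2) // -ltnS.
  by rewrite (HL i j ij2) (negbTE ij) eqxx.
apply: (@modulus_triangular n.+1 U (fun i => i : nat)) => [i j ij|i|]; [|exact: Un0|exact: uU].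
case: (ltngtP i j) => // [ji|/val_inj e]; last by rewrite e eqxx in ij.
by rewrite (HU i j ji) eqxx.
Qed.

(** The set is a translate of the image under [J] of the ball of radius r, and [modulus_ge] is
    applied to the inverse of [J]. *)
Lemma mu_linear_ball n (J : 'M[C]_n.+1) (y0 : 'rV[C]_n.+1) (r : R) : J \in unitmx -> 0 < r ->
  ((cabs (\det J) ^+ 2 * vball n.+1 r)%:E <= mu n.+1 [set y | (rn ((toCn y - y0) *m invmx J) < r)%R])%E.
Proof.
move=> uJ r0; have uI : invmx J \in unitmx by rewrite unitmx_inv.
have mB : measurable (tlin (invmx J) @^-1` pball n.+1 r) by apply: measurable_tlin_pre; exact: measurable_pball.
have -> : [set y : TT n.+1 | rn ((toCn y - y0) *m invmx J) < r] =
    tadd (ofCn (- y0)) @^-1` (tlin (invmx J) @^-1` pball n.+1 r).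
  by apply/seteqP; split=> y; rewrite /preimage /pdball /= toCn_tlin toCn_tadd ofCnK.
rewrite mu_translation // mu_tlin //; last exact: measurable_pball.
rewrite mu_pball // -EFinM lee_fin ler_wpM2r ?(ltW (vball_gt0 _ r0)) //.
by have := modulus_ge uI; rewrite det_inv cabsV invrK.
Qed.

Lemma modulus_rotation n (z : C) : cabs z = 1 -> modulus (z%:M : 'M[C]_n) = 1 /\ (z%:M : 'M[C]_n) \in unitmx.
Proof.
move=> z1; have z0 : z != 0 by rewrite -cabs_gt0 z1.
have uz : (z%:M : 'M[C]_n) \in unitmx.
  by rewrite unitmxE det_scalar unitrX // unitfE.
by split=> //; apply: modulus_pball_eq => // v; rewrite mul_mx_scalar rnZ z1 mul1r.
Qed.

End linear_maps.

(** * Mean values and changes of variables *)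

Section compactness.
Context {R : realType}.
Local Notation C := R[i].

Lemma compact_disc (M : R) : compact [set z : C | cabs z <= M].
Proof.
pose f (p : R * R) : C := p.1 +i* p.2.
have cf : continuous f.
  move=> p; apply/cvgrPdist_le => e e0.
  have Re0 : 0 < complex.Re e / 2 by rewrite divr_gt0 //; move: e0; rewrite ltcE => /andP[].
  exists (ball p.1 (complex.Re e / 2), ball p.2 (complex.Re e / 2)).
    by split; exact: nbhsx_ballx.
  move=> q []; rewrite /ball /= => h1 h2; rewrite [`|_|]cabsE -[e]RRe_real ?gtr0_real // lecR.
  apply: le_trans (cabs_le _) _; rewrite ReD ImD ReN ImN /= [complex.Re e]splitr.
  by apply: lerD; apply: ltW.
have cS : compact (f @` (`[-M, M]%classic `*` `[-M, M]%classic)).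
  apply: continuous_compact; first exact: continuous_subspaceT.
  by apply: compact_setX; exact: segment_compact.
apply: (subclosed_compact _ cS).
  rewrite -openC openE => z /= /negP; rewrite -ltNge => Mz.
  apply/nbhs_ballP; exists (cabs z - M)%:C; first by rewrite /= ltcR subr_gt0.
  move=> w; rewrite /ball /= [`|_|]cabsE ltcR => h; apply/negP; rewrite -ltNge.
  have := cabsD (z - w) w; rewrite subrK; lra.
move=> z /= h; exists (complex.Re z, complex.Im z); last by rewrite /f; case: (z).
by split; rewrite /= in_itv /= -ler_norml; apply: le_trans h; [exact: Re_le_cabs|exact: Im_le_cabs].
Qed.

(** The closed ball is a product of closed discs, hence compact. This provides the bound M that
    [root_average] takes as data. *)
Lemma hol_bounded_closed_ball n (f : 'rV[C]_n -> C) z (r : R) :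
  (forall w, rn (w - z) <= r -> differentiable f w) ->
  exists M : R, forall w, rn (w - z) <= r -> cabs (f w) <= M.
Proof.
move=> fh; have [r0|r0] := ltrP r 0.
  by exists 0 => w h; have := le_lt_trans h r0; rewrite ltNge rn_ge0.
pose S : set 'rV[C]_n := [set w | forall j, [set z : C | cabs z <= r] (w ord0 j)].
have cS : compact S.
  refine (@rV_compact C n (fun=> [set z : C | cabs z <= r]) (fun=> _)).
  exact: compact_disc.
have SE w : S (w - z) <-> rn (w - z) <= r.
  by split=> [H|H j]; [apply: rn_le|apply: le_trans (cabs_le_rn _ _) H].
pose g (w : 'rV[C]_n) : R := cabs (f (z + w)).
have cg : {within S, continuous g}.
  apply/subspace_continuousP => w Sw.
  have wr : rn (z + w - z) <= r by apply/SE; rewrite addrAC subrr add0r.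
  apply/cvgrPdist_le => e e0; have [s s0 Hs] := hol_continuous (fh _ wr) e0.
  rewrite near_withinE; apply/nbhs_ballP; exists s%:C; first by rewrite /= ltcR.
  move=> x; rewrite mx_norm_ball /ball_ /= rnE ltcR => xw _.
  have := Hs (z + x); rewrite opprD addrACA subrr add0r rnB => /(_ (ltW xw)) h.
  rewrite /g ler_norml; apply/andP; split.
    by have := cabsD (f (z + x) - f (z + w)) (f (z + w)); rewrite subrK; lra.
  by have := cabsD (f (z + w) - f (z + x)) (f (z + x)); rewrite subrK (cabsB (f (z + w))); lra.
have [M [_ HM]] := compact_bounded (continuous_compact cg cS).
exists (M + 1) => w wz; have M1 : M < M + 1 by rewrite ltrDl.
have /= := HM _ M1 (g (w - z)); rewrite /g addrC subrK => h.
apply: le_trans (ler_norm _) (h _); exists (w - z); first exact/SE.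
by rewrite addrC subrK.
Qed.

End compactness.

(** * The sub-mean value property in L2 *)

Section mean_value_L2.
Context {R : realType}.
Local Notation C := R[i].
Local Notation mR := (measurableTypeR R).
Local Notation RR := (mR * mR)%type.
Local Notation TT n := (n.-tuple RR).
Local Notation mu n := (lebesgue_measure_Cn R n).
Local Notation pre U := (@toCn R _ @^-1` U).

Definition sq n (f : 'rV[C]_n -> C) (z : 'rV[C]_n) : R := cabs (f z) ^+ 2.

Lemma sq_ge0 n (f : 'rV[C]_n -> C) z : 0 <= sq f z.
Proof. exact: sqr_ge0. Qed.

Definition energy n (U : set 'rV[C]_n) (f : 'rV[C]_n -> C) : \bar R :=
  (\int[mu n]_(x in pre U) (sq f (toCn x))%:E)%E.

Lemma L2_sqnormE n (U : set 'rV[C]_n) f : L2_sqnorm U f = energy U f.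
Proof.
apply: eq_integral => x _; congr EFin; rewrite cabsE -rmorphXn /=.
by [].
Qed.

Lemma measurable_pre n (U : set 'rV[C]_n) : open U -> measurable (pre U : set (TT n)).
Proof. by move=> oU; apply: measurable_pre_open oU; exact: mcoord_toCn. Qed.

Lemma rcont_hol n (U : set 'rV[C]_n) (f : 'rV[C]_n -> C) (p : C -> R) :
  (forall a b, `|p a - p b| <= cabs (a - b)) -> holomorphic_on U f -> rcont_on U (fun z => p (f z)).
Proof.
move=> Hp fh z Uz e e0; have [r r0 H] := hol_continuous (fh z Uz) e0.
by exists r => // w Uw /ltW /H h; apply: le_trans (Hp _ _) h.
Qed.

Lemma rcont_mul n (U : set 'rV[C]_n) (u v : 'rV[C]_n -> R) : rcont_on U u -> rcont_on U v ->
  rcont_on U (fun z => u z * v z).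
Proof.
move=> cu cv z Uz e e0.
pose K := `|u z| + `|v z| + 1; have K0 : 0 < K by rewrite ltr_wpDl.
have e1 : 0 < Num.min 1 (e / K / 2) by rewrite lt_min ltr01 !divr_gt0.
have [r r0 Hr] := cu z Uz _ e1; have [s s0 Hs] := cv z Uz _ e1.
exists (Num.min r s); first by rewrite lt_min r0.
move=> w Uw; rewrite lt_min => /andP[/(Hr w Uw) + /(Hs w Uw)].
rewrite !le_min => /andP[h1 h2] /andP[h3 h4].
have -> : u w * v w - u z * v z = (u w - u z) * v w + u z * (v w - v z) by ring.
apply: le_trans (ler_normD _ _) _; rewrite !normrM.
have vw : `|v w| <= `|v z| + 1.
  have -> : v w = v z + (v w - v z) by ring.
  by apply: le_trans (ler_normD _ _) _; rewrite lerD2l.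
apply: (@le_trans _ _ (e / K / 2 * K + K * (e / K / 2))).
  by apply: lerD; apply: ler_pM => //; [apply: le_trans vw _|]; rewrite /K; have := normr_ge0 (u z); have := normr_ge0 (v z); lra.
by rewrite le_eqVlt; apply/orP; left; apply/eqP; field; rewrite gt_eqF.
Qed.

Lemma cabs_lip (a b : C) : `|cabs a - cabs b| <= cabs (a - b).
Proof.
rewrite ler_norml; apply/andP; split.
  by have := cabsD (b - a) a; rewrite subrK (cabsB b); lra.
by have := cabsD (a - b) b; rewrite subrK; lra.
Qed.

Lemma rcont_sq n (U : set 'rV[C]_n) f : holomorphic_on U f -> rcont_on U (sq f).
Proof.
by move=> fh; apply: rcont_mul; exact: rcont_hol cabs_lip fh.
Qed.

Lemma measurable_sq n (U : set 'rV[C]_n) f : open U -> holomorphic_on U f ->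
  measurable_fun (pre U : set (TT n)) (fun x => (sq f (toCn x))%:E).
Proof.
move=> oU fh; apply/measurable_EFinP.
exact: measurable_fun_rcont oU (rcont_sq fh).
Qed.

Lemma mu_map_integral n (g : TT n -> TT n) (D : set (TT n)) (f : TT n -> \bar R) : measurable_fun setT g ->
  (forall A, measurable A -> mu n (g @^-1` A) = mu n A) -> measurable D -> measurable_fun D f ->
  (forall x, D x -> (0 <= f x)%E) ->
  (\int[mu n]_(x in g @^-1` D) f (g x) = \int[mu n]_(x in D) f x)%E.
Proof.
move=> mg inv mD mf f0.
rewrite -[LHS](@ge0_integral_pushforward _ _ _ _ R g mg (mu n) D f mD mf); last first.
  by move=> y /set_mem; exact: f0.
by apply: eq_measure_integral => A mA _; exact: inv.
Qed.

(** The triangle inequality, and the fact that the moduli have nonnegative variance. *)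
Lemma mean_sq_le N (a : 'I_N.+1 -> C) :
  cabs (N.+1%:R^-1 * \sum_k a k) ^+ 2 <= N.+1%:R^-1 * \sum_k cabs (a k) ^+ 2.
Proof.
have N0 : 0 < N.+1%:R :> R by rewrite ltr0n.
rewrite cabsM cabsV.
have -> : cabs (N.+1%:R : C) = N.+1%:R.
  have -> : (N.+1%:R : C) = (N.+1%:R : R)%:C by rewrite rmorph_nat.
  by rewrite cabs_real ger0_norm.
pose m : R := N.+1%:R^-1 * \sum_k cabs (a k).
apply: (@le_trans _ _ (m ^+ 2)).
  have S0 : 0 <= \sum_k cabs (a k) by apply: sumr_ge0 => k _; exact: cabs_ge0.
  have iN0 : 0 <= N.+1%:R^-1 :> R by rewrite invr_ge0 ltW.
  apply: lerXn2r; rewrite ?nnegrE; [exact: mulr_ge0 iN0 (cabs_ge0 _)|exact: mulr_ge0|].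
  by apply: ler_wpM2l => //; exact: cabs_sum.
have : 0 <= \sum_k (cabs (a k) - m) ^+ 2 by apply: sumr_ge0 => k _; exact: sqr_ge0.
rewrite (eq_bigr (fun k => cabs (a k) ^+ 2 - 2 * m * cabs (a k) + m ^+ 2)); last first.
  by move=> k _; ring.
rewrite big_split sumrB /= -mulr_sumr sumr_const card_ord.
have -> : \sum_k cabs (a k) = N.+1%:R * m by rewrite /m mulrA divff ?mul1r // gt_eqF.
rewrite -mulr_natl ler_pdivlMl // => h.
have -> : N.+1%:R * m ^+ 2 = 2 * m * (N.+1%:R * m) - N.+1%:R * m ^+ 2 by ring.
by rewrite -subr_ge0; apply: le_trans h _; rewrite le_eqVlt; apply/orP; left; apply/eqP; ring.
Qed.

Let rotate n (c : C) (z : 'rV[C]_n) (x : TT n) : TT n := tadd (ofCn z) (tlin c%:M x).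

Lemma toCn_rotate n c (z : 'rV[C]_n) x : toCn (rotate c z x) = c *: toCn x + z.
Proof. by rewrite /rotate toCn_tadd toCn_tlin mul_mx_scalar ofCnK. Qed.

Lemma measurable_rotate n c (z : 'rV[C]_n) : measurable_fun setT (rotate c z).
Proof. exact: measurableT_comp (@measurable_tadd R n _) (@measurable_tlin R n _). Qed.

Lemma mu_rotate n c (z : 'rV[C]_n) (A : set (TT n)) : cabs c = 1 -> measurable A ->
  mu n (rotate c z @^-1` A) = mu n A.
Proof.
move=> c1 mA; have [m1 u1] := @modulus_rotation R n c c1.
have mB : measurable (tadd (ofCn z) @^-1` A) by apply: measurable_preT mA; exact: measurable_tadd.
have -> : rotate c z @^-1` A = tlin c%:M @^-1` (tadd (ofCn z) @^-1` A) by [].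
by rewrite (mu_tlin u1 mB) m1 mul1e mu_translation.
Qed.

(** For x in the polydisc of radius r, |f z|^2 is at most the mean of |f (z + c x)|^2 over the roots
    of unity c, up to an error O(1 / N). Integrated over x, all terms of the mean are equal, because
    x |-> c x + z preserves [mu]. The radius 2 r is there because [root_average] works on the disc
    of radius 2. *)
Lemma sub_mean_value_L2 n (U : set 'rV[C]_n) (f : 'rV[C]_n -> C) (z : 'rV[C]_n) (r : R) : open U -> holomorphic_on U f ->
  0 < r -> (forall w, rn (w - z) <= 2 * r -> U w) ->
  ((sq f z * vball n r)%:E <= energy U f)%E.
Proof.
move=> oU fh r0 HU.
have [M HM] := @hol_bounded_closed_ball R n f z (2 * r) (fun w h => fh w (HU w h)).
have M0 : 0 <= M by apply: le_trans (cabs_ge0 (f z)) (HM z _); rewrite subrr rn0; lra.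
pose B := @pdball R n r.
have mB : measurable B := @measurable_pball R n r.
have intB a : (\int[mu n]_(x in B) a%:E = (a * vball n r)%:E)%E.
  by rewrite EFinM -(mu_pball n r0); exact: integral_cst.
pose c N (k : 'I_N.+1) := circ ((k : nat)%:R * (2 * pi / N.+1%:R) : R).
have c1 N k : cabs (@c N k) = 1 by exact: cabs_circ.
pose W := [set w | rn (w - z) < r].
have oW : open W.
  apply: rn_open => w /= wr; exists (r - rn (w - z)); first by rewrite subr_gt0.
  move=> x xw; have := rnD (x - w) (w - z); rewrite addrA subrK /W /=; lra.
have WU : W `<=` U by move=> w /= wr; apply: HU; apply: le_trans (ltW wr) _; lra.
have fW : holomorphic_on W f by move=> w /WU; exact: fh.
have preW N k : rotate (@c N k) z @^-1` (pre W) = B.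
  by apply/seteqP; split=> x; rewrite /preimage /B /pdball /W /= toCn_rotate addrK rnZ c1 mul1r.
have eqE N k : (\int[mu n]_(x in B) (sq f (toCn (rotate (@c N k) z x)))%:E = energy W f)%E.
  rewrite -(preW N k).
  apply: (@mu_map_integral n (rotate (c N k) z) (pre W) (fun x => (sq f (toCn x))%:E)).
  - exact: measurable_rotate.
  - by move=> A mA; exact: mu_rotate.
  - exact: measurable_pre.
  - exact: measurable_sq.
  - by move=> x _; rewrite lee_fin sq_ge0.
have mk N k : measurable_fun B (fun x => (sq f (toCn (rotate (@c N k) z x)))%:E).
  rewrite -(preW N k) /preimage.
  apply: (measurable_comp (measurable_pre oW) _ (measurable_sq oW fW)); first by move=> _ [x + <-].
  by apply: measurable_funTS; exact: measurable_rotate.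
have EW : (energy W f <= energy U f)%E.
  apply: ge0_subset_integral; [exact: measurable_pre|exact: measurable_pre|exact: measurable_sq| |].
  - by move=> x _; rewrite lee_fin sq_ge0.
  - by move=> x; exact: WU.
apply: le_trans EW; apply/lee_addgt0Pr => e e0.
pose K := 2 * M * (8 * pi * M) * vball n r.
have vr := vball_gt0 n r0.
have pi0 : 0 <= pi :> R := pi_ge0 R.
have pM0 : 0 <= 8 * pi * M by rewrite !mulr_ge0.
have M20 : 0 <= 2 * M by rewrite mulr_ge0.
have K0 : 0 <= K := mulr_ge0 (mulr_ge0 M20 pM0) (ltW vr).
pose N := Num.bound (K / e).
have Ne : K / N.+1%:R <= e.
  have := @archi_boundP _ (K / e) (divr_ge0 K0 (ltW e0)).
  rewrite -/N => h; rewrite ler_pdivrMr ?ltr0n //.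
  move: h; rewrite ltr_pdivrMr // => /ltW h; apply: le_trans h _.
  by rewrite mulrC ler_pM2l // ler_nat.
(* Bounds |f z|^2 - |a|^2 = (|f z| - |a|) (|f z| + |a|), where |f z| - |a| <= 8 pi M / N.+1 and, in
   the case that matters, |a| < |f z| <= M. *)
pose d : R := 2 * M * (8 * pi * M / N.+1%:R).
have pt x : B x -> sq f z <= N.+1%:R^-1 * (\sum_(k < N.+1) sq f (toCn (rotate (@c N k) z x))) + d.
  rewrite /B /pdball /= => xr.
  have inb t : cabs (t - 0) <= 2 -> rn (z + t *: toCn x - z) <= 2 * r.
    by rewrite subr0 addrC addKr rnZ => t2; apply: ler_pM => //; [exact: cabs_ge0|exact: rn_ge0|exact: ltW].
  have ch : chol (fun t => f (z + t *: toCn x)) 0 2.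
    move=> t t2; exists (dd f (z + t *: toCn x) (toCn x)); apply: differentiable_line.
    by apply: fh; apply: HU; exact: inb.
  have bd t : cabs (t - 0) <= 2 -> cabs (f (z + t *: toCn x)) <= M by move=> t2; apply: HM; exact: inb.
  have := @root_average R _ M N ch bd; rewrite /= scale0r addr0.
  set a := _ * _ => h.
  have aE : a = N.+1%:R^-1 * \sum_(k < N.+1) f (toCn (rotate (@c N k) z x)).
    by rewrite /a; congr (_ * _); apply: eq_bigr => k _; rewrite toCn_rotate addrC.
  have := mean_sq_le (fun k : 'I_N.+1 => f (toCn (rotate (@c N k) z x))); rewrite -aE => h2.
  have fzM : cabs (f z) <= M by apply: HM; rewrite subrr rn0; lra.
  have h3 : cabs (f z) <= cabs a + 8 * pi * M / N.+1%:R.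
    rewrite -{1}[f z](subrK a); apply: le_trans (cabsD _ _) _.
    by rewrite (cabsB (f z)) addrC lerD2l.
  apply: le_trans (lerD h2 (lexx _)).
  rewrite /d /sq; set q := _ / _ in h h3 *.
  have q0 : 0 <= q by rewrite /q mulr_ge0 ?invr_ge0.
  have fz0 := cabs_ge0 (f z); have a0 := cabs_ge0 a.
  have [le|lt] := lerP (cabs (f z)) (cabs a).
    have := mulr_ge0 (mulr_ge0 (ler0n R 2) M0) q0.
    by have := lerXn2r 2 fz0 a0 le; lra.
  rewrite -lerBlDl subr_sqr mulrC.
  by apply: ler_pM; [lra|lra|lra|lra].
rewrite -intB.
have vN : 0 <= N.+1%:R^-1 :> R by rewrite invr_ge0.
have d0 : 0 <= d by rewrite /d; apply: mulr_ge0; rewrite mulr_ge0 ?invr_ge0.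
have mS : measurable_fun B (fun x => \sum_(k < N.+1) (sq f (toCn (rotate (@c N k) z x)))%:E)%E.
  by apply: emeasurable_sum => k _; exact: mk.
apply: (@le_trans _ _ (\int[mu n]_(x in B)
   ((N.+1%:R^-1)%:E * (\sum_(k < N.+1) (sq f (toCn (rotate (@c N k) z x)))%:E) + d%:E))%E).
  apply: ge0_le_integral => //.
  - by move=> x _; rewrite lee_fin sq_ge0.
  - by apply: emeasurable_funD => //; exact: measurable_funeM.
  - by move=> x /pt h; rewrite sumEFin -EFinM -EFinD lee_fin.
rewrite ge0_integralD //; last 2 first.
- by move=> x _; rewrite mule_ge0 ?lee_fin // sume_ge0 // => k _; rewrite lee_fin sq_ge0.
- exact: measurable_funeM.
rewrite ge0_integralZl //; last first.
  by move=> x _; rewrite sume_ge0 // => k _; rewrite lee_fin sq_ge0.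
rewrite ge0_integral_sum //; last by move=> k x _; rewrite lee_fin sq_ge0.
rewrite (eq_bigr (fun=> energy W f)) => [|k _]; last exact: eqE.
rewrite intB.
apply: leeD; last first.
  rewrite lee_fin; apply: le_trans Ne; rewrite le_eqVlt; apply/orP; left; apply/eqP.
  by rewrite /d /K; ring.
have -> : (\sum_(k < N.+1) energy W f = N.+1%:R%:E * energy W f)%E.
  have E0 : (0 <= energy W f)%E by apply: integral_ge0 => x _; rewrite lee_fin sq_ge0.
  elim: N.+1 => [|m IH]; first by rewrite big_ord0 mul0e.
  by rewrite big_ord_recr /= IH -natr1 EFinD ge0_muleDl ?lee_fin // mul1e.
by rewrite muleA -EFinM mulVf ?mul1e.
Qed.

End mean_value_L2.

Section fatou.
Context d (T : measurableType d) (R : realType).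
Variable mu : {measure set T -> \bar R}.

(** Fatou's lemma for one-sided estimates: at each point [h] is eventually below [f k] up to e, and
    convergence of [f k] is not assumed. *)
Lemma fatou_le (D : set T) (f : nat -> T -> \bar R) (h : T -> \bar R) (B : \bar R) : measurable D ->
  (forall k, measurable_fun D (f k)) -> (forall k x, D x -> (0 <= f k x)%E) ->
  measurable_fun D h -> (forall x, D x -> (0 <= h x)%E) ->
  (forall x, D x -> forall e : R, 0 < e -> exists K, forall k, (K <= k)%N -> (h x <= f k x + e%:E)%E) ->
  (forall k, (\int[mu]_(x in D) f k x <= B)%E) -> (\int[mu]_(x in D) h x <= B)%E.
Proof.
move=> mD mf f0 mh h0 H HB.
apply: (@le_trans _ _ (\int[mu]_(x in D) limn_einf (f^~ x))%E).
  apply: ge0_le_integral => //.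
  - apply: (emeasurable_fun_cvg (fun k x => einfs (f^~ x) k)).
      exact: measurable_fun_einfs.
    by move=> x _; rewrite limn_einf_lim; exact: is_cvg_einfs.
  - move=> x Dx; apply/lee_addgt0Pr => e e0; have [K HK] := H x Dx e e0.
    rewrite -leeBlDr //; rewrite limn_einf_lim.
    have -> : limn (einfs (f^~ x)) = ereal_sup (range (einfs (f^~ x))).
      by apply: cvg_lim => //; exact: cvg_einfs_sup.
    apply: (@le_trans _ _ (einfs (f^~ x) K)); last by apply: ereal_sup_ubound; exists K.
    apply: le_ereal_inf_tmp => _ [k /= Kk <-]; have := HK k Kk; by rewrite -leeBlDr.
apply: le_trans (fatou mu mD mf f0) _.
rewrite limn_einf_lim; apply: lime_le; first exact: is_cvg_einfs.
apply: nearW => k; apply: le_trans (HB k); apply: ereal_inf_lbound; exists k => //=.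
Qed.

End fatou.

(** * Change of variables for holomorphic maps *)

Section change_of_variables.
Context {R : realType}.
Local Notation C := R[i].
Local Notation mR := (measurableTypeR R).
Local Notation RR := (mR * mR)%type.
Local Notation TT n := (n.-tuple RR).
Local Notation mu n := (lebesgue_measure_Cn R n).
Local Notation pre U := (@toCn R _ @^-1` U).

Lemma Jmx_expansion n m (f : 'rV[C]_n -> 'rV[C]_m) z : differentiable f z ->
  forall e : R, 0 < e -> exists2 r : R, 0 < r & forall w, rn (w - z) < r ->
    rn (f w - f z - (w - z) *m Jmx f z) <= e * rn (w - z).
Proof.
move=> df e e0; have [r r0 H] := differentiable_expansion df e0.
exists r => // w /H; rewrite (addrC z) subrK rnE diff_Jmx -rmorphM /=.
by rewrite lecR.
Qed.

Lemma hol_vec_continuous n m (f : 'rV[C]_n -> 'rV[C]_m) z : differentiable f z ->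
  forall e : R, 0 < e -> exists2 r : R, 0 < r & forall w, rn (w - z) < r -> rn (f w - f z) < e.
Proof.
move=> df e e0; have [r r0 H] := Jmx_expansion df ltr01.
pose K := \sum_i \sum_j cabs (Jmx f z i j) + 1.
have K0 : 0 < K by rewrite ltr_wpDl //; do 2!(apply: sumr_ge0 => ? _); exact: cabs_ge0.
exists (Num.min r (e / K)); first by rewrite lt_min r0 divr_gt0.
move=> w; rewrite lt_min => /andP[/H h1 h2].
have -> : f w - f z = (f w - f z - (w - z) *m Jmx f z) + (w - z) *m Jmx f z by rewrite subrK.
apply: le_lt_trans (rnD _ _) _.
apply: le_lt_trans (lerD h1 (rn_mulmx _ _)) _.
rewrite -mulrDl addrC -/K mulrC.
by rewrite -ltr_pdivlMr.
Qed.

Lemma Jmx_inverse n (U : set 'rV[C]_n) m (f : 'rV[C]_n -> 'rV[C]_m) (g : 'rV[C]_m -> 'rV[C]_n) z :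
  open U -> U z -> (forall w, U w -> g (f w) = w) -> differentiable f z -> differentiable g (f z) ->
  Jmx f z *m Jmx g (f z) = 1%:M.
Proof.
move=> oU Uz gf df dg; have [r r0 Hr] := open_rn oU Uz.
rewrite -Jmx_comp //; apply/matrixP => i j.
rewrite mxE.
have dgf : differentiable (g \o f) z by exact: differentiable_comp.
have [_ <-] := hol_coord j dgf.
have did : differentiable (fun w : 'rV[C]_n => w) z by exact: (@ex_diff _ _ _ _ _ _ _ (is_diff_id z)).
have [dc ec] := hol_coord j did.
have [|_ ->] := @hol_near_eq R n (fun w => w 0 j) (fun w => (g \o f) w 0 j) z r r0 _ dc.
  by move=> w /Hr Uw; rewrite /= gf.
rewrite ec.
have -> : 'd (fun w : 'rV[C]_n => w) z (delta_mx 0 i) = delta_mx 0 i.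
  exact: (congr1 (fun h : 'rV[C]_n -> 'rV[C]_n => h (delta_mx 0 i)) (@diff_val _ _ _ _ _ _ _ (is_diff_id z))).
by rewrite !mxE eqxx /= eq_sym.
Qed.

Lemma rn_lsubmx n m (w : 'rV[C]_(n + m)) : rn (lsubmx w) <= rn w.
Proof. by apply: rn_le => [|j]; [exact: rn_ge0|rewrite mxE; exact: cabs_le_rn]. Qed.

Lemma rn_rsubmx n m (w : 'rV[C]_(n + m)) : rn (rsubmx w) <= rn w.
Proof. by apply: rn_le => [|j]; [exact: rn_ge0|rewrite mxE; exact: cabs_le_rn]. Qed.

Variables (n : nat) (U V : set 'rV[C]_n.+1) (psi phi : 'rV[C]_n.+1 -> 'rV[C]_n.+1) (u : 'rV[C]_n.+1 -> R).
Hypotheses (oU : open U) (oV : open V) (hpsi : holomorphic_on U psi) (hphi : holomorphic_on V phi).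
Hypothesis psiK : forall z, U z -> V (psi z) /\ phi (psi z) = z.
Hypotheses (cu : rcont_on V u) (u0 : forall z, 0 <= u z).

Lemma measurable_weight : measurable_fun (pre V) (fun y : TT n.+1 => (u (toCn y))%:E).
Proof. by apply/measurable_EFinP; exact: measurable_fun_rcont oV cu. Qed.

(* The integral of the weight [u y] over the pairs with [|phi y - x| < d] is estimated in both
   orders. For fixed [y] the section is a ball of radius [d]; for fixed [x] and small [d] it
   contains a linear image under [Jmx psi x] of the ball of radius [d / 2]. Halving the radius
   absorbs the error of the linearisation, at the price of the factor 4 ^ n.+1. *)
Definition near_graph (d : R) : set (TT n.+1 * TT n.+1) :=
  [set p | [/\ U (toCn p.1), V (toCn p.2) & rn (phi (toCn p.2) - toCn p.1) < d]].

(** Joining the two points in one row vector exhibits the set as the preimage of an open set. *)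
Lemma measurable_near_graph d : measurable (near_graph d).
Proof.
pose e (p : TT n.+1 * TT n.+1) : 'rV[C]_(n.+1 + n.+1) := row_mx (toCn p.1) (toCn p.2).
pose S : set 'rV[C]_(n.+1 + n.+1) :=
  [set w | [/\ U (lsubmx w), V (rsubmx w) & rn (phi (rsubmx w) - lsubmx w) < d]].
have -> : near_graph d = e @^-1` S.
  by apply/seteqP; split=> p; rewrite /near_graph /S /= row_mxKl row_mxKr.
apply: measurable_pre_open.
  move=> j; rewrite /e; case: (split_ordP j) => k ->.
    under eq_fun do rewrite row_mxEl; under [X in _ /\ measurable_fun _ X]eq_fun do rewrite row_mxEl.
    have [m1 m2] := @mcoord_toCn R n.+1 k.
    by split; [exact: measurableT_comp m1 measurable_fst|exact: measurableT_comp m2 measurable_fst].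
  under eq_fun do rewrite row_mxEr; under [X in _ /\ measurable_fun _ X]eq_fun do rewrite row_mxEr.
  have [m1 m2] := @mcoord_toCn R n.+1 k.
  by split; [exact: measurableT_comp m1 measurable_snd|exact: measurableT_comp m2 measurable_snd].
apply: rn_open => w [Uw Vw wd].
have [r r0 Hr] := open_rn oU Uw; have [s s0 Hs] := open_rn oV Vw.
pose t := (d - rn (phi (rsubmx w) - lsubmx w)) / 2.
have t0 : 0 < t by rewrite divr_gt0 // subr_gt0.
have [q q0 Hq] := hol_vec_continuous (hphi Vw) t0.
exists (Num.min (Num.min r s) (Num.min q t)); first by rewrite !lt_min r0 s0 q0.
move=> x; rewrite !lt_min => /andP[/andP[xr xs] /andP[xq xt]].
have hl := rn_lsubmx (x - w); rewrite linearB in hl.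
have hr := rn_rsubmx (x - w); rewrite linearB in hr.
split; [exact: Hr (le_lt_trans hl xr)|exact: Hs (le_lt_trans hr xs)|].
have -> : phi (rsubmx x) - lsubmx x = (phi (rsubmx x) - phi (rsubmx w)) +
   ((phi (rsubmx w) - lsubmx w) - (lsubmx x - lsubmx w)).
  by apply/rowP => j; rewrite !mxE; ring.
apply: le_lt_trans (rnD _ _) _.
have h1 := Hq _ (le_lt_trans hr xq).
have h2 := le_lt_trans hl xt.
apply: (@lt_le_trans _ _ (t + (rn (phi (rsubmx w) - lsubmx w) + t))).
  apply: ltr_leD => //; apply: le_trans (rnD _ _) _; rewrite rnN lerD2l; exact: ltW.
by rewrite /t; set a := rn _; lra.
Qed.

Definition graph_weight (d : R) : TT n.+1 * TT n.+1 -> \bar R :=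
  (fun p => (u (toCn p.2))%:E) \_ (near_graph d).

Lemma graph_weight_ge0 d p : (0 <= graph_weight d p)%E.
Proof. by rewrite /graph_weight patchE; case: ifP => // _; rewrite lee_fin. Qed.

Lemma measurable_graph_weight d : measurable_fun setT (graph_weight d).
Proof.
apply/(measurable_restrictT _ (measurable_near_graph d)).
apply: (@measurable_comp _ _ _ _ _ _ (pre V) (fun y => (u (toCn y))%:E) _ snd (measurable_pre oV)).
- by move=> _ [p [_ Vp _] <-].
- exact: measurable_weight.
- by apply: measurable_funTS; exact: measurable_snd.
Qed.

Lemma graph_weight_upper d : 0 < d ->
  (\int[mu n.+1]_x \int[mu n.+1]_y graph_weight d (x, y)
    <= (vball n.+1 d)%:E * \int[mu n.+1]_(y in pre V) (u (toCn y))%:E)%E.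
Proof.
move=> d0.
have v0 := ltW (vball_gt0 n.+1 d0).
have mw := @measurable_graph_weight d.
rewrite (@fubini_tonelli _ _ _ _ _ (mu n.+1) (mu n.+1) _ mw (graph_weight_ge0 d)).
rewrite -ge0_integralZl //; last 3 first.
- exact: measurable_pre.
- exact: measurable_weight.
- by move=> x _; rewrite lee_fin.
rewrite [leRHS]integral_mkcond.
apply: ge0_le_integral => //.
- by move=> y _; apply: integral_ge0 => x _; exact: graph_weight_ge0.
- exact: (@measurable_fun_fubini_tonelli_G _ _ _ _ _ (mu n.+1) _ mw (graph_weight_ge0 d)).
- apply/(measurable_restrictT _ (measurable_pre oV)); apply: measurable_funeM.
  exact: measurable_weight.
move=> y _; rewrite patchE; case: ifPn => [/set_mem Vy|]; last first.
  rewrite notin_setE => nVy; rewrite integral0_eq // => x _.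
  by rewrite /graph_weight patchE memNset // => -[].
(* The section over y lies in the ball of radius d about phi y. *)
pose b := ofCn (- phi (toCn y)) : TT n.+1.
pose B := tadd b @^-1` pdball d.
have mB : measurable B by apply: measurable_preT (@measurable_pball R _ d); exact: measurable_tadd.
have muB : mu n.+1 B = (vball n.+1 d)%:E by rewrite mu_translation ?mu_pball //; exact: measurable_pball.
rewrite -muB muleC -(integral_cst _ mB) integral_mkcond.
apply: ge0_le_integral => //.
- by move=> x _; exact: graph_weight_ge0.
- exact: measurableT_comp mw (pair2_measurable y).
- by apply/(measurable_restrictT _ mB).
move=> x _; rewrite /graph_weight !patchE; case: ifPn => [/set_mem[_ _ h]|_].
  rewrite mem_set // /B /b /pdball /preimage /= toCn_tadd ofCnK.
  by rewrite -opprB rnN.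
by case: ifP => // _; rewrite lee_fin.
Qed.

Lemma graph_weight_lower x e : U (toCn x) -> 0 < e -> exists2 r : R, 0 < r & forall d, 0 < d < r ->
  (((u (psi (toCn x)) - e) * (cabs (\det (Jmx psi (toCn x))) ^+ 2 * vball n.+1 (d / 2)))%:E
    <= \int[mu n.+1]_y graph_weight d (x, y))%E.
Proof.
move=> Ux e0; set z := toCn x in Ux *.
have [Vy0 phi0] := psiK Ux; set y0 := psi z in Vy0 phi0 *.
pose J := Jmx psi z.
have JJ : J *m Jmx phi y0 = 1%:M.
  by apply: (Jmx_inverse oU Ux) => [w /psiK[]||] //; [exact: hpsi|exact: hphi].
have [uJ _] := mulmx1_unit JJ.
have iJ : invmx J = Jmx phi y0 by rewrite -[LHS]mulmx1 -JJ mulKmx.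
pose K := \sum_i \sum_j cabs (J i j) + 1.
have K0 : 0 < K by rewrite ltr_wpDl //; do 2!(apply: sumr_ge0 => ? _); exact: cabs_ge0.
have [r1 r10 H1] := open_rn oV Vy0.
have [r2 r20 H2] := cu Vy0 e0.
(* Precision 1 / K: on the set [A] below |y - y0| <= K d / 2, so the linearisation of phi errs by at
   most d / 2; the linear part being smaller than d / 2, phi y stays within d of x. *)
have [r3 r30 H3] := Jmx_expansion (hphi Vy0) (divr_gt0 (@ltr01 R) K0).
pose r := Num.min (Num.min r1 r2) r3.
have r0 : 0 < r by rewrite !lt_min r10 r20.
exists (r / K); first exact: divr_gt0.
move=> d /andP[d0 dr].
have d20 : 0 < d / 2 by rewrite divr_gt0.
pose A := [set y : TT n.+1 | rn ((toCn y - y0) *m invmx J) < d / 2].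
have mA : measurable A.
  have -> : A = tadd (ofCn (- y0)) @^-1` (tlin (invmx J) @^-1` pdball (d / 2)).
    by apply/seteqP; split=> y; rewrite /preimage /A /pdball /= toCn_tlin toCn_tadd ofCnK.
  by apply: measurable_preT (@measurable_tadd R _ _) _; apply: measurable_tlin_pre; exact: measurable_pball.
have mw := @measurable_graph_weight d.
have mwx : measurable_fun setT (fun y => graph_weight d (x, y)).
  exact: measurableT_comp mw (pair1_measurable x).
(* A nonpositive constant makes the left side nonpositive; a positive one can be integrated over [A]
   as a nonnegative function. *)
have [ue|eu] := lerP (u y0 - e) 0.
  apply: (@le_trans _ _ 0%E); last by apply: integral_ge0 => y _; exact: graph_weight_ge0.
  rewrite lee_fin mulr_le0_ge0 // mulr_ge0 ?sqr_ge0 // ltW //; exact: vball_gt0.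
apply: (@le_trans _ _ ((u y0 - e)%:E * mu n.+1 A)%E).
  by rewrite EFinM; apply: lee_wpmul2l; [rewrite lee_fin ltW|exact: mu_linear_ball].
rewrite -(integral_cst _ mA) integral_mkcond.
apply: ge0_le_integral => //.
- by move=> y _; rewrite patchE; case: ifP => // _; rewrite lee_fin ltW.
- by apply/(measurable_restrictT _ mA).
move=> y _; rewrite patchE; case: ifPn => [/set_mem Ay|_]; last exact: graph_weight_ge0.
have yr : rn (toCn y - y0) < r.
  have -> : toCn y - y0 = ((toCn y - y0) *m invmx J) *m J by rewrite mulmxKV.
  apply: le_lt_trans (rn_mulmx _ _) _.
  apply: (@le_lt_trans _ _ (K * (d / 2))).
    apply: ler_pM => //; [|exact: rn_ge0| |exact: ltW].
      by do 2!(apply: sumr_ge0 => ? _); exact: cabs_ge0.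
    by rewrite /K lerDl.
  rewrite mulrC -ltr_pdivlMr //; apply: le_lt_trans dr; lra.
have yr2 : rn (toCn y - y0) <= K * (d / 2).
  have -> : toCn y - y0 = ((toCn y - y0) *m invmx J) *m J by rewrite mulmxKV.
  apply: le_trans (rn_mulmx _ _) _.
  apply: ler_pM => //; [|exact: rn_ge0| |exact: ltW].
    by do 2!(apply: sumr_ge0 => ? _); exact: cabs_ge0.
  by rewrite /K lerDl.
move: (yr); rewrite !lt_min => /andP[/andP[y1 y2] y3].
have Vy := H1 _ y1.
have := H2 _ Vy y2; rewrite ler_norml => /andP[h2 _].
rewrite /graph_weight patchE mem_set; first by rewrite lee_fin /=; lra.
split=> //=.
have -> : phi (toCn y) - toCn x = (phi (toCn y) - phi y0 - (toCn y - y0) *m Jmx phi y0) + (toCn y - y0) *m Jmx phi y0.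
  by rewrite subrK phi0.
apply: le_lt_trans (rnD _ _) _.
rewrite -iJ [ltRHS]splitr iJ; apply: ler_ltD; last by rewrite -iJ.
apply: le_trans (H3 _ y3) _.
by rewrite div1r mulrC ler_pdivrMr // mulrC.
Qed.

Lemma vball_scale (d : R) : vball n.+1 (d / 2) = vball n.+1 d / 4 ^+ n.+1.
Proof.
have e4 : (4 : R) = 2 ^+ 2 by ring.
by rewrite /vball e4 !exprMn exprVn -!exprM (mulnC n.+1) mulrAC -expr2 exprVn.
Qed.

(** Both estimates of the double integral are divided by the volume of the ball of radius d k. As d
    k tends to 0, Fatou's lemma integrates the pointwise lower one. The factor 4 ^ n.+1 is the ratio
    of the volumes for the radii d and d / 2. *)
Lemma change_of_variables_le :
  measurable_fun (pre U) (fun x : TT n.+1 => (u (psi (toCn x)) * cabs (\det (Jmx psi (toCn x))) ^+ 2)%:E) ->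
  (\int[mu n.+1]_(x in pre U) (u (psi (toCn x)) * cabs (\det (Jmx psi (toCn x))) ^+ 2)%:E
    <= (4 ^+ n.+1)%:E * \int[mu n.+1]_(y in pre V) (u (toCn y))%:E)%E.
Proof.
move=> mh.
pose d k : R := k.+1%:R^-1.
have d0 k : 0 < d k by rewrite invr_gt0.
have p4 : 0 < 4 ^+ n.+1 :> R by rewrite exprn_gt0.
pose c k : R := 4 ^+ n.+1 / vball n.+1 (d k).
have c0 k : 0 <= c k by rewrite ltW // divr_gt0 // vball_gt0.
pose f k x := ((c k)%:E * \int[mu n.+1]_y graph_weight (d k) (x, y))%E.
have i0 k x : (0 <= \int[mu n.+1]_y graph_weight (d k) (x, y))%E.
  by apply: integral_ge0 => y _; exact: graph_weight_ge0.
have mi k : measurable_fun setT (fun x => \int[mu n.+1]_y graph_weight (d k) (x, y))%E.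
  exact: (@measurable_fun_fubini_tonelli_F _ _ _ _ _ (mu n.+1) _ (@measurable_graph_weight (d k)) (graph_weight_ge0 (d k))).
apply: (@fatou_le _ _ _ (mu n.+1) (pre U) f) => //.
- exact: measurable_pre.
- by move=> k; apply: measurable_funTS; apply: measurable_funeM.
- by move=> k x _; rewrite mule_ge0 // lee_fin.
- by move=> x _; rewrite lee_fin mulr_ge0 ?sqr_ge0.
- move=> x Ux e e0.
  pose D := cabs (\det (Jmx psi (toCn x))) ^+ 2.
  have D0 : 0 <= D by exact: sqr_ge0.
  (* The lower estimate multiplies its tolerance by D. *)
  have e10 : 0 < e / (D + 1) by rewrite divr_gt0 // ltr_wpDl.
  have [r r0 H] := graph_weight_lower Ux e10.
  exists (Num.bound r^-1) => k Kk.
  have dr : d k < r.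
    rewrite /d invf_plt ?posrE ?ltr0n //.
    apply: lt_le_trans (archi_boundP _) _; first by rewrite invr_ge0 ltW.
    by rewrite ler_nat (leq_trans Kk).
  have := H (d k); rewrite d0 dr => /(_ isT) h.
  rewrite -leeBlDr // -EFinD.
  apply: le_trans (lee_wpmul2l _ h); last by rewrite lee_fin.
  rewrite -EFinM lee_fin vball_scale -/D.
  have -> : c k * ((u (psi (toCn x)) - e / (D + 1)) * (D * (vball n.+1 (d k) / 4 ^+ n.+1))) =
     u (psi (toCn x)) * D - e * (D / (D + 1)).
    rewrite /c; field; rewrite !gt_eqF ?vball_gt0 //; last by rewrite ltr_wpDl.
  rewrite lerD2l lerN2 ler_piMr ?(ltW e0) // ler_pdivrMr ?ltr_wpDl //; lra.
move=> k; rewrite ge0_integralZl //; last 3 first.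
- exact: measurable_pre.
- exact: measurable_funTS.
- by rewrite lee_fin.
apply: (@le_trans _ _ ((c k)%:E * ((vball n.+1 (d k))%:E * \int[mu n.+1]_(y in pre V) (u (toCn y))%:E))%E).
  apply: lee_wpmul2l; first by rewrite lee_fin.
  apply: le_trans (graph_weight_upper (d0 k)).
  by apply: ge0_subset_integral => //; exact: measurable_pre.
by rewrite muleA -EFinM /c mulfVK // gt_eqF // vball_gt0.
Qed.

End change_of_variables.

(** * The Bergman space *)

Section bergman_space.
Context {R : realType}.
Local Notation C := R[i].
Local Notation mR := (measurableTypeR R).
Local Notation RR := (mR * mR)%type.
Local Notation TT n := (n.-tuple RR).
Local Notation mu n := (lebesgue_measure_Cn R n).
Local Notation pre U := (@toCn R _ @^-1` U).
Variables (n : nat) (Om : set 'rV[C]_n).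
Hypothesis oO : open Om.
Implicit Types f g h : 'rV[C]_n -> C.

Let mO : measurable (pre Om : set (TT n)) := measurable_pre oO.

(* Sealing keeps unification from unfolding membership in the Bergman space, the inner
   product and the norm down to the integrals. *)
Lemma bergman_seal : {p : (('rV[C]_n -> C) -> Prop) * (('rV[C]_n -> C) -> R) *
    (('rV[C]_n -> C) -> ('rV[C]_n -> C) -> C) * (('rV[C]_n -> C) -> ('rV[C]_n -> C) -> R) |
  p = (A2 Om, fun f => fine (energy Om f), L2_dot Om,
    fun f g => \int[mu n]_(x in pre Om) complex.Re (f (toCn x) * (g (toCn x))^*)%C)}.
Proof. by eexists. Qed.

Definition inA2 := (sval bergman_seal).1.1.1.
Definition nq := (sval bergman_seal).1.1.2.
Definition dot := (sval bergman_seal).1.2.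
Definition rdot := (sval bergman_seal).2.

Lemma inA2E : inA2 = A2 Om.
Proof. by rewrite /inA2 (svalP bergman_seal). Qed.

Lemma nq_def f : nq f = fine (energy Om f).
Proof. by rewrite /nq (svalP bergman_seal). Qed.

Lemma dotE : dot = L2_dot Om.
Proof. by rewrite /dot (svalP bergman_seal). Qed.

Lemma rdotE f g : rdot f g = \int[mu n]_(x in pre Om) complex.Re (f (toCn x) * (g (toCn x))^*)%C.
Proof. by rewrite /rdot (svalP bergman_seal). Qed.

Lemma A2P f : inA2 f <-> holomorphic_on Om f /\ (energy Om f < +oo)%E.
Proof. by rewrite inA2E /A2 L2_sqnormE. Qed.

Lemma A2_hol f : inA2 f -> holomorphic_on Om f.
Proof. by move=> /A2P[]. Qed.

Lemma energy_ge0 f : (0 <= energy Om f)%E.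
Proof. by apply: integral_ge0 => x _; rewrite lee_fin sq_ge0. Qed.

Lemma eq_energy f g : (forall z, Om z -> f z = g z) -> energy Om f = energy Om g.
Proof. by move=> fg; apply: eq_integral => x /set_mem Ox; rewrite /sq fg. Qed.

Lemma nq_ge0 f : 0 <= nq f.
Proof. by rewrite nq_def fine_ge0 // energy_ge0. Qed.

Lemma nqE f : inA2 f -> energy Om f = (nq f)%:E.
Proof. by move=> /A2P[_ fi]; rewrite nq_def fineK // ge0_fin_numE // energy_ge0. Qed.

Lemma integrable_sq f : inA2 f -> (mu n).-integrable (pre Om) (EFin \o (fun x => sq f (toCn x))).
Proof.
move=> /A2P[fh fi]; apply/integrableP; split; first exact: measurable_sq.
rewrite (eq_integral (fun x => (sq f (toCn x))%:E)) //.
by move=> x _; rewrite /= ger0_norm // sq_ge0.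
Qed.

Lemma sqD_le f g z : sq (fun w => f w + g w) z <= 2 * sq f z + 2 * sq g z.
Proof.
rewrite /sq; have h := cabsD (f z) (g z).
have := lerXn2r 2 (cabs_ge0 (f z + g z)) (addr_ge0 (cabs_ge0 (f z)) (cabs_ge0 (g z))) h.
move=> k; apply: le_trans k _; have := sqr_ge0 (cabs (f z) - cabs (g z)); rewrite -subr_ge0.
by move=> k; rewrite -subr_ge0 (le_trans k) // le_eqVlt; apply/orP; left; apply/eqP; ring.
Qed.

Lemma energyZ c f : holomorphic_on Om f -> energy Om (fun z => c * f z) = ((cabs c ^+ 2)%:E * energy Om f)%E.
Proof.
move=> fh; rewrite -ge0_integralZl //; last 3 first.
- exact: measurable_sq.
- by move=> x _; rewrite lee_fin sq_ge0.
- by rewrite lee_fin sqr_ge0.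
by apply: eq_integral => x _; rewrite /sq cabsM exprMn.
Qed.

Lemma A2Z c f : inA2 f -> inA2 (fun z => c * f z).
Proof.
move=> /A2P[fh fi]; apply/A2P; split.
  by move=> z Oz; have [d _] := hol_scale c (fh z Oz).
rewrite energyZ // lte_mul_pinfty //; by rewrite lee_fin sqr_ge0.
Qed.

Lemma A2D f g : inA2 f -> inA2 g -> inA2 (fun z => f z + g z).
Proof.
move=> Af Ag; have /A2P[fh fi] := Af; have /A2P[gh gi] := Ag.
have sh : holomorphic_on Om (fun z => f z + g z).
  by move=> z Oz; have [d _] := holD (fh z Oz) (gh z Oz).
apply/A2P; split=> //.
apply: (@le_lt_trans _ _ (2%:E * energy Om f + 2%:E * energy Om g)%E); last first.
  by rewrite (nqE Af) (nqE Ag) -!EFinM -EFinD ltry.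
have m1 := measurable_sq oO fh; have m2 := measurable_sq oO gh.
rewrite -!ge0_integralZl //; last 2 first.
- by move=> x _; rewrite lee_fin sq_ge0.
- by move=> x _; rewrite lee_fin sq_ge0.
rewrite -ge0_integralD //; last 4 first.
- by move=> x _; rewrite mule_ge0 // lee_fin sq_ge0.
- exact: measurable_funeM.
- by move=> x _; rewrite mule_ge0 // lee_fin sq_ge0.
- exact: measurable_funeM.
apply: ge0_le_integral => //.
- by move=> x _; rewrite lee_fin sq_ge0.
- exact: measurable_sq.
- by apply: emeasurable_funD; exact: measurable_funeM.
- by move=> x _; rewrite -!EFinM -EFinD lee_fin sqD_le.
Qed.

Lemma A2_0 : inA2 (fun=> 0).
Proof.
apply/A2P; split; first by move=> z _; have [d _] := hol_cst 0 z.
rewrite (_ : energy _ _ = 0%E) //; apply: integral0_eq => x _.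
by rewrite /sq cabs0 expr0n.
Qed.

Lemma A2B f g : inA2 f -> inA2 g -> inA2 (fun z => f z - g z).
Proof.
move=> Af Ag; have -> : (fun z => f z - g z) = (fun z => f z + (-1) * g z).
  by apply/funext => z; rewrite mulN1r.
exact: A2D Af (A2Z _ Ag).
Qed.

Lemma A2_sum I (s : seq I) (P : pred I) (F : I -> 'rV[C]_n -> C) :
  (forall i, inA2 (F i)) -> inA2 (fun z => \sum_(i <- s | P i) F i z).
Proof.
move=> AF; elim: s => [|i s IH].
  by have -> : (fun z => \sum_(i <- [::] | P i) F i z) = (fun=> 0);
    [apply/funext => z; rewrite big_nil|exact: A2_0].
have -> : (fun z => \sum_(j <- i :: s | P j) F j z) =
    (fun z => (if P i then 1 else 0) * F i z + \sum_(j <- s | P j) F j z).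
  by apply/funext => z; rewrite big_cons; case: (P i); rewrite ?mul1r // mul0r add0r.
exact: A2D (A2Z _ (AF i)) IH.
Qed.

(** Polarisation, by which the integrability of products reduces to that of squares. *)
Lemma Re_dotE (a b : C) : complex.Re (a * b^*)%C = (cabs (a + b) ^+ 2 - cabs a ^+ 2 - cabs b ^+ 2) / 2.
Proof. by rewrite !sqr_cabs ReD ImD ReM; case: a => a1 a2; case: b => b1 b2 /=; field. Qed.

Lemma integrable_rdot f g : inA2 f -> inA2 g ->
  (mu n).-integrable (pre Om) (EFin \o (fun x => complex.Re (f (toCn x) * (g (toCn x))^*)%C)).
Proof.
move=> Af Ag.
apply: (@eq_integrable _ _ _ _ _ mO (fun x => (2^-1)%:E * (((sq (fun w => f w + g w)%R (toCn x))%:E - (sq f (toCn x))%:E)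
    - (sq g (toCn x))%:E))%E).
  by move=> x _; rewrite /= Re_dotE -!EFinD -EFinM mulrC.
apply: (@integrableZl _ _ _ _ _ mO).
apply: integrableB => //; last exact: integrable_sq.
apply: integrableB => //; last exact: integrable_sq.
exact: integrable_sq (A2D Af Ag).
Qed.

Lemma rdotC f g : rdot f g = rdot g f.
Proof.
rewrite !rdotE; apply: eq_Rintegral => x _; move: (f _) (g _) => a b.
by rewrite !Re_dotE [b + a]addrC; congr (_ / _); rewrite addrAC.
Qed.

Lemma rdotDl f g h : inA2 f -> inA2 g -> inA2 h -> rdot (fun z => f z + g z) h = rdot f h + rdot g h.
Proof.
move=> Af Ag Ah; rewrite !rdotE -RintegralD //; last 2 first.
- exact: integrable_rdot.
- exact: integrable_rdot.
by apply: eq_Rintegral => x _; rewrite mulrDl ReD.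
Qed.

Lemma rdotZl (a : R) f g : inA2 f -> inA2 g -> rdot (fun z => a%:C * f z) g = a * rdot f g.
Proof.
move=> Af Ag; rewrite !rdotE -RintegralZl //; last exact: integrable_rdot.
by apply: eq_Rintegral => x _; rewrite -mulrA ReM /= mul0r subr0.
Qed.

Lemma rdot_rotate f g : inA2 f -> inA2 g -> rdot (fun z => 'i * f z) g = - rdot f (fun z => 'i * g z).
Proof.
move=> Af Ag; rewrite -mulN1r !rdotE -RintegralZl //; last exact: integrable_rdot Af (A2Z 'i Ag).
apply: eq_Rintegral => x _; move: (f _) (g _) => [a b] [c d] /=; ring.
Qed.

Lemma rdot_ii f g : rdot (fun z => 'i * f z) (fun z => 'i * g z) = rdot f g.
Proof. by rewrite !rdotE; apply: eq_Rintegral => x _; move: (f _) (g _) => [a b] [c d] /=; ring. Qed.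

Lemma rdot_self f : rdot f f = nq f.
Proof.
rewrite nq_def rdotE /energy /Rintegral; congr fine; apply: eq_integral => x _; congr EFin.
by rewrite /sq sqr_cabs; case: (f _) => a b /=; ring.
Qed.

(** The imaginary part of f conj(g) is the real part of f conj(i g), so the rules for [rdot] yield
    those of the complex inner product. *)
Lemma dot_rdot f g : dot f g = rdot f g +i* rdot f (fun z => 'i * g z).
Proof.
rewrite dotE /L2_dot !rdotE; congr Complex.
by apply: eq_Rintegral => x _; move: (f _) (g _) => [a b] [c d] /=; ring.
Qed.

Lemma dotDl f g h : inA2 f -> inA2 g -> inA2 h -> dot (fun z => f z + g z) h = dot f h + dot g h.
Proof.
move=> Af Ag Ah; have Aih := A2Z 'i Ah.
by rewrite !dot_rdot (rdotDl Af Ag Ah) (rdotDl Af Ag Aih).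
Qed.

Lemma dotC f g : inA2 f -> inA2 g -> dot g f = (dot f g)^*%C.
Proof.
move=> Af Ag; rewrite !dot_rdot; congr Complex; first exact: rdotC.
by rewrite rdotC (rdot_rotate Af Ag).
Qed.

Lemma dotZl c f g : inA2 f -> inA2 g -> dot (fun z => c * f z) g = c * dot f g.
Proof.
case: c => a b Af Ag.
have -> : (fun z => (a +i* b) * f z) = (fun z => a%:C * f z + b%:C * ('i * f z)).
  by apply/funext => z; rewrite mulrA -mulrDl; congr (_ * _); apply: complex_eq => /=; ring.
have Aif := A2Z 'i Af; have Aig := A2Z 'i Ag.
rewrite (dotDl (A2Z _ Af) (A2Z _ Aif) Ag) !dot_rdot.
rewrite (rdotZl a Af Ag) (rdotZl a Af Aig) (rdotZl b Aif Ag) (rdotZl b Aif Aig) (rdot_rotate Af Ag) rdot_ii.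
by apply: complex_eq => /=; ring.
Qed.

Lemma dot_self f : inA2 f -> dot f f = (nq f)%:C.
Proof.
move=> Af; rewrite dot_rdot rdot_self; congr Complex.
rewrite rdotE (@eq_Rintegral _ _ _ _ _ (fun=> 0)); last first.
  by move=> x _; move: (f _) => [a b] /=; ring.
by rewrite /Rintegral integral0.
Qed.

Lemma dotZr c f g : inA2 f -> inA2 g -> dot f (fun z => c * g z) = c^*%C * dot f g.
Proof.
move=> Af Ag; rewrite (dotC (A2Z c Ag) Af) (dotZl c Ag Af) rmorphM.
by congr (_ * _); exact/esym/dotC.
Qed.

Lemma dotDr f g h : inA2 f -> inA2 g -> inA2 h -> dot f (fun z => g z + h z) = dot f g + dot f h.
Proof.
move=> Af Ag Ah; rewrite (dotC (A2D Ag Ah) Af) (dotDl Ag Ah Af) rmorphD.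
by congr (_ + _); exact/esym/dotC.
Qed.

Lemma dotBl f g h : inA2 f -> inA2 g -> inA2 h -> dot (fun z => f z - g z) h = dot f h - dot g h.
Proof.
move=> Af Ag Ah; have -> : (fun z => f z - g z) = (fun z => f z + (-1) * g z).
  by apply/funext => z; rewrite mulN1r.
by rewrite (dotDl Af (A2Z _ Ag) Ah) (dotZl _ Ag Ah) mulN1r.
Qed.

Lemma dot0l g : dot (fun=> 0) g = 0.
Proof.
rewrite dotE /L2_dot; congr Complex; rewrite (@eq_Rintegral _ _ _ _ _ (fun=> 0)).
- by rewrite /Rintegral integral0.
- by move=> x _; rewrite mul0r.
- by rewrite /Rintegral integral0.
- by move=> x _; rewrite mul0r.
Qed.

Lemma dot_suml I (s : seq I) (P : pred I) (F : I -> 'rV[C]_n -> C) g :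
  (forall i, inA2 (F i)) -> inA2 g ->
  dot (fun z => \sum_(i <- s | P i) F i z) g = \sum_(i <- s | P i) dot (F i) g.
Proof.
move=> AF Ag; elim: s => [|i s IH].
  rewrite big_nil -[RHS](dot0l g); congr dot.
  by apply/funext => z; rewrite big_nil.
have -> : (fun z => \sum_(j <- i :: s | P j) F j z) =
    (fun z => (if P i then 1 else 0) * F i z + \sum_(j <- s | P j) F j z).
  by apply/funext => z; rewrite big_cons; case: (P i); rewrite ?mul1r // mul0r add0r.
rewrite (dotDl (A2Z _ (AF i)) (A2_sum s P AF) Ag) (dotZl _ (AF i) Ag) IH.
by rewrite big_cons; case: (P i); rewrite ?mul1r // mul0r add0r.
Qed.

Lemma nqZ c f : inA2 f -> nq (fun z => c * f z) = cabs c ^+ 2 * nq f.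
Proof.
move=> Af; have fh := A2_hol Af.
by rewrite !nq_def energyZ // (nqE Af) -EFinM.
Qed.

Lemma nqD f g : inA2 f -> inA2 g ->
  nq (fun z => f z + g z) = nq f + nq g + 2 * complex.Re (dot f g).
Proof.
move=> Af Ag; rewrite -!rdot_self dot_rdot /=.
rewrite (rdotDl Af Ag (A2D Af Ag)) ![rdot _ (fun z => f z + g z)]rdotC.
rewrite (rdotDl Af Ag Af) (rdotDl Af Ag Ag) (rdotC g f).
by ring.
Qed.

Lemma nqB f g : inA2 f -> inA2 g ->
  nq (fun z => f z - g z) = nq f + nq g - 2 * complex.Re (dot f g).
Proof.
move=> Af Ag; have -> : (fun z => f z - g z) = (fun z => f z + (-1) * g z).
  by apply/funext => z; rewrite mulN1r.
rewrite (nqD Af (A2Z _ Ag)) (nqZ _ Ag) (dotZr _ Af Ag).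
by rewrite cabsN cabs1 expr1n rmorphN rmorph1 mulN1r ReN; ring.
Qed.

Lemma sq_le_nq f z (r : R) : inA2 f -> 0 < r -> (forall w, rn (w - z) <= 2 * r -> Om w) ->
  sq f z <= nq f / vball n r.
Proof.
move=> Af r0 Hr; have fh := A2_hol Af.
have := sub_mean_value_L2 oO fh r0 Hr; rewrite (nqE Af) lee_fin.
by rewrite ler_pdivlMr // vball_gt0.
Qed.

Lemma nq_eq0 f z : inA2 f -> nq f = 0 -> Om z -> f z = 0.
Proof.
move=> Af f0 Oz; have [r r0 Hr] := open_rn oO Oz.
have r40 : 0 < r / 4 by rewrite divr_gt0.
have := @sq_le_nq f z (r / 4) Af r40; rewrite f0 mul0r => h.
have /h : forall w, rn (w - z) <= 2 * (r / 4) -> Om w.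
  by move=> w wr; apply: Hr; apply: le_lt_trans wr _; lra.
rewrite /sq => k; apply/eqP; rewrite -cabs_eq0 -sqrf_eq0.
by rewrite eq_le k sqr_ge0.
Qed.

Lemma cauchy_schwarz f g : inA2 f -> inA2 g -> cabs (dot f g) ^+ 2 <= nq f * nq g.
Proof.
move=> Af Ag.
(* If g has norm 0, it vanishes on [Om] by the bound for point values, and so does the inner
   product; otherwise the norm of |g|^2 f - c g is expanded. *)
have [g0|g0] := eqVneq (nq g) 0.
  have -> : dot f g = 0.
    rewrite (dotC Ag Af) (_ : dot g f = 0) ?conjc0 // -[RHS](dot0l f).
    rewrite !dot_rdot !rdotE; congr Complex; apply: eq_Rintegral => x /set_mem Ox;
    by rewrite (nq_eq0 Ag g0 Ox).
  by rewrite cabs0 expr0n g0 mulr0.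
have gp : 0 < nq g by rewrite lt_neqAle eq_sym g0 nq_ge0.
pose c := dot f g.
have := nq_ge0 (fun z => (nq g)%:C * f z - c * g z).
rewrite (nqB (A2Z _ Af) (A2Z _ Ag)) (nqZ _ Af) (nqZ _ Ag).
rewrite (dotZl _ Af (A2Z _ Ag)) (dotZr _ Af Ag).
rewrite cabs_real ger0_norm ?nq_ge0 // -/c.
have -> : complex.Re ((nq g)%:C * (c^*%C * c)) = nq g * cabs c ^+ 2.
  by rewrite sqr_cabs; case: (c) => a b /=; ring.
move=> h; have : 0 <= nq g * (nq f * nq g - cabs c ^+ 2).
  by apply: le_trans h _; rewrite le_eqVlt; apply/orP; left; apply/eqP; ring.
by rewrite pmulr_rge0 // subr_ge0.
Qed.

End bergman_space.

(** * Completeness of the Bergman space *)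

Section completeness.
Context {R : realType}.
Local Notation C := R[i].
Local Notation mR := (measurableTypeR R).
Local Notation RR := (mR * mR)%type.
Local Notation TT n := (n.-tuple RR).
Local Notation mu n := (lebesgue_measure_Cn R n).
Local Notation pre U := (@toCn R _ @^-1` U).

Definition converges (u : nat -> C) (a : C) :=
  forall e : R, 0 < e -> exists K, forall k, (K <= k)%N -> cabs (u k - a) <= e.

(** One-sided, being applied to nonnegative sequences. *)
Definition vanishes (u : nat -> R) :=
  forall e : R, 0 < e -> exists K, forall k, (K <= k)%N -> u k <= e.

Lemma converges_unique u a b : converges u a -> converges u b -> a = b.
Proof.
move=> ua ub; apply/eqP; rewrite -subr_eq0 -cabs_eq0 eq_le cabs_ge0 andbT.
apply/ler_addgt0Pr => e e0; rewrite add0r; have e20 : 0 < e / 2 by rewrite divr_gt0.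
have [K1 H1] := ua _ e20; have [K2 H2] := ub _ e20.
have := H1 (maxn K1 K2) (leq_maxl _ _); have := H2 (maxn K1 K2) (leq_maxr _ _).
set w := u _ => h2 h1; have -> : a - b = (w - b) - (w - a) by ring.
by rewrite [e]splitr; apply: le_trans (cabsD _ _) _; rewrite cabsN; exact: lerD.
Qed.

Lemma vanishes_of_sqr u a (c : R) (v : nat -> R) : 0 < c -> vanishes v ->
  (forall k, cabs (u k - a) ^+ 2 <= v k / c) -> converges u a.
Proof.
move=> c0 v0 H e e0; have [K HK] := v0 _ (mulr_gt0 (exprn_gt0 2 e0) c0).
exists K => k /HK h; rewrite -(ler_pXn2r (n:=2)) ?nnegrE ?cabs_ge0 ?(ltW e0) //.
by apply: le_trans (H k) _; rewrite ler_pdivrMr.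
Qed.

(** Continuity of the squared modulus from one side, in the form taken by [fatou_le]. *)
Lemma sqr_near (a b : C) (e : R) : 0 < e -> cabs (b - a) <= Num.min 1 (e / (2 * cabs a + 1)) ->
  cabs a ^+ 2 <= cabs b ^+ 2 + e.
Proof.
move=> e0; rewrite le_min => /andP[h1 h2].
have a0 := cabs_ge0 a; have b0 := cabs_ge0 b.
have c0 : 0 < 2 * cabs a + 1 by rewrite ltr_wpDl ?mulr_ge0.
have ab : cabs a <= cabs b + cabs (b - a).
  by have := cabsD (a - b) b; rewrite subrK (cabsB a) addrC.
have [le|lt] := lerP (cabs a) (cabs b).
  by rewrite (le_trans (lerXn2r 2 a0 b0 le)) // lerDl ltW.
rewrite -lerBlDl subr_sqr.
apply: le_trans (_ : e / (2 * cabs a + 1) * (2 * cabs a + 1) <= e); last by rewrite divfK // gt_eqF.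
have h3 : cabs a - cabs b <= e / (2 * cabs a + 1) by apply: le_trans h2; rewrite lerBlDl.
have h4 : cabs a + cabs b <= 2 * cabs a + 1.
  by rewrite mulr_natl mulr2n -addrA lerD2l (le_trans (ltW lt)) // lerDl.
apply: ler_pM => //; first by rewrite subr_ge0 ltW.
exact: addr_ge0.
Qed.

Variables (n : nat) (Om : set 'rV[C]_n).
Hypothesis oO : open Om.
Implicit Types f g h : 'rV[C]_n -> C.
Local Notation inA2 := (inA2 Om).
Local Notation nq := (nq Om).
Local Notation dot := (dot Om).

(** The bound is uniform for w near z, so that convergence in norm is locally uniform. *)
Lemma local_eval_bound z : Om z -> exists r c : R, [/\ 0 < r, 0 < c,
  forall w, rn (w - z) <= r -> Om w & forall f w, inA2 f -> rn (w - z) <= r -> sq f w <= nq f / c].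
Proof.
move=> Oz; have [s s0 Hs] := open_rn oO Oz.
have r0 : 0 < s / 4 by rewrite divr_gt0.
exists (s / 4), (vball n (s / 4)); split=> //.
- exact: vball_gt0.
- by move=> w wz; apply: Hs; apply: le_lt_trans wz _; rewrite ltr_pdivrMr // ltr_pMr // ltr1n.
move=> f w Af wz; apply: (sq_le_nq oO Af r0) => x xw; apply: Hs.
apply: (@le_lt_trans _ _ (s / 4 + 2 * (s / 4))); last by lra.
exact: ball_sub (lexx _) wz xw.
Qed.

Lemma eval_bound z : Om z -> exists2 c : R, 0 < c & forall f, inA2 f -> sq f z <= nq f / c.
Proof.
move=> /local_eval_bound[r [c [r0 c0 _ H]]]; exists c => // f Af; apply: H => //.
by rewrite subrr rn0 ltW.
Qed.

Lemma eval_converges F f z : (forall k, inA2 (F k)) -> inA2 f -> vanishes (fun k => nq (fun w => F k w - f w)) ->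
  Om z -> converges (fun k => F k z) (f z).
Proof.
move=> AF Af H Oz; have [c c0 Hc] := eval_bound Oz.
apply: (vanishes_of_sqr c0 H) => k.
exact: Hc (A2B oO (AF k) Af).
Qed.

Lemma dot_converges F f g : (forall k, inA2 (F k)) -> inA2 f -> inA2 g ->
  vanishes (fun k => nq (fun w => F k w - f w)) -> converges (fun k => dot (F k) g) (dot f g).
Proof.
move=> AF Af Ag H.
have c0 : 0 < (nq g + 1)^-1 by rewrite invr_gt0 ltr_wpDl ?nq_ge0.
apply: (vanishes_of_sqr c0 H) => k; rewrite invrK -(dotBl oO (AF k) Af Ag).
apply: le_trans (cauchy_schwarz oO (A2B oO (AF k) Af) Ag) _.
by apply: ler_wpM2l; [exact: nq_ge0|rewrite lerDl].
Qed.

(** A Cauchy sequence converges locally uniformly, by the bound for point values; the limit is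
    holomorphic by [weierstrass], and Fatou's lemma in the second index shows that it is the limit
    in norm. *)
Lemma A2_complete F : (forall k, inA2 (F k)) ->
  (forall e : R, 0 < e -> exists K, forall k l, (K <= k)%N -> (K <= l)%N -> nq (fun w => F k w - F l w) <= e) ->
  exists2 f, inA2 f & vanishes (fun k => nq (fun w => F k w - f w)).
Proof.
move=> AF HF.
have cauchy_sq c (v : nat -> nat -> R) : 0 < c -> (forall k l, v k l ^+ 2 <= nq (fun w => F k w - F l w) / c) ->
    forall e : R, 0 < e -> exists K, forall k l, (K <= k)%N -> (K <= l)%N -> v k l <= e.
  move=> c0 Hv e e0; have [K HK] := HF _ (mulr_gt0 (exprn_gt0 2 e0) c0).
  exists K => k l Kk Kl; have [//|lt] := lerP (v k l) e.
  have := le_trans (Hv k l) (_ : _ <= e ^+ 2).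
  rewrite ler_pdivrMr // => /(_ (HK k l Kk Kl)).
  by rewrite ler_pXn2r ?nnegrE ?(ltW e0) ?(ltW (lt_trans e0 lt)) // leNgt lt.
have /choice[f Hf] : forall z, exists a, Om z -> converges (fun k => F k z) a.
  move=> z; have [Oz|nOz] := pselect (Om z); last by exists 0.
  have [c c0 Hc] := eval_bound Oz.
  have [a Ha] := @complex_complete R (fun k => F k z) (cauchy_sq c (fun k l => cabs (F k z - F l z)) c0
     (fun k l => Hc _ (A2B oO (AF k) (AF l)))).
  by exists a.
have fh : holomorphic_on Om f.
  move=> z Oz; have [r [c [r0 c0 Hr Hc]]] := local_eval_bound Oz.
  (* [weierstrass] takes a common bound, which is available from K0 on; hence the sequence is
     shifted by K0. *)
  have [K0 HK0] := HF 1 ltr01.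
  pose M := (2 * 1 + 2 * nq (F K0)) / c + 1.
  have nF k : (K0 <= k)%N -> nq (F k) <= 2 * 1 + 2 * nq (F K0).
    move=> Kk; have -> : F k = (fun w => (F k w - F K0 w) + F K0 w) by apply/funext => w; rewrite subrK.
    have AB := A2B oO (AF k) (AF K0).
    rewrite (nqD oO AB (AF K0)).
    have := nq_ge0 Om (fun w => (F k w - F K0 w) - F K0 w); rewrite (nqB oO AB (AF K0)).
    have := HK0 k K0 Kk (leqnn _); lra.
  have unif e : 0 < e -> exists K, forall k w, (K <= k)%N -> rn (w - z) <= r -> cabs (F k w - f w) <= e.
    move=> e0; have [K HK] := HF _ (mulr_gt0 (exprn_gt0 2 e0) c0).
    exists K => k w Kk wr; apply/ler_addgt0Pr => d d0.
    have [L HL] := Hf w (Hr w wr) d d0.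
    pose l := maxn K L; have := HL l (leq_maxr _ _); set b := F l w => h1.
    have -> : F k w - f w = (F k w - b) + (b - f w) by ring.
    apply: le_trans (cabsD _ _) _; apply: lerD h1.
    rewrite -(ler_pXn2r (n:=2)) ?nnegrE ?cabs_ge0 ?(ltW e0) //.
    apply: le_trans (Hc _ w (A2B oO (AF k) (AF l)) wr) _.
    by rewrite ler_pdivrMr //; exact: HK Kk (leq_maxl _ _).
  have [|||//] := @weierstrass R n (fun k => F (K0 + k)%N) f z r M r0.
  - by move=> k w wr; apply: (A2_hol (AF _)); exact: Hr.
  - move=> k w wr; have h := Hc _ w (AF (K0 + k)%N) wr.
    have h2 : sq (F (K0 + k)%N) w <= M - 1.
      apply: le_trans h _; rewrite /M addrK ler_pdivrMr // divfK ?gt_eqF //.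
      exact: nF (leq_addr _ _).
    have [le1|lt1] := lerP (cabs (F (K0 + k)%N w)) 1.
      apply: le_trans le1 _; rewrite /M lerDr divr_ge0 ?(ltW c0) //.
      by rewrite addr_ge0 // mulr_ge0 // nq_ge0.
    apply: (@le_trans _ _ (sq (F (K0 + k)%N) w)); last by apply: le_trans h2 _; rewrite lerBlDr lerDl.
    by rewrite /sq expr2 ler_peMr ?cabs_ge0 // ltW.
  move=> e e0; have [K HK] := unif e e0; exists K => k w Kk wr; apply: HK => //.
  by rewrite (leq_trans Kk) // leq_addl.
have EB e K : 0 < e -> (forall k l, (K <= k)%N -> (K <= l)%N -> nq (fun w => F k w - F l w) <= e) ->
    forall k, (K <= k)%N -> (energy Om (fun w => F k w - f w)%R <= e%:E)%E.
  move=> e0 HK k Kk.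
  have hl l : holomorphic_on Om (fun w => F k w - F l w) := A2_hol (A2B oO (AF k) (AF l)).
  have hk : holomorphic_on Om (fun w => F k w - f w).
    by move=> w Ow; have [d _] := holB (A2_hol (AF k) Ow) (fh w Ow).
  apply: (@fatou_le _ _ _ (mu n) (pre Om) (fun l x => (sq (fun w => F k w - F (K + l)%N w)%R (toCn x))%:E)).
  - exact: measurable_pre.
  - by move=> l; exact: measurable_sq.
  - by move=> l x _; rewrite lee_fin sq_ge0.
  - exact: measurable_sq.
  - by move=> x _; rewrite lee_fin sq_ge0.
  - move=> x Ox d d0; set z := toCn x.
    have m0 : 0 < Num.min 1 (d / (2 * cabs (F k z - f z) + 1)).
      by rewrite lt_min ltr01 divr_gt0 // ltr_wpDl // mulr_ge0 // cabs_ge0.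
    have [L HL] := Hf z Ox _ m0.
    exists L => l Ll; rewrite -EFinD lee_fin /sq; apply: sqr_near => //.
    have -> : F k z - F (K + l)%N z - (F k z - f z) = - (F (K + l)%N z - f z) by ring.
    by rewrite cabsN; apply: HL; rewrite (leq_trans Ll) // leq_addl.
  move=> l; have := HK k (K + l)%N Kk (leq_addr _ _).
  by rewrite -lee_fin -(nqE (A2B oO (AF k) (AF _))).
have [K0 HK0] := HF 1 ltr01.
have AB : inA2 (fun w => F K0 w - f w).
  apply/A2P; split.
    by move=> w Ow; have [d _] := holB (A2_hol (AF K0) Ow) (fh w Ow).
  by apply: le_lt_trans (EB _ _ ltr01 HK0 K0 (leqnn _)) _; rewrite ltry.
have Af : inA2 f.
  (* [f] is recovered as F K0 - (F K0 - f). *)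
  have := A2B oO (AF K0) AB; set g := (X in _ X); have -> : g = f; last by [].
  by apply/funext => w; rewrite /g subKr.
exists f => // e e0; have [K HK] := HF e e0; exists K => k Kk.
by rewrite -lee_fin -(nqE (A2B oO (AF k) Af)); exact: EB e0 HK k Kk.
Qed.

End completeness.

(** * Orthonormal bases *)

Section orthonormal_systems.
Context {R : realType}.
Local Notation C := R[i].
Variables (n : nat) (Om : set 'rV[C]_n).
Hypothesis oO : open Om.
Implicit Types f g h : 'rV[C]_n -> C.
Local Notation inA2 := (inA2 Om).
Local Notation nq := (nq Om).
Local Notation dot := (dot Om).

Definition orthonormal (phi : nat -> 'rV[C]_n -> C) :=
  (forall j, inA2 (phi j)) /\ forall j k, dot (phi j) (phi k) = (j == k)%:R.

Definition proj (phi : nat -> 'rV[C]_n -> C) f N : 'rV[C]_n -> C :=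
  fun z => \sum_(j < N) dot f (phi j) * phi j z.

Section bessel.
Variable phi : nat -> 'rV[C]_n -> C.
Hypothesis ON : orthonormal phi.
Let Aphi j : inA2 (phi j) := ON.1 j.

Lemma proj_A2 f N : inA2 (proj phi f N).
Proof. by apply: (A2_sum oO) => j; exact (A2Z oO _ (Aphi j)). Qed.

Lemma proj_S f N : proj phi f N.+1 = (fun z => proj phi f N z + dot f (phi N) * phi N z).
Proof. by apply/funext => z; rewrite /proj big_ord_recr. Qed.

Lemma proj_0 f : proj phi f 0 = fun=> 0.
Proof. by apply/funext => z; rewrite /proj big_ord0. Qed.

Lemma dot_proj f N k : dot (proj phi f N) (phi k) = if (k < N)%N then dot f (phi k) else 0.
Proof.
elim: N => [|N IH]; first by rewrite proj_0 dot0l.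
rewrite proj_S (dotDl oO (proj_A2 f N) (A2Z oO _ (Aphi N)) (Aphi k)) (dotZl oO _ (Aphi N) (Aphi k)) IH ON.2.
rewrite ltnS; rewrite eq_sym; have [kN|kN|->] := ltngtP k N.
- by rewrite mulr0 addr0.
- by rewrite mulr0 addr0.
- by rewrite add0r mulr1.
Qed.

(** Pythagoras, one basis vector at a time. *)
Lemma nq_sub_proj f N : inA2 f ->
  nq (fun z => f z - proj phi f N z) = nq f - \sum_(j < N) cabs (dot f (phi j)) ^+ 2.
Proof.
move=> Af; elim: N => [|N IH].
  rewrite big_ord0 subr0; congr nq; apply/funext => z; by rewrite proj_0 subr0.
pose g z := f z - proj phi f N z; have Ag : inA2 g := A2B oO Af (proj_A2 f N).
have -> : (fun z => f z - proj phi f N.+1 z) = (fun z => g z - dot f (phi N) * phi N z).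
  by apply/funext => z; rewrite proj_S /g opprD addrA.
rewrite (nqB oO Ag (A2Z oO _ (Aphi N))) (nqZ oO _ (Aphi N)) (dotZr oO _ Ag (Aphi N)).
rewrite IH big_ord_recr /=.
have n1 : nq (phi N) = 1.
  by apply: complexI; rewrite -(dot_self (Aphi N)) ON.2 eqxx.
rewrite (dotBl oO Af (proj_A2 f N) (Aphi N)) dot_proj ltnn subr0 n1 mulr1.
have -> : complex.Re ((dot f (phi N))^*%C * dot f (phi N)) = cabs (dot f (phi N)) ^+ 2.
  by rewrite sqr_cabs; case: (dot _ _) => a b /=; ring.
ring.
Qed.

Lemma bessel f N : inA2 f -> \sum_(j < N) cabs (dot f (phi j)) ^+ 2 <= nq f.
Proof. by move=> Af; rewrite -subr_ge0 -nq_sub_proj // nq_ge0. Qed.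

Lemma proj_proj f M N : (M <= N)%N -> proj phi (proj phi f N) M = proj phi f M.
Proof.
move=> MN; apply/funext => z; apply: eq_bigr => j _.
by rewrite dot_proj (leq_trans (ltn_ord j) MN).
Qed.

Lemma nq_proj f N : nq (proj phi f N) = \sum_(j < N) cabs (dot f (phi j)) ^+ 2.
Proof.
have := nq_sub_proj N (proj_A2 f N); rewrite proj_proj //.
have -> : (fun z => proj phi f N z - proj phi f N z) = (fun=> 0).
  by apply/funext => z; rewrite subrr.
rewrite [X in X = _](_ : _ = 0); last first.
  by apply: complexI; rewrite -(dot_self (A2_0 Om)) dot0l.
move=> /esym/eqP; rewrite subr_eq0 => /eqP ->.
by apply: eq_bigr => j _; rewrite dot_proj ltn_ord.
Qed.

Lemma nq_proj_sub f M N : (M <= N)%N -> nq (fun z => proj phi f N z - proj phi f M z) =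
  \sum_(j < N) cabs (dot f (phi j)) ^+ 2 - \sum_(j < M) cabs (dot f (phi j)) ^+ 2.
Proof.
move=> MN; have := nq_sub_proj M (proj_A2 f N); rewrite proj_proj // nq_proj => ->.
congr (_ - _); apply: eq_bigr => j _; by rewrite dot_proj (leq_trans (ltn_ord j) MN).
Qed.

Lemma nq_subC f g : inA2 f -> inA2 g -> nq (fun z => f z - g z) = nq (fun z => g z - f z).
Proof.
move=> Af Ag; have -> : (fun z => g z - f z) = (fun z => (-1) * (f z - g z)).
  by apply/funext => z; rewrite mulN1r opprB.
by rewrite (nqZ oO _ (A2B oO Af Ag)) cabsN cabs1 expr1n mul1r.
Qed.

Lemma sum_cauchy (a : nat -> R) (B : R) : (forall j, 0 <= a j) -> (forall N, \sum_(j < N) a j <= B) ->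
  forall e : R, 0 < e -> exists K, forall M N, (K <= M)%N -> (M <= N)%N ->
    \sum_(j < N) a j - \sum_(j < M) a j <= e.
Proof.
move=> a0 HB e e0; pose u N := \sum_(j < N) a j.
have nd : nondecreasing_seq u.
  by apply/nondecreasing_seqP => N; rewrite /u big_ord_recr lerDl.
have cu : cvgn u by apply: nondecreasing_is_cvgn => //; exists B => _ [N _ <-]; exact: HB.
have /cvgrPdist_le/(_ e e0)[K _ HK] := cu.
exists K => M N KM MN.
have h1 := nondecreasing_cvgn_le nd cu N.
have := HK M KM; rewrite ler_norml => /andP[_ h2].
by apply: le_trans h2; rewrite lerD2r.
Qed.

(** By Bessel's inequality the Fourier sums form a Cauchy sequence. The limit has the Fourier
    coefficients of [f]; whether it is [f] itself depends on totality. *)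
Lemma proj_limit f : inA2 f -> exists s, [/\ inA2 s, vanishes (fun N => nq (fun z => proj phi f N z - s z)) &
  forall k, dot s (phi k) = dot f (phi k)].
Proof.
move=> Af.
have [|s As Hs] := @A2_complete R n Om oO (proj phi f) (proj_A2 f).
  move=> e e0.
  have [K HK] := sum_cauchy (fun j => sqr_ge0 (cabs (dot f (phi j)))) (fun N => bessel N Af) e0.
  exists K => k l Kk Kl; have [kl|lk] := leqP k l.
    by rewrite (nq_subC (proj_A2 f k) (proj_A2 f l)) (nq_proj_sub f kl) HK.
  by rewrite (nq_proj_sub f (ltnW lk)) HK // ltnW.
exists s; split=> // k.
apply: (@converges_unique R (fun N => dot (proj phi f N) (phi k))).
  exact (dot_converges oO (proj_A2 f) As (Aphi k) Hs).
move=> e e0; exists k.+1 => N kN; rewrite dot_proj kN subrr cabs0; exact: ltW.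
Qed.

End bessel.

Section interpolation.
Variable z_ : nat -> 'rV[C]_n.
Hypothesis Oz_ : forall i, Om (z_ i).

Definition vanishing_space k f := inA2 f /\ forall i, (i < k)%N -> f (z_ i) = 0.

Lemma inf_minimizing (S : set R) : S !=set0 -> (forall x, S x -> 0 <= x) ->
  exists2 d : R, (forall x, S x -> d <= x) & forall e, 0 < e -> exists2 x, S x & x <= d + e.
Proof.
move=> S0 Sge; have hi : has_inf S by split=> //; exists 0 => x /Sge.
exists (inf S); first by move=> x Sx; apply: ge_inf => //; case: hi.
by move=> e e0; have [x Sx xe] := inf_adherent e0 hi; exists x => //; exact: ltW.
Qed.

(** Midpoints of admissible functions are admissible, so the parallelogram law makes a minimising
    sequence Cauchy, and point values pass to the limit. Adding multiples of an h from the next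
    subspace keeps admissibility, and minimality then forces orthogonality to h. *)
Lemma minimal_norm k : (exists2 f, vanishing_space k f & f (z_ k) = 1) ->
  exists e, [/\ vanishing_space k e, e (z_ k) = 1 & forall h, vanishing_space k.+1 h -> dot e h = 0].
Proof.
move=> [f0 Hf0 f01].
pose P f := vanishing_space k f /\ f (z_ k) = 1.
have [||d dmin dinf] := @inf_minimizing [set x | exists2 f, P f & x = nq f].
- by exists (nq f0), f0.
- by move=> _ [f _ ->]; exact: nq_ge0.
have /choice[F HF] : forall N, exists f, P f /\ nq f <= d + N.+1%:R^-1.
  move=> N; have [|x [f Pf ->] h] := dinf N.+1%:R^-1; first by rewrite invr_gt0.
  by exists f.
have AF N : inA2 (F N) := (HF N).1.1.1.
have small e : 0 < e -> exists K, forall N, (K <= N)%N -> (N.+1%:R^-1 : R) <= e.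
  move=> e0; exists (Num.bound e^-1) => N KN; rewrite invf_ple ?posrE ?ltr0n //.
  apply: le_trans (ltW (archi_boundP _)) _; first by rewrite invr_ge0 ltW.
  by rewrite ler_nat (leq_trans KN).
have dle f : P f -> d <= nq f by move=> Pf; apply: dmin; exists f.
have [|e Ae He] := @A2_complete R n Om oO F AF.
  move=> e e0; have e40 : 0 < e / 4 by rewrite divr_gt0.
  have [K HK] := small _ e40; exists K => i j Ki Kj.
  have Pm : P (fun z => 2^-1 * (F i z + F j z)).
    have [[[_ Hi] i1] _] := HF i; have [[[_ Hj] j1] _] := HF j.
    split; last by rewrite i1 j1 -mulr2n -[1 *+ 2]/(2%:R) mulVf // pnatr_eq0.
    split; first exact (A2Z oO _ (A2D oO (AF i) (AF j))).
    by move=> l lk; rewrite Hi // Hj // addr0 mulr0.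
  have := dle _ Pm; rewrite (nqZ oO _ (A2D oO (AF i) (AF j))) (nqD oO (AF i) (AF j)) (nqB oO (AF i) (AF j)).
  have -> : cabs (2^-1 : C) ^+ 2 = 4^-1.
    have -> : (2^-1 : C) = (2^-1 : R)%:C by rewrite fmorphV rmorph_nat.
    by rewrite cabs_real ger0_norm ?invr_ge0 // exprVn; congr (_^-1); ring.
  have := (HF i).2; have := (HF j).2; have := HK i Ki; have := HK j Kj.
  move: (i.+1%:R^-1 : R) (j.+1%:R^-1 : R) (nq _) (nq _) (complex.Re _) => a b x y t; lra.
have eF i a : Om (z_ i) -> (forall N, F N (z_ i) = a) -> e (z_ i) = a.
  move=> Oi Fi; apply: (@converges_unique R (fun N => F N (z_ i))).
    exact (eval_converges oO AF Ae He Oi).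
  by move=> t t0; exists 0%N => N _; rewrite Fi subrr cabs0 ltW.
exists e; split.
- split=> // i ik; apply: eF => // N; exact: (HF N).1.1.2.
- by apply: eF => // N; exact: (HF N).1.2.
move=> h [Ah Hh].
apply: (@converges_unique R (fun N => dot (F N) h)).
  exact (dot_converges oO AF Ae Ah He).
(* With this t one has t |h|^2 <= 1, and comparing F N with F N - t c h gives t |c|^2 <= 1 /
   N.+1. *)
pose t : R := (nq h + 1)^-1; have t0 : 0 < t by rewrite invr_gt0 ltr_wpDl // nq_ge0.
apply: (@vanishes_of_sqr R _ _ t (fun N => N.+1%:R^-1)) => // N.
rewrite subr0; set c := dot (F N) h.
have Pc : P (fun z => F N z - (t%:C * c) * h z).
  have [[[_ HN] N1] _] := HF N; split; last by rewrite N1 Hh // mulr0 subr0.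
  split; first exact (A2B oO (AF N) (A2Z oO _ Ah)).
  by move=> i ik; rewrite HN // Hh ?(ltn_trans ik) // mulr0 subr0.
have := dle _ Pc; rewrite (nqB oO (AF N) (A2Z oO _ Ah)) (nqZ oO _ Ah) (dotZr oO _ (AF N) Ah) -/c.
rewrite cabsM cabs_real exprMn gtr0_norm //.
have -> : complex.Re ((t%:C * c)^*%C * c) = t * cabs c ^+ 2.
  by rewrite sqr_cabs; case: (c) => a b /=; ring.
have := (HF N).2; move: (N.+1%:R^-1 : R) => s h1 h2.
have h3 : cabs c ^+ 2 * (t * (2 - t * nq h)) <= s.
  have -> : cabs c ^+ 2 * (t * (2 - t * nq h)) = 2 * (t * cabs c ^+ 2) - t ^+ 2 * cabs c ^+ 2 * nq h by ring.
  by lra.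
rewrite ler_pdivlMr //; apply: le_trans h3.
apply: ler_wpM2l; first exact: sqr_ge0.
rewrite ler_peMr ?(ltW t0) //.
have : t * nq h <= 1 by rewrite /t mulrC ler_pdivrMr ?mul1r ?lerDl // ltr_wpDl // nq_ge0.
by lra.
Qed.

(** Subtracting from [f] the limit of its Fourier sums leaves a function [g] orthogonal to every
    [e_ k]; it vanishes at all points of the sequence, hence on [Om] by density. *)
Lemma orthonormal_basis_exists :
  (forall k, exists2 f, vanishing_space k f & f (z_ k) = 1) ->
  (forall z (e : R), Om z -> 0 < e -> exists i, rn (z_ i - z) < e) ->
  exists phi, orthonormal_basis Om phi.
Proof.
move=> /(_ _)/minimal_norm Hmin dense.
have /choice[e_ He] : forall k, exists e, [/\ vanishing_space k e, e (z_ k) = 1 & forall h, vanishing_space k.+1 h -> dot e h = 0].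
  by move=> k; exact: Hmin.
have Ae k : inA2 (e_ k) by have [[]] := He k.
have e1 k : e_ k (z_ k) = 1 by have [_ ->] := He k.
have vsub j k h : (j <= k)%N -> vanishing_space k h -> vanishing_space j h.
  by move=> jk [Ah Hh]; split=> // i ij; apply: Hh; exact: leq_trans ij jk.
have nq0 k : 0 < nq (e_ k).
  rewrite lt_neqAle nq_ge0 andbT eq_sym; apply/eqP => h.
  have := nq_eq0 oO (Ae k) h (Oz_ k); rewrite e1 => /eqP.
  by rewrite oner_eq0.
pose s k : R := (Num.sqrt (nq (e_ k)))^-1.
have s0 k : 0 < s k by rewrite invr_gt0 sqrtr_gt0.
pose phi k z := (s k)%:C * e_ k z.
have orth j k : (j < k)%N -> dot (e_ j) (e_ k) = 0.
  by move=> jk; have [_ _] := He j; apply; apply: vsub jk _; have [] := He k.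
have orth2 j k : j != k -> dot (e_ j) (e_ k) = 0.
  rewrite neq_ltn => /orP[/orth //|/orth h].
  by rewrite (dotC oO (Ae k) (Ae j)) h conjc0.
have ON : orthonormal phi.
  split=> [j|j k]; first exact (A2Z oO _ (Ae j)).
  rewrite (dotZl oO _ (Ae j) (A2Z oO _ (Ae k))) (dotZr oO _ (Ae j) (Ae k)) conjc_real.
  have [->|jk] := eqVneq j k; last by rewrite orth2 // !mulr0.
  rewrite (dot_self (Ae k)) mulrA -!rmorphM -expr2 /s exprVn sqr_sqrtr ?nq_ge0 //.
  by rewrite mulVf ?gt_eqF.
exists phi; split.
- by move=> j; rewrite -inA2E; exact: ON.1.
- by move=> j k; rewrite -dotE; exact: ON.2.
rewrite -inA2E -dotE => f Af.
have [t [At Ht dt]] := proj_limit ON Af.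
pose g z := f z - t z; have Ag : inA2 g := A2B oO Af At.
have ge k : dot (e_ k) g = 0.
  have : dot g (phi k) = 0 by rewrite (dotBl oO Af At (ON.1 k)) dt subrr.
  rewrite (dotZr oO _ Ag (Ae k)) conjc_real => /eqP; rewrite mulf_eq0 => /orP[/eqP h|/eqP h].
    have /complexI h2 : (s k)%:C = 0%:C by [].
    by have := s0 k; rewrite h2 ltxx.
  by rewrite (dotC oO Ag (Ae k)) h conjc0.
(* If g is in the k-th subspace, then g - g (z_ k) e_k is in the next one and so orthogonal to e_k;
   as g is orthogonal to e_k too, g (z_ k) |e_k|^2 = 0. *)
have gk k : vanishing_space k g.
  elim: k => [|k IH]; first by split.
  have Hh : vanishing_space k.+1 (fun z => g z - g (z_ k) * e_ k z).
    split; first exact (A2B oO Ag (A2Z oO _ (Ae k))).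
    move=> i; rewrite ltnS leq_eqVlt => /orP[/eqP ->|ik]; first by rewrite e1 mulr1 subrr.
    have [[_ ek] _ _] := He k; by rewrite IH.2 // ek // mulr0 subr0.
  have [_ _ /(_ _ Hh)] := He k.
  rewrite (dotC oO (A2B oO Ag (A2Z oO _ (Ae k))) (Ae k)) (dotBl oO Ag (A2Z oO _ (Ae k)) (Ae k)).
  rewrite (dotC oO (Ae k) Ag) ge (dotZl oO _ (Ae k) (Ae k)) (dot_self (Ae k)) conjc0 sub0r.
  move=> /eqP; rewrite conjc_eq0 oppr_eq0 mulf_eq0 => /orP[/eqP gz|/eqP h]; last first.
    have /complexI h2 : (nq (e_ k))%:C = 0%:C by [].
    by have := nq0 k; rewrite h2 ltxx.
  split=> // i; rewrite ltnS leq_eqVlt => /orP[/eqP -> //|]; exact: IH.2.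
have g0 z : Om z -> g z = 0.
  move=> Oz; apply/eqP; rewrite -cabs_eq0 eq_le cabs_ge0 andbT.
  apply/ler_addgt0Pr => e e0; rewrite add0r.
  have [r r0 Hr] := hol_continuous (A2_hol Ag Oz) e0.
  have [i zi] := dense z r Oz r0.
  have := Hr _ (ltW zi); rewrite (gk i.+1).2 // sub0r cabsN; exact.
have E N : L2_sqnorm Om (fun z => f z - \sum_(j < N) dot f (phi j) * phi j z) =
    (nq (fun z => proj phi f N z - t z))%:E.
  rewrite L2_sqnormE (nq_subC (proj_A2 ON f N) At) -(nqE (A2B oO At (proj_A2 ON f N))).
  apply: eq_energy => z Oz; congr (_ - _).
  by apply/eqP; rewrite -subr_eq0; apply/eqP; exact: g0.
rewrite (_ : (fun N => _) = (fun N => (nq (fun z => proj phi f N z - t z))%:E)); last by apply/funext.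
apply: cvg_EFin; first exact: nearW.
apply/cvgrPdist_le => e e0; have [K HK] := Ht e e0; exists K => // N /= KN.
by rewrite sub0r normrN ger0_norm ?nq_ge0 // HK.
Qed.

End interpolation.

End orthonormal_systems.

(** * Dense sequences of rational points *)

Section rational_points.
Context {R : realType}.
Local Notation C := R[i].

Definition ratpt n (q : {ffun 'I_n -> rat * rat}) : 'rV[C]_n :=
  \row_j (ratr (q j).1 +i* ratr (q j).2).

Lemma ratpt_inj n : injective (@ratpt n).
Proof.
move=> p q /rowP h; apply/ffunP => j; have := h j; rewrite !mxE => -[h1 h2].
by rewrite [LHS]surjective_pairing [RHS]surjective_pairing (fmorph_inj _ h1) (fmorph_inj _ h2).
Qed.

Lemma ratpt_dense n (z : 'rV[C]_n) (e : R) : 0 < e -> exists q, rn (ratpt q - z) < e.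
Proof.
move=> e0; have rat_near (a : R) : exists q : rat, `|ratr q - a| < e / 2.
  have /rat_in_itvoo[q] : a - e / 2 < a + e / 2 by rewrite ltrBlDr -addrA ltrDl -splitr.
  rewrite in_itv /= => /andP[q1 q2]; exists q.
  by rewrite ltr_norml ltrBrDl q1 ltrBlDl q2.
have /choice[q1 Hq1] : forall j, exists q : rat, `|ratr q - complex.Re (z 0 j)| < e / 2.
  by move=> j; exact: rat_near.
have /choice[q2 Hq2] : forall j, exists q : rat, `|ratr q - complex.Im (z 0 j)| < e / 2.
  by move=> j; exact: rat_near.
exists [ffun j => (q1 j, q2 j)]; apply/rn_ltP => // j; rewrite !mxE ffunE.
apply: le_lt_trans (cabs_le _) _; rewrite ReD ImD ReN ImN /= [e]splitr.
exact: ltrD.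
Qed.

(** Interpolation takes distinct points, so the rational points of [Om] are enumerated by a
    bijection from nat, for which they must be infinite in number. *)
Lemma dense_sequence n (Om : set 'rV[C]_n.+1) : open Om -> Om !=set0 ->
  exists z_ : nat -> 'rV[C]_n.+1, [/\ injective z_, forall i, Om (z_ i) &
    forall z (e : R), Om z -> 0 < e -> exists i, rn (z_ i - z) < e].
Proof.
move=> oO [z0 Oz0].
have near_pt z (e : R) : Om z -> 0 < e -> exists2 q, Om (ratpt q) & rn (ratpt q - z) < e.
  move=> Oz e0; have [r r0 Hr] := open_rn oO Oz.
  have [|q] := @ratpt_dense _ z (Num.min r e); first by rewrite lt_min r0.
  by rewrite lt_min => /andP[/Hr Oq qe]; exists q.
pose S : set nat := [set k | exists2 q, Om (ratpt q) & k = pickle q].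
pose pt k : {ffun 'I_n.+1 -> rat * rat} := odflt [ffun=> (0, 0)] (unpickle k).
have ptK q : pt (pickle q) = q by rewrite /pt pickleK.
have cS : countable S by exact: countableP.
have iS : infinite_set S.
  apply/infiniteP/pcard_leP/injfunPex.
  have [q0 Oq0 _] := near_pt z0 1 Oz0 ltr01.
  have [r r0 Hr] := open_rn oO Oq0.
  have /rat_in_itvoo[t] : 0 < r := r0; rewrite in_itv /= => /andP[t0 tr].
  have t0' : 0 < t by rewrite -(ltr0q R).
  (* Infinitely many rational points: the real parts of q0 are shifted by t / k.+1, where t is
     smaller than the radius of a ball about q0 in [Om]. *)
  pose a k : {ffun 'I_n.+1 -> rat * rat} := [ffun j => ((q0 j).1 + t / k.+1%:R, (q0 j).2)].
  have Oa k : Om (ratpt (a k)).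
    apply: Hr; apply/rn_ltP => // j; rewrite !mxE ffunE /=.
    have -> : (ratr ((q0 j).1 + t / k.+1%:R) +i* ratr (q0 j).2) - (ratr (q0 j).1 +i* ratr (q0 j).2)
        = (ratr (t / k.+1%:R) : R)%:C.
      by rewrite rmorphD; apply: complex_eq => /=; ring.
    rewrite cabs_real fmorph_div rmorph_nat ger0_norm; last by apply: divr_ge0 => //; exact: ltW.
    rewrite ltr_pdivrMr ?ltr0n // (lt_le_trans tr) // ler_peMr ?(ltW r0) //.
    by rewrite ler1n.
  exists (fun k => pickle (a k)); first by move=> k _; exists (a k).
  move=> k l _ _ /(pcan_inj pickleK)/ffunP/(_ ord0).
  rewrite !ffunE => -[/addrI/(mulfI (lt0r_neq0 t0'))/invr_inj h].
  by apply/succn_inj/eqP; rewrite -(eqr_nat rat) h.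
have /card_set_bijP[f [fS finj fsurj]] : ([set: nat] #= S)%card.
  by have := eq_card_nat cS iS; rewrite card_eq_sym.
have ptS i : Om (ratpt (pt (f i))) by have [q Oq ->] := fS i Logic.I; rewrite ptK.
exists (fun i => ratpt (pt (f i))); split=> //.
  move=> i j /ratpt_inj; have [q _ fi] := fS i Logic.I; have [p _ fj] := fS j Logic.I.
  by rewrite fi fj !ptK => qp; apply: finj; rewrite ?inE // fi fj qp.
move=> z e Oz e0; have [q Oq qz] := near_pt z e Oz e0.
have [|i _ fi] := fsurj (pickle q); first by exists q.
by exists i; rewrite fi ptK.
Qed.

End rational_points.

(** * Interpolation on bounded domains *)

Section bounded_domains.
Context {R : realType}.
Local Notation C := R[i].
Local Notation mR := (measurableTypeR R).
Local Notation RR := (mR * mR)%type.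
Local Notation TT n := (n.-tuple RR).
Local Notation mu n := (lebesgue_measure_Cn R n).
Local Notation pre U := (@toCn R _ @^-1` U).
Variables (n : nat) (Om : set 'rV[C]_n) (M : R).
Hypotheses (oO : open Om) (bO : forall z, Om z -> rn z <= M).

Lemma energy_bounded (f : 'rV[C]_n -> C) (B : R) : holomorphic_on Om f -> (forall z, Om z -> cabs (f z) <= B) ->
  (energy Om f <= (B ^+ 2 * vball n (`|M| + 1))%:E)%E.
Proof.
move=> fh fB; have M0 : 0 < `|M| + 1 by rewrite ltr_wpDl.
have mB : measurable (@pdball R n (`|M| + 1)) := @measurable_pball R n _.
have mO : measurable (pre Om : set (TT n)) := measurable_pre oO.
have sub : pre Om `<=` @pdball R n (`|M| + 1).
  by move=> x /bO h; apply: le_lt_trans h _; apply: le_lt_trans (ler_norm M) _; rewrite ltrDl.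
apply: (@le_trans _ _ (\int[mu n]_(x in pre Om) (B ^+ 2)%:E)%E).
  apply: ge0_le_integral => //.
  - by move=> x _; rewrite lee_fin sq_ge0.
  - exact: measurable_sq.
  - move=> x Ox; rewrite lee_fin; apply: lerXn2r; rewrite ?nnegrE ?cabs_ge0 ?fB //.
    by apply: le_trans (fB _ Ox); exact: cabs_ge0.
rewrite [X in (_ <= X)%E]EFinM -(mu_pball n M0).
apply: (@le_trans _ _ (\int[mu n]_(x in @pdball R n (`|M| + 1)) (B ^+ 2)%:E)%E).
  by apply: ge0_subset_integral => // x _; rewrite lee_fin sqr_ge0.
by rewrite integral_cst.
Qed.

Lemma bounded_A2 (f : 'rV[C]_n -> C) (B : R) : holomorphic_on Om f -> (forall z, Om z -> cabs (f z) <= B) ->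
  inA2 Om f.
Proof.
move=> fh fB; apply/A2P; split=> //.
by apply: le_lt_trans (energy_bounded fh fB) _; rewrite ltry.
Qed.

(** A product over l < k of affine functions with value 0 at z_ l and 1 at z_ k, each in a
    coordinate where the two points differ; polynomials are bounded on [Om], hence in the Bergman
    space. *)
Lemma interpolating_polynomial (z_ : nat -> 'rV[C]_n) k : injective z_ -> Om (z_ k) ->
  exists2 f, vanishing_space Om z_ k f & f (z_ k) = 1.
Proof.
move=> zinj Ok.
pose good l (f : 'rV[C]_n -> C) := [/\ forall z, differentiable f z, exists B, forall z, Om z -> cabs (f z) <= B,
  forall i, (i < l)%N -> f (z_ i) = 0 & f (z_ k) = 1].
suff : forall l, (l <= k)%N -> exists f, good l f.
  move=> /(_ k (leqnn k))[f [fh [B fB] f0 f1]]; exists f => //; split=> //.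
  by apply: bounded_A2 fB => z _; exact: fh.
elim=> [|l IH] lk.
  exists (fun=> 1); split=> //.
  by exists 1 => z _; rewrite cabs1.
have [f [fh [B fB] f0 f1]] := IH (ltnW lk).
have [j zj] : exists j, z_ k 0 j != z_ l 0 j.
  apply/existsP; rewrite -negb_forall; apply/negP => /forallP h.
  have : k = l by apply: zinj; apply/rowP => j; apply/eqP.
  by move=> kl; rewrite kl ltnn in lk.
pose c := (z_ k 0 j - z_ l 0 j)^-1.
have c0 : c != 0 by rewrite invr_eq0 subr_eq0.
exists (fun z => f z * (c * (z 0 j - z_ l 0 j))); split.
- move=> z; have did : differentiable (fun w : 'rV[C]_n => w) z by exact: (@ex_diff _ _ _ _ _ _ _ (is_diff_id z)).
  have [d1 _] := hol_coord j did; have [d2 _] := hol_cst (z_ l 0 j) z.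
  have [d3 _] := holB d1 d2; have [d4 _] := hol_scale c d3.
  by have [d5 _] := holM (fh z) d4.
- exists (B * (cabs c * (M + cabs (z_ l 0 j)))) => z Oz; rewrite !cabsM.
  apply: ler_pM; rewrite ?mulr_ge0 ?cabs_ge0 ?fB //.
  apply: ler_wpM2l; first exact: cabs_ge0.
  apply: le_trans (cabsD _ _) _; rewrite cabsN lerD2r.
  exact: le_trans (cabs_le_rn z j) (bO Oz).
- move=> i; rewrite ltnS leq_eqVlt => /orP[/eqP ->|il]; first by rewrite subrr !mulr0.
  by rewrite f0 // mul0r.
- by rewrite f1 mul1r /c mulVf // subr_eq0.
Qed.

End bounded_domains.

(** [bergman_basis] is a choice with a default value, so its properties rest on the existence of a
    basis. *)
Lemma bergman_basis_spec (R : realType) n (Om : set 'rV[R[i]]_n.+1) : bounded_domain Om ->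
  orthonormal_basis Om (bergman_basis Om).
Proof.
case=> -[ne oO _] bO; have [M _ HM] := bounded_rn bO.
have [z_ [zinj Oz dense]] := dense_sequence oO ne.
have [|phi Hphi] := @orthonormal_basis_exists R n.+1 Om oO z_ Oz _ dense.
  by move=> k; exact: interpolating_polynomial oO HM _ _ zinj (Oz k).
exact: (xgetPex _ (ex_intro _ phi Hphi)).
Qed.

(** * Point evaluations and their representers *)

Section riesz.
Context {R : realType}.
Local Notation C := R[i].
Variables (n : nat) (Om : set 'rV[C]_n).
Hypothesis oO : open Om.
Implicit Types f g h k : 'rV[C]_n -> C.
Local Notation inA2 := (inA2 Om).
Local Notation nq := (nq Om).
Local Notation dot := (dot Om).

Definition nrm f : R := Num.sqrt (nq f).

Lemma nrm_ge0 f : 0 <= nrm f.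
Proof. exact: sqrtr_ge0. Qed.

Lemma sqr_nrm f : nrm f ^+ 2 = nq f.
Proof. by rewrite sqr_sqrtr // nq_ge0. Qed.

Lemma dot_le f g : inA2 f -> inA2 g -> cabs (dot f g) <= nrm f * nrm g.
Proof.
move=> Af Ag; rewrite -(ler_pXn2r (n:=2)) ?nnegrE ?cabs_ge0 ?mulr_ge0 ?nrm_ge0 //.
by rewrite exprMn !sqr_nrm; exact: cauchy_schwarz.
Qed.

Definition linear_functional (T : ('rV[C]_n -> C) -> C) :=
  (forall f g, inA2 f -> inA2 g -> T (fun z => f z + g z) = T f + T g) /\
  (forall c f, inA2 f -> T (fun z => c * f z) = c * T f).

Definition bounded_functional (T : ('rV[C]_n -> C) -> C) (b : R) :=
  forall f, inA2 f -> cabs (T f) <= b * nrm f.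

Definition represents (T : ('rV[C]_n -> C) -> C) k :=
  inA2 k /\ forall f, inA2 f -> dot f k = T f.

(** The bound for T is tested on k itself, where T k = |k|^2. *)
Lemma represents_bound T k b : 0 <= b -> bounded_functional T b -> represents T k -> nrm k <= b.
Proof.
move=> b0 bT [Ak Tk]; have := bT k Ak; rewrite -Tk // dot_self // cabs_real ger0_norm ?nq_ge0 // -sqr_nrm expr2.
have [->//|k0] := eqVneq (nrm k) 0.
by rewrite ler_pM2r // lt_neqAle eq_sym k0 nrm_ge0.
Qed.

Variable phi : nat -> 'rV[C]_n -> C.
Hypothesis ON : orthonormal Om phi.
Hypothesis total_phi : forall f, inA2 f -> vanishes (fun N => nq (fun z => f z - proj Om phi f N z)).
Let Aphi j : inA2 (phi j) := ON.1 j.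

Lemma dotr_phi f j : inA2 f -> dot (phi j) f = (dot f (phi j))^*%C.
Proof. by move=> Af; exact: dotC. Qed.

Lemma A2_comb (c : nat -> C) N : inA2 (fun z => \sum_(j < N) c j * phi j z).
Proof. by apply: (A2_sum oO) => j; exact (A2Z oO _ (Aphi j)). Qed.

Lemma dot_comb (c : nat -> C) N f : inA2 f ->
  dot (fun z => \sum_(j < N) c j * phi j z) f = \sum_(j < N) c j * dot (phi j) f.
Proof.
move=> Af; rewrite (dot_suml oO (index_enum _) predT (fun i : 'I_N => A2Z oO (c i) (Aphi i)) Af).
by apply: eq_bigr => j _; rewrite (dotZl oO _ (Aphi j) Af).
Qed.

Lemma functional_sum T (c : nat -> C) N : linear_functional T ->
  T (fun z => \sum_(j < N) c j * phi j z) = \sum_(j < N) c j * T (phi j).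
Proof.
move=> [TD TZ]; elim: N => [|N IH].
  have -> : (fun z => \sum_(j < 0) c j * phi j z) = (fun z => 0 * phi 0%N z).
    by apply/funext => z; rewrite big_ord0 mul0r.
  by rewrite TZ // mul0r big_ord0.
have -> : (fun z => \sum_(j < N.+1) c j * phi j z) = (fun z => \sum_(j < N) c j * phi j z + c N * phi N z).
  by apply/funext => z; rewrite big_ord_recr.
by rewrite (TD _ _ (A2_comb c N) (A2Z oO _ (Aphi N))) TZ // IH big_ord_recr.
Qed.

(** The representer is the series with coefficients conj (T phi_j). Its partial sums satisfy T (F N)
    = |F N|^2, so the bound for T gives |F N| <= b and the series converges; totality extends the
    identity from the basis to all f. *)
Lemma riesz T b : linear_functional T -> 0 <= b -> bounded_functional T b -> exists k, represents T k.
Proof.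
move=> linT b0 bT; have [TD TZ] := linT.
pose t j := T (phi j).
pose F N : 'rV[C]_n -> C := fun z => \sum_(j < N) (t j)^*%C * phi j z.
have AF N : inA2 (F N) := A2_comb (fun j => (t j)^*%C) N.
have dF N j : dot (F N) (phi j) = if (j < N)%N then (t j)^*%C else 0.
  have -> : dot (F N) (phi j) = \sum_(i < N) (t i)^*%C * (i == j :> nat)%:R.
    rewrite (dot_comb (fun j => (t j)^*%C) N (Aphi j)).
    by apply: eq_bigr => i _; rewrite ON.2.
  case: ltnP => [jN|Nj].
    rewrite (bigD1 (Ordinal jN)) //= eqxx mulr1 big1 ?addr0 // => i /negPf ij.
    by rewrite -val_eqE /= in ij; rewrite ij mulr0.
  by rewrite big1 // => i _; rewrite ltn_eqF ?mulr0 // (leq_trans (ltn_ord i)).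
have FE N : F N = proj Om phi (F N) N.
  by apply/funext => z; apply: eq_bigr => j _; rewrite dF ltn_ord.
have nF N : nq (F N) = \sum_(j < N) cabs (t j) ^+ 2.
  rewrite {1}FE (nq_proj oO ON); apply: eq_bigr => j _; by rewrite dF ltn_ord cabsJ.
have TF N : T (F N) = (nq (F N))%:C.
  rewrite nF (functional_sum (fun j => (t j)^*%C) N linT) rmorph_sum.
  by apply: eq_bigr => j _; rewrite sqr_cabs /t; case: (T _) => x y; apply: complex_eq => /=; ring.
have bF N : \sum_(j < N) cabs (t j) ^+ 2 <= b ^+ 2.
  have := bT _ (AF N); rewrite TF cabs_real ger0_norm ?nq_ge0 // -nF -sqr_nrm expr2.
  have [->|n0] := eqVneq (nrm (F N)) 0; first by rewrite mulr0 sqr_ge0.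
  have np : 0 < nrm (F N) by rewrite lt_neqAle eq_sym n0 nrm_ge0.
  by rewrite ler_pM2r // => h; rewrite -expr2 lerXn2r // nnegrE ltW.
have FM M N : (M <= N)%N -> F M = proj Om phi (F N) M.
  by move=> MN; apply/funext => z; apply: eq_bigr => j _; rewrite dF (leq_trans (ltn_ord j) MN).
have nFM M N : (M <= N)%N -> nq (fun z => F N z - F M z) =
    \sum_(j < N) cabs (t j) ^+ 2 - \sum_(j < M) cabs (t j) ^+ 2.
  move=> MN; rewrite {1}(FM M N MN) (nq_sub_proj oO ON M (AF N)) nF; congr (_ - _).
  by apply: eq_bigr => j _; rewrite dF (leq_trans (ltn_ord j) MN) cabsJ.
have [|k Ak Hk] := A2_complete oO AF.
  move=> e e0; have [K HK] := sum_cauchy (fun j => sqr_ge0 (cabs (t j))) bF e0.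
  exists K => i l Ki Kl; have [il|li] := leqP i l.
    by rewrite (nq_subC oO (AF i) (AF l)) (nFM _ _ il) HK.
  by rewrite (nFM _ _ (ltnW li)) HK // ltnW.
have dk j : dot (phi j) k = t j.
  rewrite dotr_phi // -[RHS]conjcK; congr (_^*)%C.
  apply: (@converges_unique R (fun N => dot (F N) (phi j))).
    exact (dot_converges oO AF Ak (Aphi j) Hk).
  by move=> e e0; exists j.+1 => N jN; rewrite dF jN subrr cabs0 ltW.
exists k; split=> // f Af.
have Ap N : inA2 (proj Om phi f N) := proj_A2 oO ON f N.
have HpC : vanishes (fun N => nq (fun z => proj Om phi f N z - f z)).
  move=> e e0; have [K HK] := total_phi Af e0; exists K => N KN.
  by rewrite (nq_subC oO (Ap N) Af) HK.
apply: (@converges_unique R (fun N => dot (proj Om phi f N) k)).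
  exact (dot_converges oO Ap Af Ak HpC).
have c0 : 0 < (b ^+ 2 + 1)^-1 by rewrite invr_gt0 ltr_wpDl // sqr_ge0.
apply: (vanishes_of_sqr c0 HpC) => N; rewrite invrK.
have -> : dot (proj Om phi f N) k = T (proj Om phi f N).
  rewrite (functional_sum (fun j => dot f (phi j)) N linT).
  rewrite (dot_comb (fun j => dot f (phi j)) N Ak).
  by apply: eq_bigr => i _; rewrite dk.
have -> : T (proj Om phi f N) - T f = T (fun z => proj Om phi f N z - f z).
  have -> : (fun z => proj Om phi f N z - f z) = (fun z => proj Om phi f N z + (-1) * f z).
    by apply/funext => z; rewrite mulN1r.
  by rewrite (TD _ _ (Ap N) (A2Z oO _ Af)) TZ // mulN1r.
have AB := A2B oO (Ap N) Af.
have h := bT _ AB; have h2 := lerXn2r 2 (cabs_ge0 _) (mulr_ge0 b0 (nrm_ge0 _)) h.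
apply: le_trans h2 _; rewrite exprMn sqr_nrm mulrC; apply: ler_wpM2l; first exact: nq_ge0.
by rewrite lerDl.
Qed.

(** For [k] the representer of evaluation at z, [dot (phi j) k] is phi j z and the series is the one
    that defines the kernel on the diagonal. *)
Lemma parseval k : inA2 k -> converges (fun N => \sum_(j < N) dot (phi j) k * (dot (phi j) k)^*%C) (nq k)%:C.
Proof.
move=> Ak e e0; have [K HK] := total_phi Ak e0; exists K => N /HK.
rewrite (nq_sub_proj oO ON N Ak) => h.
have -> : \sum_(j < N) dot (phi j) k * (dot (phi j) k)^*%C = (\sum_(j < N) cabs (dot k (phi j)) ^+ 2)%:C.
  rewrite rmorph_sum; apply: eq_bigr => j _; rewrite dotr_phi // conjcK sqr_cabs.
  by case: (dot _ _) => x y; apply: complex_eq => /=; ring.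
rewrite cabsB -rmorphB cabs_real ger0_norm // subr_ge0; exact: bessel.
Qed.

End riesz.

(** * Values and derivatives at a point as functionals *)

Section point_functionals.
Context {R : realType}.
Local Notation C := R[i].
Variables (n : nat) (Om : set 'rV[C]_n).
Hypothesis oO : open Om.
Implicit Types f g : 'rV[C]_n -> C.
Local Notation inA2 := (inA2 Om).
Local Notation nq := (nq Om).
Local Notation nrm := (nrm Om).
Local Notation dot := (dot Om).
Local Notation represents := (represents Om).

Definition second_dd f z v h := dd (fun w => dd f w v) z h.

Lemma ev_linear z : linear_functional Om (fun f => f z).
Proof. by split. Qed.

Lemma dd_linear z v : Om z -> linear_functional Om (fun f => dd f z v).
Proof.
move=> Oz; split=> [f g Af Ag|c f Af].
  by have [_ e] := holD (A2_hol Af Oz) (A2_hol Ag Oz); exact: e.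
by have [_ e] := hol_scale c (A2_hol Af Oz); exact: e.
Qed.

Lemma second_dd_linear z v h : Om z -> linear_functional Om (fun f => second_dd f z v h).
Proof.
move=> Oz; have [r r0 Hr] := open_rn oO Oz; split=> [f g Af Ag|c f Af].
  have df := hol_derive_on v oO (A2_hol Af) Oz; have dg := hol_derive_on v oO (A2_hol Ag) Oz.
  have [d e] := holD df dg; rewrite /second_dd -e.
  have [|_ e2] := @hol_near_eq R n _ (fun w => dd (fun z => f z + g z) w v) z r r0 _ d; last by rewrite e2.
  by move=> w /Hr Ow; have [_ e3] := holD (A2_hol Af Ow) (A2_hol Ag Ow); rewrite e3.
have df := hol_derive_on v oO (A2_hol Af) Oz.
have [d e] := hol_scale c df; rewrite /second_dd -e.
have [|_ e2] := @hol_near_eq R n _ (fun w => dd (fun z => c * f z) w v) z r r0 _ d; last by rewrite e2.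
by move=> w /Hr Ow; have [_ e3] := hol_scale c (A2_hol Af Ow); rewrite e3.
Qed.

(** Besides boundedness, the two Taylor remainders quadratic in h make the representers of values
    and of first derivatives differentiable in the point. One constant L serves all the bounds. *)
Lemma functional_bounds z : Om z -> exists r L : R, [/\ 0 < r <= 1, 0 <= L,
  forall w, rn (w - z) <= r -> Om w,
  [/\ forall f, inA2 f -> cabs (f z) <= L * nrm f,
  forall f v, inA2 f -> cabs (dd f z v) <= L * rn v * nrm f &
  forall f h, inA2 f -> rn h <= r -> cabs (f (z + h) - f z - dd f z h) <= L * rn h ^+ 2 * nrm f] &
  (forall f v h, inA2 f -> cabs (second_dd f z v h) <= L * rn v * rn h * nrm f) /\
  (forall f v h, inA2 f -> rn h <= r ->
    cabs (dd f (z + h) v - dd f z v - second_dd f z v h) <= L * rn v * rn h ^+ 2 * nrm f)].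
Proof.
move=> Oz; have [r [c [r0 c0 Hr Hc]]] := local_eval_bound oO Oz.
pose s := (Num.sqrt c)^-1; have s0 : 0 < s by rewrite invr_gt0 sqrtr_gt0.
have bd f w : inA2 f -> rn (w - z) <= r -> cabs (f w) <= s * nrm f.
  move=> Af wz; rewrite -(ler_pXn2r (n:=2)) ?nnegrE ?cabs_ge0 ?mulr_ge0 ?nrm_ge0 ?(ltW s0) //.
  rewrite exprMn sqr_nrm /s exprVn sqr_sqrtr ?(ltW c0) // mulrC; exact: Hc.
have dh f w : inA2 f -> rn (w - z) <= r -> differentiable f w by move=> Af /Hr; exact: A2_hol.
have zz : rn (z - z) <= r / 2 by rewrite subrr rn0 divr_ge0 // ltW.
have b1 f v w : inA2 f -> rn (w - z) <= r / 2 -> cabs (dd f w v) <= 4 * (s * nrm f) / r * rn v.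
  by move=> Af wz; apply: (hol_derive_bound r0 (fun w => dh f w Af) (fun w => bd f w Af)).
have r20 : 0 < r / 2 by rewrite divr_gt0.
have dh2 f v w : inA2 f -> rn (w - z) <= r / 2 -> differentiable (fun w => dd f w v) w.
  move=> Af wz; apply: (hol_derive_on v oO (A2_hol Af)); apply: Hr; apply: le_trans wz _.
  by rewrite ler_pdivrMr // ler_peMr ?ler1n // ltW.
have zz2 : rn (z - z) <= r / 2 / 2 by rewrite subrr rn0 divr_ge0 // ltW.
pose L1 := s; pose L2 := 4 * s / r; pose L3 := 128 * s / r ^+ 2.
pose L4 := 4 * L2 / (r / 2); pose L5 := 128 * L2 / (r / 2) ^+ 2.
have p2 : 0 <= L2 := divr_ge0 (mulr_ge0 (ler0n _ 4) (ltW s0)) (ltW r0).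
have p1 : 0 <= L1 := ltW s0.
have p3 : 0 <= L3 := coef_ge0 128 r (ltW s0).
have p4 : 0 <= L4 := divr_ge0 (mulr_ge0 (ler0n _ 4) p2) (ltW r20).
have p5 : 0 <= L5 := coef_ge0 128 (r / 2) p2.
pose L := L1 + L2 + L3 + L4 + L5.
have [q1 q2 q3] : [/\ L1 <= L, L2 <= L & L3 <= L] by split; rewrite /L; lra.
have [q4 q5] : L4 <= L /\ L5 <= L by split; rewrite /L; lra.
clearbody L.
(* Derivatives are controlled on the radius r / 2, and their Taylor bound takes |h| <= (r / 2) /
   8. *)
pose r' := Num.min 1 (r / 16).
have r'r : r' <= r / 16 by rewrite ge_min lexx orbT.
exists r', L; split.
- by rewrite lt_min ltr01 divr_gt0 //= ge_min lexx.
- exact: le_trans p1 q1.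
- move=> w wz; apply: Hr; apply: le_trans wz (le_trans r'r _).
  by rewrite ler_pdivrMr // ler_peMr ?ler1n // ltW.
- split=> [f Af|f v Af|f h Af hr].
  + apply: le_trans (bd f z Af _) _; first by rewrite subrr rn0 ltW.
    by apply: ler_wpM2r; [exact: nrm_ge0|].
  + apply: le_trans (b1 f v z Af zz) _.
    have -> : 4 * (s * nrm f) / r * rn v = L2 * (rn v * nrm f) by rewrite /L2; ring.
    by rewrite -mulrA; apply: ler_wpM2r => //; rewrite mulr_ge0 ?rn_ge0 ?nrm_ge0.
  + have hr8 : rn h <= r / 8 by apply: le_trans hr (le_trans r'r _); lra.
    apply: le_trans (hol_derive_taylor r0 (fun w => dh f w Af) (fun w => bd f w Af) zz hr8) _.
    have -> : 128 * (s * nrm f) / r ^+ 2 * rn h ^+ 2 = L3 * (rn h ^+ 2 * nrm f) by rewrite /L3; ring.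
    by rewrite -mulrA; apply: ler_wpM2r => //; rewrite mulr_ge0 ?sqr_ge0 ?nrm_ge0.
- split=> [f v h Af|f v h Af hr].
  + apply: le_trans (hol_derive_bound r20 (fun w => dh2 f v w Af) (fun w => b1 f v w Af) h zz2) _.
    have -> : 4 * (4 * (s * nrm f) / r * rn v) / (r / 2) * rn h = L4 * (rn v * rn h * nrm f).
      by rewrite /L4 /L2; ring.
    have -> : L * rn v * rn h * nrm f = L * (rn v * rn h * nrm f) by ring.
    apply: ler_wpM2r => //.
    by rewrite !mulr_ge0 ?rn_ge0 ?nrm_ge0.
  + have hr8 : rn h <= r / 2 / 8 by apply: le_trans hr (le_trans r'r _); lra.
    apply: le_trans (hol_derive_taylor r20 (fun w => dh2 f v w Af) (fun w => b1 f v w Af) zz2 hr8) _.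
    have -> : 128 * (4 * (s * nrm f) / r * rn v) / (r / 2) ^+ 2 * rn h ^+ 2 = L5 * (rn v * rn h ^+ 2 * nrm f).
      by rewrite /L5 /L2; ring.
    have -> : L * rn v * rn h ^+ 2 * nrm f = L * (rn v * rn h ^+ 2 * nrm f) by ring.
    apply: ler_wpM2r => //.
    by rewrite !mulr_ge0 ?rn_ge0 ?nrm_ge0 ?sqr_ge0.
Qed.

Lemma nrmD f g : inA2 f -> inA2 g -> nrm (fun z => f z + g z) <= nrm f + nrm g.
Proof.
move=> Af Ag; rewrite -(ler_pXn2r (n:=2)) ?nnegrE ?addr_ge0 ?nrm_ge0 // sqr_nrm (nqD oO Af Ag).
have := dot_le oO Af Ag; have := le_trans (ler_norm _) (Re_le_cabs (dot f g)).
by rewrite sqrrD !sqr_nrm -mulr_natl; set p := nrm f * _; lra.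
Qed.

(* [r] represents [T2 - T0 - T1], a functional of norm at most [L]. *)
Lemma representer_expansion T0 T1 T2 k0 k1 k2 (L : R) :
  represents T0 k0 -> represents T1 k1 -> represents T2 k2 ->
  0 <= L -> (forall f, inA2 f -> cabs (T2 f - T0 f - T1 f) <= L * nrm f) ->
  exists r, [/\ inA2 r, nrm r <= L & k2 = fun w => k0 w + (k1 w + r w)].
Proof.
move=> [A0 H0] [A1 H1] [A2 H2] L0 HL.
pose r w := k2 w - k0 w - k1 w.
have Ar : inA2 r := A2B oO (A2B oO A2 A0) A1.
exists r; split=> //; last by apply/funext => w; rewrite /r; ring.
apply: (@represents_bound R n Om (fun f => T2 f - T0 f - T1 f)) => //.
split=> // f Af.
have dBr g g' : inA2 g -> inA2 g' -> dot f (fun w => g w - g' w) = dot f g - dot f g'.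
  move=> Ag Ag'; rewrite (dotC oO (A2B oO Ag Ag') Af) (dotBl oO Ag Ag' Af) rmorphB.
  by congr (_ - _); exact/esym/dotC.
by rewrite (dBr _ _ (A2B oO A2 A0) A1) (dBr _ _ A2 A0) H0 // H1 // H2.
Qed.

End point_functionals.

(** * The Bergman metric *)

Section curves.
Context {R : realType}.
Local Notation C := R[i].

Definition cder (u : R -> C) (c : C) := forall e : R, 0 < e -> exists2 r : R, 0 < r &
  forall t, `|t| < r -> cabs (u t - u 0 - t%:C * c) <= e * `|t|.

Lemma cder_Re u c : cder u c -> is_derive (0 : R) 1 (fun t => complex.Re (u t)) (complex.Re c).
Proof.
move=> H; apply: eps_is_derive => e e0; have [r r0 Hr] := H e e0; exists r => // t.
rewrite subr0 => /Hr h; apply: le_trans h; apply: le_trans (Re_le_cabs _).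
by rewrite !ReD !ReN ReM /= mul0r subr0 mulrC.
Qed.

Lemma cder_Im u c : cder u c -> is_derive (0 : R) 1 (fun t => complex.Im (u t)) (complex.Im c).
Proof.
move=> H; apply: eps_is_derive => e e0; have [r r0 Hr] := H e e0; exists r => // t.
rewrite subr0 => /Hr h; apply: le_trans h; apply: le_trans (Im_le_cabs _).
by rewrite !ImD !ImN ImM /= mul0r addr0 mulrC.
Qed.

Lemma cder_intro u c : is_derive (0 : R) 1 (fun t => complex.Re (u t)) (complex.Re c) ->
  is_derive (0 : R) 1 (fun t => complex.Im (u t)) (complex.Im c) -> cder u c.
Proof.
move=> /is_derive_eps Hr /is_derive_eps Hi e e0; have e20 : 0 < e / 2 by rewrite divr_gt0.
have [r1 r10 H1] := Hr _ e20; have [r2 r20 H2] := Hi _ e20.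
exists (Num.min r1 r2); first by rewrite lt_min r10.
move=> t; rewrite lt_min => /andP[t1 t2].
have := H1 t; have := H2 t; rewrite subr0 => /(_ t2) h2 /(_ t1) h1.
apply: le_trans (cabs_le _) _; rewrite !ReD !ImD !ReN !ImN ReM ImM /= !mul0r subr0 addr0.
by rewrite [e]splitr mulrDl; apply: lerD; [move: h1|move: h2]; rewrite [_ * t]mulrC.
Qed.

Lemma cder_quadratic u c (r K : R) : 0 < r -> 0 <= K ->
  (forall t, `|t| < r -> cabs (u t - u 0 - t%:C * c) <= K * t ^+ 2) -> cder u c.
Proof.
move=> r0 K0 H e e0; have K1 : 0 < K + 1 by rewrite ltr_wpDl.
exists (Num.min r (e / (K + 1))); first by rewrite lt_min r0 divr_gt0.
move=> t; rewrite lt_min => /andP[/H h1 h2]; apply: le_trans h1 _.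
rewrite -real_normK ?num_real // expr2 mulrA; apply: ler_wpM2r => //.
have := ltW h2; rewrite ler_pdivlMr // mulrC; apply: le_trans.
by apply: ler_wpM2r => //; rewrite lerDl.
Qed.

Lemma cder_near u w c (r : R) : 0 < r -> (forall t, `|t| < r -> u t = w t) -> cder u c -> cder w c.
Proof.
move=> r0 uw H e e0; have [s s0 Hs] := H e e0.
exists (Num.min r s); first by rewrite lt_min r0.
by move=> t; rewrite lt_min => /andP[tr /Hs]; rewrite !uw // normr0.
Qed.

Lemma cder_real (k : R -> R) (k' : R) : is_derive (0 : R) 1 k k' -> cder (fun t => (k t)%:C) k'%:C.
Proof. by move=> dk; apply: cder_intro => //=; exact: is_derive_cst. Qed.

Lemma cder_ln (k : R -> R) (k' : R) : 0 < k 0 -> cder (fun t => (k t)%:C) k'%:C ->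
  cder (fun t => (ln (k t))%:C) (k' / k 0)%:C.
Proof.
move=> k0 /cder_Re /= dk; apply: cder_real.
have dln := is_derive1_ln k0.
by rewrite mulrC; exact: (is_derive1_comp dln dk).
Qed.

Lemma is_derive_ratio (a k : R -> R) (a' k' : R) : k 0 != 0 -> is_derive (0 : R) 1 a a' -> is_derive (0 : R) 1 k k' ->
  is_derive (0 : R) 1 (fun t => a t / k t) (a' / k 0 - a 0 * k' / k 0 ^+ 2).
Proof.
move=> k0 da dk; have dV := is_deriveV k0 dk.
have dM := is_deriveM da dV.
apply: is_derive_eq dM _ .
by rewrite /GRing.scale /=; field.
Qed.

Lemma cder_ratio u c (k : R -> R) (k' : R) : k 0 != 0 -> cder u c -> cder (fun t => (k t)%:C) k'%:C ->
  cder (fun t => u t / (k t)%:C) (c / (k 0)%:C - u 0 * k'%:C / (k 0)%:C ^+ 2).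
Proof.
move=> k0 du /cder_Re /= dk.
have invE (z : C) (x : R) : complex.Re (z / x%:C) = complex.Re z / x /\ complex.Im (z / x%:C) = complex.Im z / x.
  by rewrite -fmorphV ReM ImM /= !mulr0 subr0 add0r.
apply: cder_intro.
  have -> : (fun t => complex.Re (u t / (k t)%:C)) = (fun t => complex.Re (u t) / k t).
    by apply/funext => t; rewrite (invE _ _).1.
  apply: is_derive_eq (is_derive_ratio k0 (cder_Re du) dk) _.
  by rewrite ReD ReN -rmorphXn (invE _ _).1 (invE _ _).1 ReM /= mulr0 subr0.
have -> : (fun t => complex.Im (u t / (k t)%:C)) = (fun t => complex.Im (u t) / k t).
  by apply/funext => t; rewrite (invE _ _).2.
apply: is_derive_eq (is_derive_ratio k0 (cder_Im du) dk) _.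
by rewrite ImD ImN -rmorphXn (invE _ _).2 (invE _ _).2 ImM /= mulr0 add0r.
Qed.

Lemma real_deriveE n (u : 'rV[C]_n -> C) v z c : cder (fun t => u (z + t%:C *: v)) c -> real_derive v u z = c.
Proof.
move=> du; rewrite /real_derive !derive1E.
have [_ ->] := cder_Re du; have [_ ->] := cder_Im du.
by case: c {du}.
Qed.

(** The real-linear map v |-> A v + B conj(v) takes the value A + B at 1 and i A - i B at i; the two
    operators recover A and B. *)
Lemma wirtingerE n (u : 'rV[C]_n -> C) j z (A B : C) :
  cder (fun t => u (z + t%:C *: delta_mx 0 j)) (A + B) ->
  cder (fun t => u (z + t%:C *: ('i *: delta_mx 0 j))) ('i * A - 'i * B) ->
  wirtinger j u z = A /\ wirtinger_bar j u z = B.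
Proof.
move=> h1 h2; rewrite /wirtinger /wirtinger_bar (real_deriveE h1) (real_deriveE h2).
have ii : 'i * 'i = -1 :> C by rewrite -expr2 sqr_i.
by split; rewrite mulrBr !mulrA ii; field.
Qed.

End curves.

(** * The metric in terms of representers *)

Section metric.
Context {R : realType}.
Local Notation C := R[i].
Variables (n : nat) (Om : set 'rV[C]_n).
Hypothesis oO : open Om.
Hypothesis basis : orthonormal_basis Om (bergman_basis Om).
Hypothesis one_A2 : inA2 Om (fun=> 1).
Implicit Types f g : 'rV[C]_n -> C.
Local Notation inA2 := (inA2 Om).
Local Notation nq := (nq Om).
Local Notation nrm := (nrm Om).
Local Notation dot := (dot Om).
Local Notation represents := (represents Om).
Local Notation phi := (bergman_basis Om).

Let ON : orthonormal Om phi.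
Proof. by have [h1 h2 _] := basis; split=> [j|j k]; rewrite ?inA2E ?dotE. Qed.

Let total f : inA2 f -> vanishes (fun N => nq (fun z => f z - proj Om phi f N z)).
Proof.
move=> Af e e0; have [_ _ h] := basis.
have /h : A2 Om f by rewrite -inA2E.
move=> /fine_cvgP[_ /cvgrPdist_le/(_ e e0)[K _ HK]]; exists K => N KN.
have := HK N KN; rewrite /= sub0r normrN L2_sqnormE -dotE.
rewrite -/(proj Om phi f N).
have E : energy Om (fun z => f z - \sum_(j < N) dot f (phi j) * phi j z) = (nq (fun z => f z - proj Om phi f N z))%:E.
  exact: (nqE (A2B oO Af (proj_A2 oO ON f N))).
by rewrite E /= ger0_norm ?nq_ge0.
Qed.

Lemma ev_represented z : Om z -> exists k, represents (fun f => f z) k.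
Proof.
move=> Oz; have [r [L [_ L0 _ [b _ _] _]]] := functional_bounds oO Oz.
exact: riesz oO _ ON total _ _ (ev_linear Om z) L0 b.
Qed.

Lemma dd_represented z v : Om z -> exists k, represents (fun f => dd f z v) k.
Proof.
move=> Oz; have [r [L [_ L0 _ [_ b _] _]]] := functional_bounds oO Oz.
apply: (riesz oO ON total (dd_linear v Oz) (mulr_ge0 L0 (rn_ge0 v))).
by move=> f; exact: b.
Qed.

Lemma second_dd_represented z v h : Om z -> exists k, represents (fun f => second_dd f z v h) k.
Proof.
move=> Oz; have [r [L [_ L0 _ _ [b _]]]] := functional_bounds oO Oz.
apply: (riesz oO ON total (second_dd_linear oO v h Oz) (mulr_ge0 (mulr_ge0 L0 (rn_ge0 v)) (rn_ge0 h))).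
by move=> f; exact: b.
Qed.

Lemma represents_self T k : represents T k -> T k = (nq k)%:C.
Proof. by move=> [Ak Hk]; rewrite -Hk // dot_self. Qed.

(** The constant 1 takes the value 1 at z, so Cauchy-Schwarz excludes a representer of norm 0. *)
Lemma kernel_gt0 z k : Om z -> represents (fun f => f z) k -> 0 < nq k.
Proof.
move=> Oz [Ak Hk]; rewrite lt_neqAle nq_ge0 andbT eq_sym; apply/eqP => k0.
have := cauchy_schwarz oO one_A2 Ak; rewrite Hk // k0 mulr0 cabs1 expr1n.
by rewrite ler10.
Qed.

Lemma bergman_kernelE z k : represents (fun f => f z) k -> bergman_kernel Om z z = (nq k)%:C.
Proof.
move=> [Ak Hk]; apply/cvg_lim; first exact: norm_hausdorff.
apply/cvgrPdist_le => e e0.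
have Re0 : 0 < complex.Re e by move: e0; rewrite ltcE => /andP[].
have [K HK] := parseval oO ON total Ak Re0; exists K => // N /= KN.
rewrite -[e]RRe_real ?gtr0_real // [`|_|]cabsE lecR cabsB.
have := HK N KN; congr (cabs (_ - _) <= _).
by apply: eq_bigr => j _; rewrite Hk //; exact: ON.1.
Qed.

Lemma kernel_family : exists K : 'rV[C]_n -> 'rV[C]_n -> C, forall z, Om z -> represents (fun f => f z) (K z).
Proof.
have /choice[K HK] : forall z, exists k, Om z -> represents (fun f => f z) k.
  move=> z; have [Oz|nOz] := pselect (Om z); last by exists (fun=> 0).
  by have [k Hk] := ev_represented Oz; exists k.
by exists K.
Qed.

Lemma derivative_family v : exists D : 'rV[C]_n -> 'rV[C]_n -> C,
  forall z, Om z -> represents (fun f => dd f z v) (D z).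
Proof.
have /choice[D HD] : forall z, exists k, Om z -> represents (fun f => dd f z v) k.
  move=> z; have [Oz|nOz] := pselect (Om z); last by exists (fun=> 0).
  by have [k Hk] := dd_represented v Oz; exists k.
by exists D.
Qed.

Variable K : 'rV[C]_n -> 'rV[C]_n -> C.
Hypothesis HK : forall z, Om z -> represents (fun f => f z) (K z).

(** Differentiability in norm at t = 0 of a curve in the Bergman space, with the quadratic remainder
    that the Taylor bounds deliver. *)
Definition first_order (a : R -> 'rV[C]_n -> C) a' := exists s P : R, [/\ 0 < s, 0 <= P, inA2 (a 0), inA2 a' &
  forall t, `|t| < s -> exists r, [/\ inA2 r, nrm r <= P * t ^+ 2 &
    a t = fun w => a 0 w + (t%:C * a' w + r w)]].

Lemma nrmZ c f : inA2 f -> nrm (fun w => c * f w) = cabs c * nrm f.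
Proof.
move=> Af; rewrite /nrm (nqZ oO _ Af) sqrtrM ?sqr_ge0 // sqrtr_sqr ger0_norm //.
exact: cabs_ge0.
Qed.

(** Leibniz rule: after expansion the terms linear in t cancel, and three terms of order t^2 remain,
    bounded by Cauchy-Schwarz. *)
Lemma cder_dot a b a' b' : first_order a a' -> first_order b b' ->
  cder (fun t => dot (a t) (b t)) (dot (a 0) b' + dot a' (b 0)).
Proof.
move=> [s1 [P1 [s10 P10 Aa Aa' Ha]]] [s2 [P2 [s20 P20 Ab Ab' Hb]]].
have n0 := nrm_ge0 Om.
pose Q := nrm b' + P2; have Q0 : 0 <= Q by rewrite addr_ge0.
pose B := nrm (a 0) * P2 + nrm a' * Q + P1 * (nrm (b 0) + Q).
have B0 : 0 <= B by rewrite /B !addr_ge0 // mulr_ge0 // addr_ge0.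
apply: (@cder_quadratic _ _ _ (Num.min 1 (Num.min s1 s2)) B) => //.
  by rewrite !lt_min ltr01 s10.
move=> t; rewrite !lt_min => /andP[t1 /andP[/Ha[x [Ax nx ->]] /Hb[y [Ay ny ->]]]].
pose b1 w := t%:C * b' w + y w; pose a1 w := t%:C * a' w + x w.
have Ab1 : inA2 b1 := A2D oO (A2Z oO _ Ab') Ay.
have Aa1 : inA2 a1 := A2D oO (A2Z oO _ Aa') Ax.
have Abb : inA2 (fun w => b 0 w + b1 w) := A2D oO Ab Ab1.
have E : dot (fun w => a 0 w + (t%:C * a' w + x w)) (fun w => b 0 w + (t%:C * b' w + y w)) -
    dot (fun w => a 0 w) (fun w => b 0 w) - t%:C * (dot (a 0) b' + dot a' (b 0)) =
    dot (a 0) y + t%:C * dot a' b1 + dot x (fun w => b 0 w + b1 w).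
  rewrite (dotDl oO Aa Aa1 Abb) (dotDl oO (A2Z oO _ Aa') Ax Abb) (dotZl oO _ Aa' Abb).
  rewrite (dotDr oO Aa Ab Ab1) (dotDr oO Aa (A2Z oO _ Ab') Ay) (dotZr oO _ Aa Ab').
  rewrite (dotDr oO Aa' Ab Ab1) conjc_real.
  by ring.
have tn : 0 <= `|t| by exact: normr_ge0.
have t2 : t ^+ 2 = `|t| * `|t| by rewrite -expr2 real_normK ?num_real.
have nb1 : nrm b1 <= `|t| * Q.
  apply: le_trans (nrmD oO (A2Z oO _ Ab') Ay) _; rewrite (nrmZ _ Ab') cabs_real mulrDr lerD2l.
  apply: le_trans ny _; rewrite t2 mulrA mulrC ler_wpM2l //.
  by rewrite ler_piMr // ltW.
have nbb : nrm (fun w => b 0 w + b1 w) <= nrm (b 0) + Q.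
  apply: le_trans (nrmD oO Ab Ab1) _; rewrite lerD2l; apply: le_trans nb1 _.
  by rewrite ler_piMl // ltW.
rewrite E; have -> : B * t ^+ 2 = nrm (a 0) * (P2 * t ^+ 2) + `|t| * (nrm a' * (`|t| * Q)) +
    P1 * t ^+ 2 * (nrm (b 0) + Q) by rewrite /B t2; ring.
apply: le_trans (cabsD _ _) _; apply: lerD; first (apply: le_trans (cabsD _ _) _; apply: lerD).
- by apply: le_trans (dot_le oO Aa Ay) _; apply: ler_wpM2l.
- rewrite cabsM cabs_real; apply: ler_wpM2l => //.
  by apply: le_trans (dot_le oO Aa' Ab1) _; apply: ler_wpM2l.
- by apply: le_trans (dot_le oO Ax Abb) _; apply: ler_pM.
Qed.

(** Representers depend conjugate-linearly on the functional; with a real factor the conjugation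
    disappears, which is why the curves have a real parameter. *)
Lemma represents_scale T k (t : R) : represents T k -> represents (fun f => t%:C * T f) (fun w => t%:C * k w).
Proof.
move=> [Ak Hk]; split; first exact (A2Z oO _ Ak).
by move=> f Af; rewrite (dotZr oO _ Af Ak) conjc_real Hk.
Qed.

Lemma dd_real_scale f w (t : R) v : dd f w (t%:C *: v) = t%:C * dd f w v.
Proof. exact: ddZ. Qed.

(** The remainder of the functionals has norm at most P t^2, and [representer_expansion] converts it
    into the remainder of their representers. *)
Lemma first_order_of (T : R -> ('rV[C]_n -> C) -> C) T' a a' (s P : R) : 0 < s -> 0 <= P ->
  represents (T 0) (a 0) -> represents T' a' ->
  (forall t, `|t| < s -> represents (T t) (a t)) ->
  (forall t f, `|t| < s -> inA2 f -> cabs (T t f - T 0 f - t%:C * T' f) <= P * t ^+ 2 * nrm f) ->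
  first_order a a'.
Proof.
move=> s0 P0 H0 H' Ht HT; exists s, P; split=> //; [by case: H0|by case: H'|].
move=> t ts; have Pt : 0 <= P * t ^+ 2 by rewrite mulr_ge0 // sqr_ge0.
exact: (representer_expansion oO H0 (represents_scale t H') (Ht t ts) Pt (fun f => HT t f ts)).
Qed.

Lemma small_time (r V : R) : 0 < r -> 0 <= V -> exists2 s : R, 0 < s & forall t : R, `|t| < s -> `|t| * V <= r.
Proof.
move=> r0 V0; exists (r / (V + 1)); first by rewrite divr_gt0 // ltr_wpDl.
move=> t; rewrite ltr_pdivlMr ?ltr_wpDl // => h; apply: le_trans (ltW h).
by apply: ler_wpM2l => //; rewrite lerDl.
Qed.

Lemma rn_line (z u : 'rV[C]_n) (t : R) : rn (z + t%:C *: u - z) = `|t| * rn u.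
Proof. by rewrite addrC addKr rnZ cabs_real. Qed.

Lemma line0 (z u : 'rV[C]_n) : z + (0 : R)%:C *: u = z.
Proof. by rewrite scale0r addr0. Qed.

Lemma first_order_kernel z u d : Om z -> represents (fun f => dd f z u) d ->
  first_order (fun t => K (z + t%:C *: u)) d.
Proof.
move=> Oz Hd; have [r [L [/andP[r0 r1] L0 Hr [_ b1 b2] _]]] := functional_bounds oO Oz.
have [s s0 Hs] := small_time r0 (rn_ge0 u).
apply: (@first_order_of (fun t f => f (z + t%:C *: u)) (fun f => dd f z u) _ _ s (L * rn u ^+ 2)) => //.
- by rewrite mulr_ge0 // exprn_ge0 // rn_ge0.
- by rewrite line0; exact: HK.
- by move=> t ts; apply: HK; apply: Hr; rewrite rn_line; exact: Hs.
move=> t f ts Af; rewrite line0 -dd_real_scale.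
apply: le_trans (b2 f _ Af _) _; first by rewrite rnZ cabs_real; exact: Hs.
have -> : rn (t%:C *: u) ^+ 2 = rn u ^+ 2 * t ^+ 2.
  by rewrite rnZ cabs_real exprMn real_normK ?num_real // mulrC.
by rewrite mulrA.
Qed.

Lemma first_order_derivative z v u x D : Om z -> (forall w, Om w -> represents (fun f => dd f w v) (D w)) ->
  represents (fun f => second_dd f z v u) x -> first_order (fun t => D (z + t%:C *: u)) x.
Proof.
move=> Oz HD Hx; have [r [L [/andP[r0 r1] L0 Hr _ [_ b]]]] := functional_bounds oO Oz.
have [s s0 Hs] := small_time r0 (rn_ge0 u).
apply: (@first_order_of (fun t f => dd f (z + t%:C *: u) v) (fun f => second_dd f z v u) _ _ s (L * rn v * rn u ^+ 2)) => //.
- by rewrite !mulr_ge0 ?exprn_ge0 // rn_ge0.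
- by rewrite line0; exact: HD.
- by move=> t ts; apply: HD; apply: Hr; rewrite rn_line; exact: Hs.
move=> t f ts Af; rewrite line0.
have -> : t%:C * second_dd f z v u = second_dd f z v (t%:C *: u) by rewrite /second_dd ddZ.
apply: le_trans (b f v _ Af _) _; first by rewrite rnZ cabs_real; exact: Hs.
have -> : rn (t%:C *: u) ^+ 2 = rn u ^+ 2 * t ^+ 2.
  by rewrite rnZ cabs_real exprMn real_normK ?num_real // mulrC.
by rewrite mulrA.
Qed.

Lemma cder_kernel z u : Om z ->
  cder (fun t => (nq (K (z + t%:C *: u)))%:C) (2 * complex.Re (dd (K z) z u))%:C.
Proof.
move=> Oz; have [d Hd] := dd_represented u Oz; have [Ad Hd'] := Hd; have [Ak _] := HK Oz.
have fo := first_order_kernel Oz Hd.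
have [r r0 Hr] := open_rn oO Oz.
have [s s0 Hs] := small_time (divr_gt0 r0 (ltr0n R 2)) (rn_ge0 u).
have := cder_dot fo fo; rewrite line0 (dotC oO Ak Ad) Hd' //.
have -> : dd (K z) z u + (dd (K z) z u)^*%C = (2 * complex.Re (dd (K z) z u))%:C.
  by case: (dd _ _ _) => x y; apply: complex_eq => /=; ring.
apply: cder_near s0 _ => t ts; rewrite dot_self //.
have Ow : Om (z + t%:C *: u).
  by apply: Hr; rewrite rn_line; apply: le_lt_trans (Hs t ts) _; rewrite ltr_pdivrMr // ltr_pMr // ltr1n.
by have [] := HK Ow.
Qed.

(** Leibniz rule for a pairing that equals conj (d_v k_w (w)). The first term is complex-linear in u
    and the second conjugate-linear, the shape that [wirtingerE] separates. *)
Lemma cder_pairing z v u D : Om z -> (forall w, Om w -> represents (fun f => dd f w v) (D w)) ->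
  cder (fun t => dot (D (z + t%:C *: u)) (K (z + t%:C *: u)))
    (dd (D z) z u + (second_dd (K z) z v u)^*%C).
Proof.
move=> Oz HD; have [d Hd] := dd_represented u Oz; have [x Hx] := second_dd_represented v u Oz.
have [Ad Hd'] := Hd; have [Ax Hx'] := Hx; have [Ak _] := HK Oz; have [AD _] := HD z Oz.
have := cder_dot (first_order_derivative Oz HD Hx) (first_order_kernel Oz Hd).
by rewrite !line0 Hd' // (dotC oO Ak Ax) Hx'.
Qed.

Let log_kernel (w : 'rV[C]_n) : C := (ln (complex.Re (bergman_kernel Om w w)))%:C.

Lemma line_in z u : Om z -> exists2 s : R, 0 < s & forall t, `|t| < s -> Om (z + t%:C *: u).
Proof.
move=> Oz; have [r r0 Hr] := open_rn oO Oz.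
have [s s0 Hs] := small_time (divr_gt0 r0 (ltr0n R 2)) (rn_ge0 u).
exists s => // t ts; apply: Hr; rewrite rn_line; apply: le_lt_trans (Hs t ts) _.
by rewrite ltr_pdivrMr // ltr_pMr // ltr1n.
Qed.

Lemma cder_log_kernel z u : Om z ->
  cder (fun t => log_kernel (z + t%:C *: u)) (2 * complex.Re (dd (K z) z u) / nq (K z))%:C.
Proof.
move=> Oz; have [s s0 Hs] := line_in u Oz.
have := @cder_ln R (fun t => nq (K (z + t%:C *: u))) _ _ (cder_kernel u Oz).
rewrite line0 => /(_ (kernel_gt0 Oz (HK Oz))).
by apply: cder_near s0 _ => t ts; rewrite /log_kernel (bergman_kernelE (HK (Hs t ts))).
Qed.

(** Along u the logarithm has derivative c + conj(c) with c = d_u k_z (z) / |k_z|^2 linear in u; the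
    operator selects the conjugate half. *)
Lemma wirtinger_bar_log_kernel z j : Om z ->
  wirtinger_bar j log_kernel z = (dd (K z) z (delta_mx 0 j))^*%C / (nq (K z))%:C.
Proof.
move=> Oz; pose c := dd (K z) z (delta_mx 0 j) / (nq (K z))%:C.
suff [_ ->] : wirtinger j log_kernel z = c /\ wirtinger_bar j log_kernel z = c^*%C.
  by rewrite /c rmorphM -fmorphV; congr (_ * _); exact: conjc_real.
apply: wirtingerE.
  have -> : c + c^*%C = (2 * complex.Re (dd (K z) z (delta_mx 0 j)) / nq (K z))%:C.
    rewrite /c -fmorphV; case: (dd _ _ _) => x y; apply: complex_eq => /=; ring.
  exact: cder_log_kernel.
have -> : 'i * c - 'i * c^*%C = (2 * complex.Re (dd (K z) z ('i *: delta_mx 0 j)) / nq (K z))%:C.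
  rewrite ddZ /c -fmorphV; case: (dd _ _ _) => x y; apply: complex_eq => /=; ring.
exact: cder_log_kernel.
Qed.

(** The second derivative of the kernel function occurs in the conjugate-linear part [B], which the
    outer operator removes. *)
Lemma wirtinger_wirtinger_bar z i j D : Om z ->
  (forall w, Om w -> represents (fun f => dd f w (delta_mx 0 j)) (D w)) ->
  wirtinger i (wirtinger_bar j log_kernel) z = dd (D z) z (delta_mx 0 i) / (nq (K z))%:C -
    dot (D z) (K z) * dd (K z) z (delta_mx 0 i) / (nq (K z))%:C ^+ 2.
Proof.
move=> Oz HD; pose v : 'rV[C]_n := delta_mx 0 j.
have k0 : nq (K z) != 0 by rewrite gt_eqF // (kernel_gt0 Oz (HK Oz)).
have step u : cder (fun t => wirtinger_bar j log_kernel (z + t%:C *: u))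
    ((dd (D z) z u + (second_dd (K z) z v u)^*%C) / (nq (K z))%:C -
     dot (D z) (K z) * (2 * complex.Re (dd (K z) z u))%:C / (nq (K z))%:C ^+ 2).
  have [s s0 Hs] := line_in u Oz.
  (* Near z the inner derivative is dot (D w) (K w) / nq (K w), so the quotient rule applies. *)
  have := @cder_ratio R _ _ (fun t => nq (K (z + t%:C *: u))) _ _ (cder_pairing u Oz HD) (cder_kernel u Oz).
  rewrite !line0 => /(_ k0); apply: cder_near s0 _ => t ts.
  have Ow := Hs t ts; rewrite (wirtinger_bar_log_kernel j Ow).
  have [Ak _] := HK Ow; have [AD HD'] := HD _ Ow.
  by rewrite (dotC oO Ak AD) HD'.
pose e := delta_mx 0 i : 'rV[C]_n.
pose p := dd (K z) z e; pose k := (nq (K z))%:C : C.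
pose B := (second_dd (K z) z v e)^*%C / k - dot (D z) (K z) * p^*%C / k ^+ 2.
have [] := @wirtingerE R n (wirtinger_bar j log_kernel) i z
  (dd (D z) z e / k - dot (D z) (K z) * p / k ^+ 2) B.
- have -> : dd (D z) z e / k - dot (D z) (K z) * p / k ^+ 2 + B =
    (dd (D z) z e + (second_dd (K z) z v e)^*%C) / k - dot (D z) (K z) * (2 * complex.Re p)%:C / k ^+ 2.
    have -> : (2 * complex.Re p)%:C = p + p^*%C by case: (p) => x y; apply: complex_eq => /=; ring.
    by rewrite /B; ring.
  exact: step.
- have := step ('i *: e); rewrite -/k !ddZ /second_dd ddZ -/(second_dd (K z) z v e) -/p.
  congr cder.
  have -> : (2 * complex.Re ('i * p))%:C = 'i * p - 'i * p^*%C.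
    by case: (p) => x y; apply: complex_eq => /=; ring.
  have -> : ('i * second_dd (K z) z v e)^*%C = - ('i * (second_dd (K z) z v e)^*%C).
    by case: (second_dd _ _ _ _) => x y; apply: complex_eq => /=; ring.
  by rewrite /B; ring.
by [].
Qed.

Lemma bergman_metricE z X d : Om z -> represents (fun f => dd f z X) d ->
  bergman_metric Om z X X = (nq d / nq (K z) - cabs (dot d (K z)) ^+ 2 / nq (K z) ^+ 2)%:C.
Proof.
move=> Oz Hd; have [Ad Hd'] := Hd; have [Ak Hk] := HK Oz.
have /choice[D HD] : forall j, exists D : 'rV[C]_n -> 'rV[C]_n -> C,
    forall w, Om w -> represents (fun f => dd f w (delta_mx 0 j : 'rV[C]_n)) (D w).
  by move=> j; exact: derivative_family.
pose k := (nq (K z))%:C : C.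
have expand f : \sum_j X 0 j * dd f z (delta_mx 0 j) = dd f z X.
  rewrite [X in RHS]matrix_sum_delta big_ord1 dd_sum; apply: eq_bigr => j _.
  by rewrite ddZ.
have expandC f : \sum_j (X 0 j)^*%C * (dd f z (delta_mx 0 j))^*%C = (dd f z X)^*%C.
  by rewrite -expand rmorph_sum; apply: eq_bigr => j _; rewrite rmorphM.
rewrite /bergman_metric exchange_big /=.
(* The sum over i assembles the derivative along X; the sum over j carries conjugate coefficients
   and is assembled next, after exchanging the arguments of the inner products. *)
transitivity (\sum_j (X 0 j)^*%C * (dot (D j z) d / k - dot (D j z) (K z) * dot (K z) d / k ^+ 2)).
  apply: eq_bigr => j _; have [AD _] := HD j z Oz.
  rewrite (Hd' _ AD) (Hd' _ Ak) -!expand !mulr_suml mulr_sumr !mulr_suml -sumrB mulr_sumr.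
  apply: eq_bigr => i _; rewrite (wirtinger_wirtinger_bar i Oz (HD j)) -/k.
  by ring.
transitivity ((dd d z X)^*%C / k - (dd (K z) z X)^*%C * dot (K z) d / k ^+ 2).
  rewrite -!expandC !mulr_suml -sumrB; apply: eq_bigr => j _; have [AD HD'] := HD j z Oz.
  rewrite -(HD' _ Ad) -(HD' _ Ak) -(dotC oO Ad AD) -(dotC oO Ak AD); ring.
rewrite (represents_self Hd) -(Hd' _ Ak) conjc_real (dotC oO Ad Ak) conjcK.
rewrite /k rmorphB !rmorphM /= !fmorphV !rmorphXn /=; congr (_ - _ / _).
rewrite -rmorphM -expr2 sqr_cabs; case: (dot _ _) => x y; apply: complex_eq => /=; ring.
Qed.

End metric.

(** * Lower and upper bounds for the metric *)

Section comparison.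
Context {R : realType}.
Local Notation C := R[i].
Local Notation mR := (measurableTypeR R).
Local Notation RR := (mR * mR)%type.
Local Notation TT n := (n.-tuple RR).
Local Notation pre U := (@toCn R _ @^-1` U).

Lemma dd_comp n m (f : 'rV[C]_m -> C) (g : 'rV[C]_n -> 'rV[C]_m) z v : differentiable g z ->
  differentiable f (g z) -> dd (f \o g) z v = dd f (g z) ('d g z v).
Proof.
move=> dg df; have E := diff_comp dg df.
by rewrite !ddE; exact: (congr1 (fun h => h v) E).
Qed.

Lemma diff_comp_apply n m l (f : 'rV[C]_m -> 'rV[C]_l) (g : 'rV[C]_n -> 'rV[C]_m) z v : differentiable g z ->
  differentiable f (g z) -> 'd f (g z) ('d g z v) = 'd (f \o g) z v.
Proof. by move=> dg df; rewrite !diff_Jmx -mulmxA -(Jmx_comp dg df). Qed.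

Lemma bounded_domain_one n (Om : set 'rV[C]_n) : bounded_domain Om -> inA2 Om (fun=> 1).
Proof.
case=> -[_ oO _] bO; have [M _ HM] := bounded_rn bO.
apply: (bounded_A2 oO HM (B := 1)) => [z _|z _]; last by rewrite cabs1.
by have [d _] := hol_cst 1 z.
Qed.

(* [e] is the component orthogonal to the kernel function [k] of the representer of the
   derivative at [z] along [X]. *)
Lemma bergman_metric_extremal n (Om : set 'rV[C]_n.+1) z X : bounded_domain Om -> Om z ->
  exists e k, [/\ inA2 Om e, represents Om (fun f => f z) k /\ 0 < nq Om k, e z = 0,
    (forall f, inA2 Om f -> f z = 0 -> dot Om f e = dd f z X) &
    bergman_metric Om z X X = (nq Om e / nq Om k)%:C].
Proof.
move=> bO Oz; have basis := bergman_basis_spec bO; have A1 := bounded_domain_one bO.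
have oO : open Om by case: bO => -[].
have [K HK] := kernel_family oO basis.
have [d Hd] := dd_represented oO basis X Oz.
have [Ad Hd'] := Hd; have [Ak Hk] := HK z Oz.
have k0 := kernel_gt0 oO A1 Oz (HK z Oz).
pose k := K z; pose c := dot Om d k / (nq Om k)%:C.
have kC : (nq Om k)%:C != 0 :> C by apply/eqP => /complexI h; move: k0; rewrite -/k h ltxx.
have Ack := A2Z oO c Ak.
pose e w := d w - c * k w; have Ae : inA2 Om e := A2B oO Ad Ack.
have ek : dot Om e k = 0.
  by rewrite (dotBl oO Ad Ack Ak) (dotZl oO c Ak Ak) (dot_self Ak) /c divfK // subrr.
exists e, k; split=> //.
- by rewrite -(Hk _ Ae).
- move=> f Af fz; rewrite (dotC oO Ae Af) (dotBl oO Ad Ack Af) (dotZl oO c Ak Af).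
  have -> : dot Om k f = 0 by rewrite (dotC oO Af Ak) (Hk _ Af) fz conjc0.
  by rewrite mulr0 subr0 -(dotC oO Ad Af) Hd'.
rewrite (bergman_metricE oO basis A1 HK Oz Hd) -/k; congr (_%:C).
have -> : nq Om d = nq Om e + cabs c ^+ 2 * nq Om k.
  have {1}-> : d = (fun w => e w + c * k w) by apply/funext => w; rewrite /e subrK.
  by rewrite (nqD oO Ae Ack) (nqZ oO c Ak) (dotZr oO c Ae Ak) ek mulr0 mulr0 addr0.
rewrite /c cabsM cabsV cabs_real gtr0_norm //.
by field; rewrite gt_eqF.
Qed.

Lemma schwarz_metric n (Om : set 'rV[C]_n.+1) z X (h : 'rV[C]_n.+1 -> C) : bounded_domain Om -> Om z ->
  holomorphic_on Om h -> (forall w, Om w -> cabs (h w) <= 1) -> h z = 0 ->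
  (cabs (dd h z X) ^+ 2)%:C <= bergman_metric Om z X X.
Proof.
move=> bO Oz hh h1 hz.
have oO : open Om by case: bO => -[].
have [e [k [Ae [Hk k0] ez He ->]]] := bergman_metric_extremal X bO Oz.
have [Ak _] := Hk; have kz := represents_self Hk.
pose f w := h w * k w.
have fh : holomorphic_on Om f.
  by move=> w Ow; have [d _] := holM (hh w Ow) (A2_hol Ak Ow).
have fE : (energy Om f <= (nq Om k)%:E)%E.
  rewrite -(nqE Ak); apply: ge0_le_integral => //.
  - exact: measurable_pre.
  - by move=> x _; rewrite lee_fin sq_ge0.
  - exact: measurable_sq.
  - exact: measurable_sq oO (A2_hol Ak).
  - move=> x Ox; rewrite lee_fin /sq /f cabsM; apply: lerXn2r; rewrite ?nnegrE ?mulr_ge0 ?cabs_ge0 //.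
    by rewrite ler_piMl ?cabs_ge0 // h1.
have Af : inA2 Om f by apply/A2P; split=> //; apply: le_lt_trans fE _; rewrite ltry.
have fk : nq Om f <= nq Om k by rewrite -lee_fin -(nqE Af).
have fz : f z = 0 by rewrite /f hz mul0r.
have df : dd f z X = dd h z X * (nq Om k)%:C.
  have [_ ->] := holM (hh z Oz) (A2_hol Ak Oz).
  by rewrite hz mul0r kz ?add0r ?addr0 // mulrC.
(* The pairing of f with e is d_X f (z) = d_X h (z) |k|^2, so the inequality reads |d_X h|^2 |k|^4
   <= |f|^2 |e|^2, where |f| <= |k|. *)
have := cauchy_schwarz oO Af Ae; rewrite (He f Af fz) df cabsM cabs_real gtr0_norm // exprMn => cs.
rewrite lecR ler_pdivlMr // -(ler_pM2r k0) -mulrA -expr2 mulrC [X in _ <= X]mulrC.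
apply: le_trans (_ : nq Om f * nq Om e <= _); first by rewrite mulrC.
by apply: ler_wpM2r => //; exact: nq_ge0.
Qed.

(** [change_of_variables_le] with the weight |f|^2; the squared modulus of the complex determinant
    is the real Jacobian. *)
Lemma A2_transport n (U V : set 'rV[C]_n.+1) (psi phi : 'rV[C]_n.+1 -> 'rV[C]_n.+1) f : open U -> open V ->
  holomorphic_on U psi -> holomorphic_on V phi ->
  (forall z, U z -> V (psi z) /\ phi (psi z) = z) ->
  inA2 V f -> let G := fun z => f (psi z) * \det (Jmx psi z) in
  inA2 U G /\ nq U G <= 4 ^+ n.+1 * nq V f.
Proof.
move=> oU oV hpsi hphi psiK Af G.
have Gh : holomorphic_on U G.
  move=> z Uz; have [Vz _] := psiK z Uz.
  have d1 : differentiable (f \o psi) z := differentiable_comp (hpsi z Uz) (A2_hol Af Vz).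
  by have [d _] := holM d1 (hol_Jdet oU hpsi Uz).
have GE : energy U G = (\int[lebesgue_measure_Cn R n.+1]_(x in pre U)
    (sq f (psi (toCn x)) * cabs (\det (Jmx psi (toCn x))) ^+ 2)%:E)%E.
  by apply: eq_integral => x _; rewrite /sq /G cabsM exprMn.
have mG := measurable_sq oU Gh.
have EG : (energy U G <= (4 ^+ n.+1 * nq V f)%:E)%E.
  rewrite EFinM -(nqE Af) GE.
  apply: (change_of_variables_le oU oV hpsi hphi psiK (rcont_sq (A2_hol Af)) (sq_ge0 f)).
  have -> // : (fun x : TT n.+1 => (sq f (psi (toCn x)) * cabs (\det (Jmx psi (toCn x))) ^+ 2)%:E) =
     (fun x => (sq G (toCn x))%:E).
  by apply/funext => x; rewrite /sq /G cabsM exprMn.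
have AG : inA2 U G by apply/A2P; split=> //; apply: le_lt_trans EG _; rewrite ltry.
by split=> //; rewrite -lee_fin -(nqE AG).
Qed.

Lemma homogeneous_metric_upper n (Om : set 'rV[C]_n.+1) p : bounded_domain Om -> Om p ->
  exists2 c : R, 0 <= c & forall phi psi q Y, holomorphic_on Om phi -> holomorphic_on Om psi ->
    (forall z, Om z -> Om (phi z) /\ psi (phi z) = z) -> (forall z, Om z -> Om (psi z) /\ phi (psi z) = z) ->
    Om q -> phi q = p -> bergman_metric Om q Y Y <= (c * rn ('d phi q Y) ^+ 2)%:C.
Proof.
move=> bO Op; have oO : open Om by case: bO => -[].
have A1 := bounded_domain_one bO.
have [r [L [_ L0 _ [_ b _] _]]] := functional_bounds oO Op.
pose A : R := 4 ^+ n.+1; have A0 : 0 < A by rewrite exprn_gt0.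
(* The derivative at p contributes L^2, each of the two transports A, and the constant function 1
   its squared norm. *)
exists (L ^+ 2 * A ^+ 2 * nq Om (fun=> 1)).
  by rewrite mulr_ge0 ?nq_ge0 // mulr_ge0 ?sqr_ge0.
move=> phi psi q Y hphi hpsi phiK psiK Oq phiq.
have [e [k [Ae [Hk k0] eq0 He ->]]] := bergman_metric_extremal Y bO Oq.
rewrite lecR.
have psip : psi p = q by rewrite -phiq; exact: (phiK q Oq).2.
set Z := 'd phi q Y.
have [AG nG] := A2_transport oO oO hpsi hphi psiK Ae.
have [AH nH] := A2_transport oO oO hphi hpsi phiK A1.
set G := (fun z => e (psi z) * _) in AG nG; set H := (fun z => 1 * _) in AH nH.
have JJ : Jmx phi q *m Jmx psi p = 1%:M.
  rewrite -phiq; apply: (Jmx_inverse oO Oq) => [w Ow||].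
  - exact: (phiK w Ow).2.
  - exact: hphi.
  - by rewrite phiq; exact: hpsi.
(* The two determinants are inverse to each other and cancel when [h2] and [h4] are multiplied. *)
pose a := cabs (\det (Jmx phi q)); pose a' := cabs (\det (Jmx psi p)).
have aa : a * a' = 1 by rewrite -cabsM -det_mulmx JJ det1 cabs1.
have a0 : 0 < a.
  rewrite lt_neqAle cabs_ge0 andbT eq_sym; apply/eqP => h.
  by move: aa; rewrite h mul0r => /eqP; rewrite eq_sym oner_eq0.
(* Since e vanishes at q, the derivative of the determinant drops out of the product rule, and the
   derivative of e along Y is |e|^2. *)
have dG : dd G p Z = (nq Om e)%:C * \det (Jmx psi p).
  have de : differentiable e (psi p) by rewrite psip; exact: A2_hol Ae _ Oq.
  have d1 : differentiable (e \o psi) p := differentiable_comp (hpsi p Op) de.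
  have [_ ->] := holM d1 (hol_Jdet oO hpsi Op).
  have -> : dd (e \o psi) p Z = dd e q Y.
    have h := dd_comp Z (hpsi p Op) de; rewrite h psip; congr (dd e q _).
    by rewrite diff_Jmx /Z diff_Jmx -mulmxA JJ mulmx1.
  by rewrite -(He e Ae eq0) (dot_self Ae) /= psip eq0 mul0r add0r mulrC.
have Hq : H q = \det (Jmx phi q) by rewrite /H mul1r.
clearbody Z G H.
have h1 : nq Om e * a' <= L * rn Z * nrm Om G.
  by have := b G Z AG; rewrite dG cabsM cabs_real ger0_norm ?nq_ge0.
(* Squaring [h1] brings in |G|^2 <= A |e|^2; one factor |e|^2 is then cancelled when it is
   positive. *)
have h2 : nq Om e * a' ^+ 2 <= L ^+ 2 * A * rn Z ^+ 2.
  have [->|e0] := eqVneq (nq Om e) 0.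
    by rewrite mul0r; apply: mulr_ge0 (sqr_ge0 _); apply: mulr_ge0 (sqr_ge0 _) (ltW A0).
  have ep : 0 < nq Om e by rewrite lt_neqAle eq_sym e0 nq_ge0.
  have ea : 0 <= nq Om e * a' by rewrite mulr_ge0 ?nq_ge0 ?cabs_ge0.
  have := lerXn2r 2 ea (mulr_ge0 (mulr_ge0 L0 (rn_ge0 Z)) (nrm_ge0 _ _)) h1.
  rewrite !exprMn sqr_nrm => h3; rewrite -(ler_pM2l ep).
  have -> : nq Om e * (nq Om e * a' ^+ 2) = nq Om e ^+ 2 * a' ^+ 2 by ring.
  apply: le_trans h3 _.
  have -> : nq Om e * (L ^+ 2 * A * rn Z ^+ 2) = L ^+ 2 * rn Z ^+ 2 * (A * nq Om e) by ring.
  by apply: ler_wpM2l => //; rewrite mulr_ge0 ?sqr_ge0.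
(* H takes at q the value of the Jacobian determinant of phi, bounded by Cauchy-Schwarz against the
   kernel function at q. *)
have h4 : a ^+ 2 <= A * nq Om (fun=> 1) * nq Om k.
  have [Ak Hk'] := Hk; have := cauchy_schwarz oO AH Ak; rewrite (Hk' _ AH) Hq -/a => h5.
  by apply: le_trans h5 _; apply: ler_wpM2r => //; exact: nq_ge0.
rewrite ler_pdivrMr //.
have -> : nq Om e = nq Om e * a' ^+ 2 * a ^+ 2.
  by rewrite -mulrA -exprMn [a' * a]mulrC aa expr1n mulr1.
have -> : L ^+ 2 * A ^+ 2 * nq Om (fun=> 1) * rn Z ^+ 2 * nq Om k =
   L ^+ 2 * A * rn Z ^+ 2 * (A * nq Om (fun=> 1) * nq Om k) by ring.
have p1 : 0 <= nq Om e * a' ^+ 2 := mulr_ge0 (nq_ge0 _ _) (sqr_ge0 _).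
exact: ler_pM p1 (sqr_ge0 _) h2 h4.
Qed.

(** [schwarz_metric] for (F_j - F_j z) / (2 M), with j a coordinate at which the sup norm of the
    derivative is attained; the difference of two values is at most 2 M. *)
Lemma bounded_map_metric n m (Om : set 'rV[C]_n.+1) (F : 'rV[C]_n.+1 -> 'rV[C]_m.+1) (M : R) z X :
  bounded_domain Om -> 0 < M -> holomorphic_on Om F -> (forall w, Om w -> rn (F w) <= M) -> Om z ->
  (rn ('d F z X) ^+ 2)%:C <= ((2 * M) ^+ 2)%:C * bergman_metric Om z X X.
Proof.
move=> bO M0 Fh FM Oz; have M20 : 0 < 2 * M by rewrite mulr_gt0.
have [j ->] := rn_attained ('d F z X) (ltn0Sn m).
have [dj <-] := hol_coord j (Fh z Oz).
pose k : C := ((2 * M)^-1)%:C.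
pose h w := k * (F w 0 j - F z 0 j).
have hE w : Om w -> differentiable h w /\ forall v, dd h w v = k * dd (fun w => F w 0 j) w v.
  move=> Ow; have [d1 e1] := hol_coord j (Fh w Ow); have [d2 e2] := hol_cst (F z 0 j) w.
  have [d3 e3] := holB d1 d2; have [d4 e4] := hol_scale k d3.
  by split=> // v; rewrite e4 e3 e2 subr0.
have ck : cabs k = (2 * M)^-1 by rewrite /k cabs_real ger0_norm // invr_ge0 ltW.
have h1 w : Om w -> cabs (h w) <= 1.
  move=> Ow; rewrite /h cabsM ck mulrC ler_pdivrMr // mul1r mulrDl mul1r.
  by apply: le_trans (cabsD _ _) _; rewrite cabsN; apply: lerD; exact: le_trans (cabs_le_rn _ _) (FM _ _).
have hz : h z = 0 by rewrite /h subrr mulr0.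
have low := schwarz_metric X bO Oz (fun w Ow => (hE w Ow).1) h1 hz.
rewrite (hE z Oz).2 cabsM ck exprMn in low.
have -> : cabs (dd (fun w => F w 0 j) z X) ^+ 2 =
    (2 * M) ^+ 2 * ((2 * M)^-1 ^+ 2 * cabs (dd (fun w => F w 0 j) z X) ^+ 2).
  by rewrite mulrA exprVn divff ?mul1r // expf_neq0 // gt_eqF.
rewrite rmorphM; apply: ler_wpM2l low.
by rewrite ler0c sqr_ge0.
Qed.

End comparison.

Theorem corollary4p5 (R : realType) (m : nat) (m_gt0 : (0 < m)%N)
    (Omega2 : set 'rV[R[i]]_m) :
  bounded_domain Omega2 -> homogeneous Omega2 ->
  exists2 C : R, 0 < C &
    forall (n : nat) (Omega1 : set 'rV[R[i]]_n)
        (f : 'rV[R[i]]_n -> 'rV[R[i]]_m),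
      (0 < n)%N ->
      bounded_domain Omega1 ->
      holomorphic_on Omega1 f ->
      (forall z, Omega1 z -> Omega2 (f z)) ->
      forall z X : 'rV[R[i]]_n, Omega1 z ->
        bergman_metric Omega2 (f z) ('d f z X) ('d f z X)
          <= C%:C * bergman_metric Omega1 z X X.
Proof.
case: m m_gt0 Omega2 => // m _ Omega2 bO2 hom2.
have [p Op] : Omega2 !=set0 by case: bO2 => -[].
have [M M0 HM] := bounded_rn bO2.2.
have [c c0 Hc] := homogeneous_metric_upper bO2 Op.
(* The added 1 makes the constant positive also when c = 0; it is absorbed below by the
   nonnegativity of the metric on [Omega1]. *)
exists (c * (2 * M) ^+ 2 + 1); first by rewrite ltr_wpDl // mulr_ge0 // sqr_ge0.
move=> n Omega1 f; case: n Omega1 f => // n Omega1 f _ bO1 fh fO z X Oz.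
have [phi [psi [hphi hpsi phiK psiK]] phiq] := hom2 (f z) p (fO z Oz) Op.
have up := Hc phi psi (f z) ('d f z X) hphi hpsi phiK psiK (fO z Oz) phiq.
apply: le_trans up _.
have Fh : holomorphic_on Omega1 (phi \o f).
  by move=> w Ow; exact: (differentiable_comp (fh w Ow) (hphi _ (fO w Ow))).
have FM w : Omega1 w -> rn ((phi \o f) w) <= M.
  by move=> Ow; exact: HM (phiK _ (fO w Ow)).1.
have low := bounded_map_metric X bO1 M0 Fh FM Oz.
rewrite -(diff_comp_apply X (fh z Oz) (hphi _ (fO z Oz))) in low.
move: (rn _) low => r low.
(* Read off from [low], whose left side is a square. *)
have h0 : 0 <= bergman_metric Omega1 z X X.
  rewrite -(pmulr_rge0 _ (_ : 0 < ((2 * M) ^+ 2)%:C)); last by rewrite ltcR exprn_gt0 // mulr_gt0.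
  by apply: le_trans low; rewrite ler0c sqr_ge0.
rewrite rmorphD /= mulrDl mul1r -[X in X <= _]addr0; apply: lerD => //.
have cM x : (c * x)%:C = c%:C * x%:C :> R[i] by exact: rmorphM.
by rewrite !cM -mulrA; apply: ler_wpM2l low; rewrite ler0c.
Qed.
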